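(* Let $1\le m\le 4$ and let $f,g\in H^{\otimes m}$ be symmetric. Let $C$ be the covariance matrix of the random vector $(F,G)=(I_m(f),I_m(g))$. Then $(F,G)$ does not admit a density (i.e. its law is not absolutely continuous with respect to Lebesgue measure on $\mathbb R^2$) if and only if $\det C=0$. In other words, the vector $(F,G)$ does not admit a density if and only if its components are proportional.
   Context: $H$ is a real separable Hilbert space and $(W(h),h\in H)$ is an isonormal process on a probability space $(\Omega,\mathcal F,P)$, i.e. a centered Gaussian family with $E[W(h)W(g)]=\langle h,g\rangle_H$; $\mathcal F$ is generated by $W$. $I_m$ denotes the multiple Wiener-Itô integral of order $m$ with respect to $W$: on symmetric elements of $H^{\otimes m}$ it is the linear map with $I_m(h^{\otimes m})=H_m(W(h))$ for $\Vert h\Vert=1$ ($H_m$ the monic Hermite polynomial of degree $m$), and it satisfies $E[I_m(f)^2]=m!\Vert f\Vert^2_{H^{\otimes m}}$ for symmetric $f$. ''Proportional'' means linearly dependent (almost surely, over $\mathbb R$). *)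

(* Defs.v *)
From HB Require Import structures.
From mathcomp Require Export all_boot all_order all_algebra all_fingroup.
From mathcomp Require Export all_classical all_reals all_analysis.
From mathcomp Require Import sesquilinear.

Set Implicit Arguments.
Unset Strict Implicit.
Unset Printing Implicit Defensive.
Import Order.TTheory GRing.Theory Num.Theory.
Import numFieldNormedType.Exports.
Local Open Scope classical_set_scope.
Local Open Scope ring_scope.

HB.mixin Record NormedModule_hasInner (R : realType) V of NormedModule R V := {
  inner : {dot V for idfun} ;
  inner_normE : forall x : V, inner x x = `|x| ^+ 2 }.

#[short(type="hilbertType")]
HB.structure Definition Hilbert (R : realType) :=
  { V of CompleteNormedModule R V & NormedModule_hasInner R V }.

Definition separable_space (T : topologicalType) :=
  exists2 D : set T, countable D & dense D.

Section TensorPower.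
Context {R : realType} {H T : hilbertType R} {m : nat}.
Implicit Type tens : ('I_m -> H) -> T.

Definition multilinear tens := forall (i : 'I_m) (h : 'I_m -> H),
  linear (fun x : H => tens (dfwith h i x)).

Definition tensor_span tens : set T :=
  [set x | exists n (c : 'I_n -> R) (h : 'I_n -> 'I_m -> H),
             x = \sum_(k < n) c k *: tens (h k)].

(* T, with tens, is the order m Hilbert tensor power of H: these properties
   determine it up to a unique isometric isomorphism. *)
Definition tensor_power tens :=
  [/\ multilinear tens,
      forall h k, inner (tens h) (tens k) = \prod_(i < m) inner (h i) (k i)
    & dense (tensor_span tens)].

(* U is the action of s on T: by density of the span, it is unique. *)
Definition symmetric_tensor tens (f : T) := forall s : 'S_m,
  exists U : {linear T -> T},
    [/\ continuous U, forall h, U (tens h) = tens (h \o s) & U f = f].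

End TensorPower.

(* Monic Hermite polynomials: orthogonal for the standard normal law. *)
Fixpoint hermite (R : realType) (n : nat) : {poly R} :=
  if n is k.+1 then 'X * hermite R k - (hermite R k)^`() else 1.

Section Probability.
Context {d : measure_display} {Omega : measurableType d} {R : realType}.
Context (P : probability Omega R).

(* normal_prob m 0 is not a point mass, whence the separate case. *)
Definition gaussian (X : Omega -> R) := exists m s : R,
  forall A : set R, measurable A ->
    pushforward P X A = if s == 0 then \d_m A else normal_prob m s A.

Definition gaussian_family (I : Type) (X : I -> {RV P >-> R}) :=
  forall n (i : 'I_n -> I) (c : 'I_n -> R),
    gaussian (fun w => \sum_(k < n) c k * X (i k) w).

Definition isonormal (H : hilbertType R) (W : H -> {RV P >-> R}) :=
  [/\ gaussian_family W, forall h, 'E_P[W h]%E = 0%E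
    & forall h g, 'E_P[W h \* W g]%E = (inner h g)%:E].

Definition generated_by (I : Type) (X : I -> {RV P >-> R}) :=
  @measurable d Omega =
    <<s \bigcup_i preimage_set_system setT (X i) measurable >>.

(* These three clauses determine I up to null sets on symmetric tensors, as the
   tensors h^(otimes m) span a dense subspace of them; I is unconstrained on
   the other elements of T. *)
Definition multiple_integral (H T : hilbertType R) (m : nat)
    (W : H -> {RV P >-> R}) (tens : ('I_m -> H) -> T)
    (I : T -> {RV P >-> R}) :=
  [/\ forall (a : R) (f g : T),
        symmetric_tensor tens f -> symmetric_tensor tens g ->
        {ae P, forall w, I (a *: f + g) w = a * I f w + I g w},
      forall h : H, `|h| = 1 ->
        {ae P, forall w, I (tens (fun=> h)) w = (hermite R m).[W h w]}
    & forall f : T, symmetric_tensor tens f ->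
        'E_P[I f \* I f]%E = (m`!%:R * `|f| ^+ 2)%:E].

Definition covariance_matrix n (X : n.-tuple {RV P >-> R}) : 'M[R]_n :=
  \matrix_(i, j) fine (covariance P (tnth X i) (tnth X j)).

Definition has_joint_density (F G : {RV P >-> R}) :=
  pushforward P (fun w => (F w, G w)) `<<
    (@lebesgue_measure R \x @lebesgue_measure R)%E.

Definition proportional (F G : {RV P >-> R}) := exists a b : R,
  (a, b) != (0, 0) /\ {ae P, forall w, a * F w + b * G w = 0}.

End Probability.

(* Main.v *)
(* If f and g are linearly dependent then so are F and G, the covariance matrix
   is singular, and the law of (F, G) lives on a line. Otherwise, by
   polarization, there are orthonormal e1, e2 such that the polynomials
   p(s) = <f, (e1 + s e2)^m> and q(s) = <g, (e1 + s e2)^m> are not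
   proportional. Condition on the W(h) with h orthogonal to e1 and e2, which are
   independent of W(e1) and W(e2): F and G become polynomials in W(e1), W(e2)
   of degree m, limits of those given by finite Hermite expansions. In the
   coordinates W(e1) = t, W(e2) = t s their terms of degree m in t are p(s) and
   q(s), whatever the conditioning, so that the Jacobian has the leading
   coefficient m (p q' - q p') in t, which is not 0. A polynomial map of the
   plane with nonzero Jacobian pulls null sets back to null sets. *)

From HB Require Import structures.
Require Import Defs.
From mathcomp Require Import measurable_realfun.
From mathcomp Require Import ring lra.
Import Order.TTheory GRing.Theory Num.Theory.
Import numFieldNormedType.Exports.
Set Implicit Arguments.
Unset Strict Implicit.
Unset Printing Implicit Defensive.
Local Open Scope classical_set_scope.
Local Open Scope ring_scope.

(** * Hilbert spaces and symmetric tensors *)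

(** Existence of a density is a statement about null sets only. So conditioning needs no conditional
    expectation: the probability space is viewed as a product, and the normal laws of [W e1] and
    [W e2] are exchanged for Lebesgue measure. Independence must come from covariances and Gaussian
    linear combinations. Trigonometric functions of the [W h] suffice, since the bounded functions
    that may multiply an orthogonality relation are closed under products and bounded limits, and
    thus include the indicators. Almost sure limits are harmless: polynomials of bounded degree that
    converge almost everywhere have convergent coefficients, so the leading terms p and q survive.
    Null sets are pulled back without a change of variables formula: near a point where the Jacobian
    and one partial derivative are nonzero, difference quotients give one-dimensional expansion
    estimates, and Fubini does the rest. *)

Section InnerProduct.
Context {R : realType} {H : hilbertType R}.
Implicit Types (x y z : H) (a : R).

Lemma innerC x y : inner x y = inner y x.
Proof. by have := hermC inner x y; rewrite /= expr0 mul1r. Qed.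

Lemma innerDl x y z : inner (x + y) z = inner x z + inner y z.
Proof. exact: linearDl. Qed.

Lemma innerZl a x z : inner (a *: x) z = a * inner x z.
Proof. exact: linearZl_LR. Qed.

Lemma innerDr x y z : inner z (x + y) = inner z x + inner z y.
Proof. by rewrite innerC innerDl !(innerC _ z). Qed.

Lemma innerZr a x z : inner z (a *: x) = a * inner z x.
Proof. by rewrite innerC innerZl (innerC z). Qed.

Lemma inner0l z : inner 0 z = 0.
Proof. by have := innerZl 0 0 z; rewrite scale0r mul0r. Qed.

Lemma inner0r z : inner z 0 = 0.
Proof. by rewrite innerC inner0l. Qed.

Lemma innerNl x z : inner (- x) z = - inner x z.
Proof. by rewrite -scaleN1r innerZl mulN1r. Qed.

Lemma innerBl x y z : inner (x - y) z = inner x z - inner y z.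
Proof. by rewrite innerDl innerNl. Qed.

Lemma innerBr x y z : inner z (x - y) = inner z x - inner z y.
Proof. by rewrite innerC innerBl !(innerC _ z). Qed.

Lemma inner_suml I (r : seq I) (Q : pred I) (F : I -> H) z :
  inner (\sum_(i <- r | Q i) F i) z = \sum_(i <- r | Q i) inner (F i) z.
Proof.
by apply: (big_morph (inner^~ z)) => [x y|]; [exact: innerDl|exact: inner0l].
Qed.

Lemma inner_sumr I (r : seq I) (Q : pred I) (F : I -> H) z :
  inner z (\sum_(i <- r | Q i) F i) = \sum_(i <- r | Q i) inner z (F i).
Proof. by rewrite innerC inner_suml; apply: eq_bigr => i _; rewrite innerC. Qed.

Lemma inner_ge0 x : 0 <= inner x x.
Proof. by rewrite inner_normE sqr_ge0. Qed.

Lemma inner_eq0 x : (inner x x == 0) = (x == 0).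
Proof. by rewrite inner_normE sqrf_eq0 normr_eq0. Qed.

Lemma inner_gt0 x : x != 0 -> 0 < inner x x.
Proof. by move=> x0; rewrite lt_def inner_eq0 x0 inner_ge0. Qed.

Lemma Cauchy_Schwarz x y : `|inner x y| <= `|x| * `|y|.
Proof.
have [->|y0] := eqVneq y 0; first by rewrite inner0r !normr0 mulr0.
have yy := inner_gt0 y0.
rewrite -(@ler_pXn2r _ 2%N)// ?nnegrE ?mulr_ge0// exprMn -!inner_normE.
rewrite -normrX ger0_norm ?sqr_ge0//.
have := inner_ge0 (x - (inner x y / inner y y) *: y).
rewrite innerBl !innerBr !innerZl !innerZr (innerC y x).
rewrite (_ : _ - _ = (inner x x * inner y y - inner x y ^+ 2) / inner y y).
  by rewrite pmulr_lge0 ?invr_gt0// subr_ge0.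
by field; rewrite gt_eqF.
Qed.

End InnerProduct.

Lemma continuous_bigsum (K : numFieldType) (V : normedModType K) (T : topologicalType)
    (I : Type) (r : seq I) (f : I -> T -> V) :
  (forall i, continuous (f i)) -> continuous (fun x => \sum_(i <- r) f i x).
Proof.
move=> cf; elim: r => [|i r IHr].
  rewrite (_ : (fun x => _) = fun=> 0); first by move=> x; exact: cvg_cst.
  by apply/funext => x; rewrite big_nil.
rewrite (_ : (fun x => _) = fun x => f i x + \sum_(i <- r) f i x).
  by move=> x; apply: cvgD; [exact: cf|exact: IHr].
by apply/funext => x; rewrite big_cons.
Qed.

Lemma cvg_bigsum (K : numFieldType) (V : normedModType K) (T : Type)
    (F : set_system T) (FF : Filter F) (I : eqType) (r : seq I) (f : I -> T -> V) (l : I -> V) :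
  (forall i, i \in r -> f i @ F --> l i) ->
  (fun x => \sum_(i <- r) f i x) @ F --> \sum_(i <- r) l i.
Proof.
elim: r => [|i r IHr] fl.
  rewrite big_nil (_ : (fun x => _) = fun=> 0); first exact: cvg_cst.
  by apply/funext => x; rewrite big_nil.
rewrite big_cons (_ : (fun x => _) = fun x => f i x + \sum_(i <- r) f i x).
  apply: cvgD; first by apply: fl; rewrite mem_head.
  by apply: IHr => j jr; apply: fl; rewrite inE jr orbT.
by apply/funext => x; rewrite big_cons.
Qed.

(** For nonempty [A], toggling a fixed element of [A] pairs its subsets with opposite signs. *)
Lemma sum_subset_sign (R : comNzRingType) (J : finType) (A : {set J}) :
  \sum_(B : {set J} | B \subset A) (-1) ^+ #|B| = (A == finset.set0)%:R :> R.
Proof.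
have [->|] := eqVneq A finset.set0.
  by rewrite (big_pred1 finset.set0) ?cards0 ?expr0// => B; rewrite finset.subset0.
move=> /set0Pn[a aA].
rewrite (bigID (fun B : {set J} => a \in B))/=.
rewrite (reindex_onto (fun B => a |: B) (fun B => B :\ a))/=; last first.
  by move=> B /andP[_ aB]; rewrite finset.setD1K.
apply/eqP; rewrite addr_eq0 -sumrN; apply/eqP; apply: eq_big => B.
  rewrite finset.subUset finset.sub1set aA finset.setU11/= andbT; case: (boolP (a \in B)) => aB.
    rewrite [X in _ && X](_ : _ = false) ?andbF//; apply/negbTE/eqP => E.
    by have := finset.setD11 a (a |: B); rewrite E aB.
  by rewrite finset.setU1K// eqxx andbT.
move=> /andP[/andP[_ _] /eqP E].
by rewrite cardsU1 -E finset.setD11/= exprS mulN1r E.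
Qed.

(** Ryser's formula for the permanent. Expand each product over the self-maps [f] of ['I_m]; by
    [sum_subset_sign] the signed count of the sets [B] that contain the image of [f] vanishes unless
    [f] is onto, that is, a permutation. *)
Lemma permanent_polarization (R : comNzRingType) (m : nat) (A : 'I_m -> 'I_m -> R) :
  \sum_(s : 'S_m) \prod_(i < m) A (s i) i =
  \sum_(B : {set 'I_m}) (-1) ^+ #|~: B| * \prod_(i < m) \sum_(j in B) A j i.
Proof.
have E (B : {set 'I_m}) : \prod_(i < m) \sum_(j in B) A j i =
    \sum_(f : {ffun 'I_m -> 'I_m} | f @: 'I_m \subset B) \prod_(i < m) A (f i) i.
  rewrite (bigA_distr_big _ (fun i j => A j i)).
  apply: eq_bigl => f; apply/ffun_onP/fintype.subsetP => [fB _ /imsetP[i _ ->]//|fB i].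
  by apply: fB; apply: imset_f; rewrite inE.
under [RHS]eq_bigr do rewrite E mulr_sumr.
rewrite (exchange_big_dep xpredT)//=.
transitivity (\sum_(f : {ffun 'I_m -> 'I_m} | injectiveb f) \prod_(i < m) A (f i) i).
  rewrite (reindex_onto (@pval _) (fun f => insubd (1%g : 'S_m) f))/=; last first.
    by move=> f inj_f; rewrite val_insubd inj_f.
  apply: eq_big => s; last by move=> _; apply: eq_bigr => i _; rewrite pvalE.
  by rewrite valKd eqxx andbT (valP s).
rewrite big_mkcond; apply: eq_bigr => f _; rewrite -mulr_suml.
transitivity ((~: (f @: 'I_m) == finset.set0)%:R * \prod_(i < m) A (f i) i).
  case: injectiveP => inj_f.
    rewrite (_ : _ == _) ?mul1r//; apply/eqP/finset.setP => i; rewrite !inE.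
    apply/negbTE; rewrite negbK; have [g gK Kg] := injF_bij inj_f.
    by rewrite -(Kg i); apply: imset_f; rewrite inE.
  case: eqP => [fT|_]; last by rewrite mul0r.
  case: inj_f.
  have : #|f @: 'I_m| == #|'I_m|.
    by rewrite -[f @: 'I_m]finset.setCK fT finset.setC0 cardsT.
  by move=> /imset_injP inj x y; apply: inj; rewrite inE.
congr (_ * _); rewrite -sum_subset_sign.
rewrite (reindex_inj (inv_inj (@finset.setCK _)))/=.
by apply: eq_bigl => B; rewrite finset.setCS.
Qed.

Lemma dense_approx (R : realType) (T : hilbertType R) (D : set T) (O : set T) (f : T) :
  dense D -> nbhs f O -> exists2 x, D x & O x.
Proof.
move=> dD fO; have fO' : (interior O) f by exact: nbhs_singleton (nbhs_interior fO).
have [x [Ox Dx]] := dD (interior O) (ex_intro _ f fO') (@open_interior _ O).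
by exists x => //; exact: interior_subset Ox.
Qed.

Lemma norm_lt_nbhs (R : realType) (T : hilbertType R) (f : T) (e : R) : 0 < e ->
  \forall x \near f, `|f - x| < e.
Proof.
move=> e0; have := nbhsx_ballx f e e0.
by apply: filterS => x; rewrite -ball_normE.
Qed.

Section TensorPowers.
Context {R : realType} {H T : hilbertType R} {m : nat}.
Variable tens : ('I_m -> H) -> T.
Hypothesis tensT : tensor_power tens.
Implicit Types (x y f g : T) (h k : 'I_m -> H) (u v : H).

Let inner_tens h k : inner (tens h) (tens k) = \prod_(i < m) inner (h i) (k i).
Proof. by case: tensT. Qed.

Let dense_span : dense (tensor_span tens).
Proof. by case: tensT. Qed.

(** If [x] were nonzero, some [y] in [D] would be closer to [x] than 0 is, while orthogonality makes
    [|x - y|] at least [|x|]. *)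
Lemma inner_dense_eq0 (D : set T) x : dense D -> (forall y, D y -> inner x y = 0) -> x = 0.
Proof.
move=> dD xD; apply/eqP/negPn/negP => x0; have nx : 0 < `|x| by rewrite normr_gt0.
have [y Dy yx] := dense_approx dD (norm_lt_nbhs x nx).
have : `|x - y| ^+ 2 < `|x| ^+ 2 by rewrite ltr_pXn2r// nnegrE.
rewrite -!inner_normE innerBl !innerBr (innerC y x) (xD _ Dy) subr0 sub0r opprK.
by rewrite ltNge lerDl inner_ge0.
Qed.

Lemma tens_eq0 x : (forall k, inner x (tens k) = 0) -> x = 0.
Proof.
move=> x0; apply: (inner_dense_eq0 dense_span) => _ [n [c [h ->]]].
by rewrite inner_sumr big1// => i _; rewrite innerZr x0 mulr0.
Qed.

(** Tensor identities are tested against pure tensors, where they become identities between products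
    of scalars. *)
Lemma tens_inj x y : (forall k, inner x (tens k) = inner y (tens k)) -> x = y.
Proof.
move=> xy; apply/eqP; rewrite -subr_eq0; apply/eqP/tens_eq0 => k.
by rewrite innerBl xy subrr.
Qed.

Definition tpow u : T := tens (fun=> u).

Lemma inner_tpow u v : inner (tpow u) (tpow v) = inner u v ^+ m.
Proof. by rewrite inner_tens prodr_const card_ord. Qed.

Lemma tpowZ a u : tpow (a *: u) = a ^+ m *: tpow u.
Proof.
apply: tens_inj => k; rewrite innerZl !inner_tens.
under eq_bigr do rewrite innerZl.
by rewrite big_split/= prodr_const card_ord.
Qed.

(** After testing against a pure tensor this is [permanent_polarization] for the matrix of inner
    products. It makes every symmetrized pure tensor a combination of powers. *)
Lemma tens_polarization h : \sum_(s : 'S_m) tens (h \o s) =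
  \sum_(B : {set 'I_m}) (-1) ^+ #|~: B| *: tpow (\sum_(j in B) h j).
Proof.
apply: tens_inj => k; rewrite !inner_suml.
under eq_bigr do rewrite inner_tens.
rewrite (permanent_polarization (fun j i => inner (h j) (k i))).
apply: eq_bigr => B _; rewrite innerZl inner_tens; congr (_ * _).
by apply: eq_bigr => i _; rewrite inner_suml.
Qed.

(** Unit vectors, because [multiple_integral] prescribes values on powers of unit vectors. *)
Definition power_span : set T := [set x | exists2 s : seq (R * H),
  (forall p, p \in s -> `|p.2| = 1) & x = \sum_(p <- s) p.1 *: tpow p.2].

Lemma power_span_lin a x y : power_span x -> power_span y -> power_span (a *: x + y).
Proof.
move=> [s s1 ->] [t t1 ->]; exists ([seq (a * p.1, p.2) | p <- s] ++ t).
  by move=> p; rewrite mem_cat => /orP[/mapP[q qs ->]|]; [exact: s1 qs|exact: t1].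
rewrite big_cat big_map/= scaler_sumr; congr (_ + _).
by apply: eq_bigr => p _; rewrite scalerA.
Qed.

Lemma power_span0 : power_span 0.
Proof. by exists [::]; rewrite ?big_nil. Qed.

Lemma power_span_sum I (r : seq I) (Q : pred I) (F : I -> T) :
  (forall i, power_span (F i)) -> power_span (\sum_(i <- r | Q i) F i).
Proof.
move=> HF; elim/big_ind: _ => //; first exact: power_span0.
by move=> x y xs ys; have := power_span_lin 1 xs ys; rewrite scale1r.
Qed.

Lemma power_spanZ a x : power_span x -> power_span (a *: x).
Proof. by move=> xs; have := power_span_lin a xs power_span0; rewrite addr0. Qed.

Hypothesis m_gt0 : (0 < m)%N.

Lemma power_span_tpow u : power_span (tpow u).
Proof.
have [->|u0] := eqVneq u 0.
  by rewrite -(scale0r (0 : H)) tpowZ expr0n gtn_eqF// scale0r; exact: power_span0.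
have nu : `|u| != 0 by rewrite normr_eq0.
exists [:: (`|u| ^+ m, `|u|^-1 *: u)].
  move=> p; rewrite inE => /eqP -> /=.
  by rewrite normrZ normfV normr_id mulVf.
by rewrite big_seq1 -tpowZ/= scalerA mulfV// scale1r.
Qed.

Definition power_approx f := forall e : R, 0 < e -> exists2 x, power_span x & `|f - x| < e.

Lemma power_approx_lin a f g : power_approx f -> power_approx g -> power_approx (a *: f + g).
Proof.
move=> af ag e e0; have e2 : 0 < e / 2 by rewrite divr_gt0.
have a1 : 0 < `|a| + 1 by rewrite ltr_wpDl.
have [x xs fx] := af (e / 2 / (`|a| + 1)) (divr_gt0 e2 a1).
have [y ys gy] := ag _ e2; exists (a *: x + y); first exact: power_span_lin.
rewrite opprD addrACA -scalerBr (le_lt_trans (ler_normD _ _))//.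
rewrite [ltRHS](splitr e) ltr_leD ?(ltW gy)// normrZ.
have fx' : `|f - x| * (`|a| + 1) < e / 2 by rewrite -ltr_pdivlMr.
by apply: le_lt_trans fx'; rewrite mulrC ler_wpM2l// lerDl.
Qed.

Lemma power_approx_eq0 f : power_approx f -> (forall u, inner f (tpow u) = 0) -> f = 0.
Proof.
move=> af f0; apply/eqP/negPn/negP => fn0.
have nf : 0 < `|f| by rewrite normr_gt0.
have [x [s _ xE] fx] := af _ nf.
have : `|f - x| ^+ 2 < `|f| ^+ 2 by rewrite ltr_pXn2r// nnegrE.
have fx0 : inner f x = 0.
  by rewrite xE inner_sumr big1// => p _; rewrite innerZr f0 mulr0.
rewrite -!inner_normE innerBl !innerBr (innerC x f) fx0 subr0 sub0r opprK.
by rewrite ltNge lerDl inner_ge0.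
Qed.

Section SymmetricTensor.
Variable f : T.
Hypothesis symf : symmetric_tensor tens f.

(** The mean [S] of the permutation operators of [f] is continuous, fixes [f], and sends pure
    tensors to combinations of powers by polarization. It therefore turns an approximation of [f] in
    the span of pure tensors into one by powers. *)
Lemma symmetric_approx : power_approx f.
Proof.
move=> e e0; have /choice[U HU] := symf.
have mf0 : (m`!%:R : R) != 0 by rewrite pnatr_eq0 -lt0n fact_gt0.
pose S x : T := (m`!%:R)^-1 *: \sum_(s : 'S_m) U s x.
have Sf : S f = f.
  rewrite /S (eq_bigr (fun=> f)) => [|s _]; last by have [] := HU s.
  by rewrite sumr_const card_Sn -[f *+ _]scaler_nat scalerA mulVf// scale1r.
have cS : continuous S.
  move=> x; apply: cvgZr; apply: continuous_bigsum => s.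
  by have [cU _ _] := HU s; exact: cU.
have nS : nbhs f [set x | `|f - S x| < e].
  have : S x @[x --> f] --> S f := cS f; rewrite Sf.
  by move=> /(_ _ (norm_lt_nbhs f e0)).
have [x [n [c [h xE]]] Sx] := dense_approx dense_span nS.
exists (S x) => //; rewrite /S; apply: power_spanZ.
rewrite (_ : \sum_s _ = \sum_(k < n) c k *: \sum_(s : 'S_m) tens (h k \o s)).
  apply: power_span_sum => k; apply: power_spanZ; rewrite tens_polarization.
  by apply: power_span_sum => B; apply: power_spanZ; exact: power_span_tpow.
under [RHS]eq_bigr do rewrite scaler_sumr.
rewrite exchange_big/=; apply: eq_bigr => s _; have [_ Ut _] := HU s.
rewrite xE linear_sum; apply: eq_bigr => k _.
by rewrite linearZ Ut.
Qed.

(** [symmetric_tensor] asserts that permutation operators exist. Those supplied by [f] also serve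
    for sums of powers; [a = 0] gives the symmetry of such sums by themselves. *)
Lemma symmetric_power_span a x : power_span x -> symmetric_tensor tens (a *: f + x).
Proof.
move=> [p p1 xE] s; have [U [cU Ut Uf]] := symf s; exists U; split => //.
rewrite linearD linearZ/= Uf; congr (_ + _); rewrite xE linear_sum.
by apply: eq_bigr => q _; rewrite linearZ/= Ut.
Qed.

End SymmetricTensor.

(** With [c] the ratio of [g] to [f] at the power of [e1], [D] measures the failure of [g = c *: f]
    on powers: it vanishes at [e1] but not everywhere. A vector [z] with [D z] nonzero and a
    component along [e1] has, up to scaling, the form [e1 + s *: e2]. *)
Lemma independent_directions f g : power_approx f -> power_approx g ->
    (forall a b : R, a *: f + b *: g = 0 -> a = 0 /\ b = 0) ->
  exists e1 e2 : H, [/\ inner e1 e1 = 1, inner e2 e2 = 1, inner e1 e2 = 0,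
    inner f (tpow e1) != 0 &
    exists s, inner g (tpow (e1 + s *: e2)) !=
      inner g (tpow e1) / inner f (tpow e1) * inner f (tpow (e1 + s *: e2))].
Proof.
move=> af ag indep.
have [x fx] : exists x : H, inner f (tpow x) != 0.
  apply: contrapT => /forallNP nf.
  have f0 : f = 0 by apply: power_approx_eq0 => // u; apply/eqP/negPn/negP; exact: nf.
  have f10 : 1 *: f + 0 *: g = 0 by rewrite f0 scaler0 scale0r addr0.
  by have [/eqP] := indep _ _ f10; rewrite oner_eq0.
have x0 : x != 0.
  apply: contraNneq fx => ->; rewrite -(scale0r (0 : H)) tpowZ expr0n gtn_eqF//.
  by rewrite scale0r inner0r.
have nx : `|x| != 0 by rewrite normr_eq0.
pose e1 := `|x|^-1 *: x.
have e11 : inner e1 e1 = 1.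
  by rewrite innerZl innerZr inner_normE mulrA -expr2 -exprMn mulVf// expr1n.
have fe1 : inner f (tpow e1) != 0.
  by rewrite tpowZ innerZr mulf_neq0// expf_neq0// invr_eq0.
clearbody e1; pose c := inner g (tpow e1) / inner f (tpow e1); pose D u := inner (- c *: f + g) (tpow u).
have DE u : D u = inner g (tpow u) - c * inner f (tpow u).
  by rewrite /D innerDl innerZl mulNr addrC.
have DZ a u : D (a *: u) = a ^+ m * D u by rewrite /D tpowZ innerZr.
have De1 : D e1 = 0 by rewrite DE /c divfK// subrr.
have [y Dy] : exists y : H, D y != 0.
  apply: contrapT => /forallNP nD.
  have f0 : - c *: f + g = 0.
    apply: power_approx_eq0; first exact: power_approx_lin.
    by move=> u; apply/eqP/negPn/negP; exact: nD.
  have fg1 : - c *: f + 1 *: g = 0 by rewrite scale1r.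
  by have [_ /eqP] := indep _ _ fg1; rewrite oner_eq0.
have [z Dz ze1] : exists2 z : H, D z != 0 & inner z e1 != 0.
  have [ye1|] := eqVneq (inner y e1) 0; last by exists y.
  (* A [y] orthogonal to [e1] is moved slightly along [e1]. By Cauchy-Schwarz [n2 t] bounds the
     squared change of [D]: its second factor is [|tpow (y + t *: e1) - tpow y| ^+ 2], which tends
     to 0. *)
  pose n2 (t : R) := `|- c *: f + g| ^+ 2 * ((inner y y + t ^+ 2) ^+ m - inner y y ^+ m).
  have DyD t : (D (y + t *: e1) - D y) ^+ 2 <= n2 t.
    rewrite /D -innerBr -[leLHS]ger0_norm ?sqr_ge0// normrX.
    apply: (@le_trans _ _ ((`|- c *: f + g| * `|tpow (y + t *: e1) - tpow y|) ^+ 2)).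
      by rewrite ler_pXn2r ?nnegrE ?mulr_ge0// Cauchy_Schwarz.
    rewrite exprMn -(inner_normE (tpow _ - tpow _)) innerBl !innerBr !inner_tpow.
    rewrite ler_wpM2l ?sqr_ge0// (innerC y (_ + _)) !innerDl !innerDr !innerZl !innerZr.
    rewrite (innerC e1) ye1 e11 !mulr0 mulr1 !addr0 add0r -expr2.
    by rewrite le_eqVlt; apply/orP; left; apply/eqP; ring.
  have cn : n2 t @[t --> (0 : R)] --> n2 0.
    apply: cvgM; first exact: cvg_cst.
    apply: cvgB; last exact: cvg_cst.
    apply: (@continuous_comp _ _ _ (fun t : R => inner y y + t ^+ 2) (fun t => t ^+ m)).
      by apply: cvgD; [exact: cvg_cst|exact: exprn_continuous].
    exact: exprn_continuous.
  have n20 : n2 0 = 0 by rewrite /n2 expr0n addr0 subrr mulr0.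
  have Dy2 : 0 < D y ^+ 2 by rewrite exprn_even_gt0.
  have : \forall t \near (0 : R), n2 t < D y ^+ 2.
    by apply: (cvgr_lt _ cn); rewrite n20.
  move=> /nbhs_ballP[r /= r0 Hr].
  pose t := r / 2; have t0 : t != 0 by rewrite mulf_neq0// ?gt_eqF// invr_neq0.
  exists (y + t *: e1); last by rewrite innerDl ye1 add0r innerZl e11 mulr1.
  apply: contraTneq (Hr t _) => [D0|].
    rewrite -leNgt; apply: le_trans (DyD t).
    by rewrite D0 sub0r sqrrN.
  rewrite /ball/= sub0r normrN gtr0_norm ?divr_gt0//.
  by rewrite ltr_pdivrMr// ltr_pMr// ltr1n.
set b := inner z e1 in ze1; pose v := z - b *: e1.
have ve1 : inner v e1 = 0 by rewrite innerBl innerZl e11 mulr1 subrr.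
have zE : z = b *: e1 + v by rewrite addrC subrK.
clearbody v b.
have v0 : v != 0.
  by apply: contraNneq Dz => v0; rewrite zE v0 addr0 DZ De1 mulr0.
have nv : `|v| != 0 by rewrite normr_eq0.
exists e1, (`|v|^-1 *: v); split => //.
- by rewrite innerZl innerZr inner_normE mulrA -expr2 -exprMn mulVf// expr1n.
- by rewrite innerZr innerC ve1 mulr0.
(* This [s] makes [e1 + s *: e2] equal to [b^-1 *: z], and [D] is homogeneous. *)
exists (`|v| / b); rewrite scalerA mulrAC mulfV// mul1r -/c -subr_eq0 -DE.
rewrite (_ : e1 + _ = b^-1 *: z); first by rewrite DZ mulf_neq0// expf_neq0// invr_eq0.
by rewrite zE scalerDr scalerA mulVf// scale1r.
Qed.

End TensorPowers.

(** * Null sets under polynomial maps of the plane *)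

Section ExpandingMaps.
Context {R : realType}.
Local Notation mu := (@lebesgue_measure R).
Local Notation l := (@wlength R idfun).
Local Open Scope measure_scope.

Lemma outer_measure_diam (A : set R) (r : R) : 0 <= r ->
  (forall x y, A x -> A y -> `|x - y| <= r) -> (l^* A <= (2 * r)%:E)%E.
Proof.
move=> r0 diamA; have [->|/set0P[a Aa]] := eqVneq A set0.
  by rewrite outer_measure0 lee_fin mulr_ge0.
have -> : (2 * r)%:E = (l^* `[(a - r)%R, (a + r)%R])%E.
  rewrite (_ : (l^* _)%E = mu `[a - r, a + r])// lebesgue_measure_itv/= lte_fin.
  case: ltP => [_|]; first by congr EFin; ring.
  rewrite lerD2l => rr; have -> : r = 0 by lra.
  by rewrite mulr0.
apply: le_outer_measure => x Ax /=; rewrite in_itv/=.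
by have := diamA _ _ Ax Aa; rewrite ler_norml => /andP[? ?]; apply/andP; split; lra.
Qed.

(** An interval of length L pulls back inside [D] to a set of diameter at most L / c, hence of outer
    measure at most 2 L / c: covers of [N] of total length [c * e / 2] suffice. [D] and [h] are
    arbitrary, whence outer measures. *)
Lemma negligible_expanding (h : R -> R) (c : R) (D N : set R) : 0 < c ->
    (forall x y, D x -> D y -> c * `|x - y| <= `|h x - h y|) ->
  mu.-negligible N -> mu.-negligible (D `&` h @^-1` N).
Proof.
move=> c0 hD /negligible_outer_measure N0; apply/negligible_outer_measure.
apply/eqP; rewrite eq_le outer_measure_ge0 andbT; apply/lee_addgt0Pr => e e0.
rewrite add0e; have e'0 : 0 < c * e / 2 by rewrite divr_gt0 ?mulr_gt0.
have : (l^* N \is a fin_num)%E by rewrite N0.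
rewrite outer_measure_open_itv_cover.
move=> /lb_ereal_inf_adherent-/(_ _ e'0)[_/= [F]] [Fo NF] <-.
rewrite -outer_measure_open_itv_cover [X in (X + _)%E]N0 add0e => /ltW Fe.
apply: (@le_trans _ _ (l^* (\bigcup_k (D `&` h @^-1` F k)))%E).
  by apply: le_outer_measure => x [Dx /NF[k _ Fk]]; exists k.
apply: (le_trans (outer_measure_sigma_subadditive _ _)).
have Fl k : (l (F k) = (fine (l (F k)))%:E)%E.
  have [[a b] ->]/= := Fo k; rewrite wlength_itv/=; case: ifP => //=.
have -> : (e%:E = (2 / c)%:E * (c * e / 2)%:E)%E.
  by rewrite -EFinM; congr EFin; field; rewrite gt_eqF.
have c2 : 0 <= 2 / c by rewrite divr_ge0// ltW.
apply: (@le_trans _ _ (\sum_(k <oo) (2 / c)%:E * l (F k))%E); last first.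
  rewrite nneseriesZl; last by move=> *; exact: wlength_ge0.
  by rewrite lee_pmul2l// lte_fin divr_gt0.
apply: lee_nneseries => // k _; rewrite Fl -EFinM mulrAC -mulrA.
apply: outer_measure_diam => [|x y [Dx Fx] [Dy Fy]].
  by apply: divr_ge0; [exact/fine_ge0/wlength_ge0|exact: ltW].
rewrite ler_pdivlMr// mulrC (le_trans (hD _ _ Dx Dy))//.
move: Fx Fy (Fl k); have [[a b] ->]/= := Fo k; rewrite !in_itv/=.
rewrite wlength_itv/= => /andP[ax xb] /andP[ay yb].
rewrite lte_fin (lt_trans ax xb) ler_norml => _ /=; apply/andP; split; lra.
Qed.

End ExpandingMaps.

Section NullSections.
Context d1 d2 (T1 : measurableType d1) (T2 : measurableType d2) (R : realType).
Variable m1 : {sigma_finite_measure set T1 -> \bar R}.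
Variable m2 : {sigma_finite_measure set T2 -> \bar R}.
Local Open Scope ereal_scope.

Lemma product_null_xsection (S : set (T1 * T2)) : measurable S ->
  (m1 \x m2) S = 0 <-> {ae m1, forall x, m2 (xsection S x) = 0}.
Proof.
move=> mS; have mf : measurable_fun setT (m2 \o xsection S).
  exact: measurable_fun_xsection.
rewrite /product_measure1.
have := ae_eq_integral_abs m1 measurableT mf.
under eq_integral do rewrite gee0_abs//=.
move=> ->; rewrite /ae_eq; split; apply: filterS => x /=; first exact.
by move=> -> _.
Qed.

Lemma product_null_ysection (S : set (T1 * T2)) : measurable S ->
  (m1 \x m2) S = 0 <-> {ae m2, forall y, m1 (ysection S y) = 0}.
Proof.
move=> mS; have mf : measurable_fun setT (m1 \o ysection S).
  exact: measurable_fun_ysection.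
have -> : (m1 \x m2) S = (m1 \x^ m2) S.
  by apply: product_measure_unique => //= A B mA mB; exact: product_measure2E.
rewrite /product_measure2.
have := ae_eq_integral_abs m2 measurableT mf.
under eq_integral do rewrite gee0_abs//=.
move=> ->; rewrite /ae_eq; split; apply: filterS => x /=; first exact.
by move=> -> _.
Qed.

End NullSections.

Lemma measurable_ler d (T : measurableType d) (R : realType) (f g : T -> R) :
  measurable_fun setT f -> measurable_fun setT g ->
  measurable [set x | f x <= g x].
Proof.
move=> mf mg; rewrite (_ : [set _ | _] = (g \- f) @^-1` `[0, +oo[).
  by rewrite -[X in measurable X]setTI; apply: measurable_funB => //.
by apply/seteqP; split => x /=; rewrite in_itv/= andbT subr_ge0.
Qed.

Lemma measurable_eqr d (T : measurableType d) (R : realType) (f g : T -> R) :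
  measurable_fun setT f -> measurable_fun setT g ->
  measurable [set x | f x = g x].
Proof.
move=> mf mg; rewrite (_ : [set _ | _] =
  [set x | f x <= g x] `&` [set x | g x <= f x]).
  by apply: measurableI; exact: measurable_ler.
by apply/seteqP; split=> x /= => [->//|[fg gf]]; apply/eqP; rewrite eq_le fg.
Qed.

Section LocalNull.
Context {R : realType}.
Local Notation mu := (@lebesgue_measure R).
Variables (F G : R * R -> R) (a b a' b' sg c : R) (A : set (R * R)).
Hypotheses (c0 : 0 < c) (mF : measurable_fun setT F) (mG : measurable_fun setT G).
Hypotheses (mA : measurable A) (A0 : (mu \x mu)%E A = 0%E).
Let I : set R := `]a, b[%classic.
Let K : set R := `]a', b'[%classic.
Hypothesis monoF : forall t t' s, I t -> I t' -> K s -> t' <= t ->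
  c * (t - t') <= sg * (F (t, s) - F (t', s)).
Hypothesis expandG : forall t t' s s', I t -> I t' -> K s -> K s' ->
  F (t, s) = F (t', s') -> c * `|s - s'| <= `|G (t, s) - G (t', s')|.

(* (X u, s) inverts t |-> F (t, s): if u = F (t, s) then the set is ]a, t].
   Through a measure, the measurability of X is part of Fubini's theorem. *)
Let X (z : R * R) : R :=
  a + fine (mu [set t | I t /\ sg * F (t, z.2) <= sg * z.1]).

Let mX : measurable_fun setT X.
Proof.
apply: measurable_funD => //; apply: measurableT_comp => //.
pose E : set ((R * R) * R) := [set z | I z.2 /\ sg * F (z.2, z.1.2) <= sg * z.1.1].
have mE : measurable E.
  apply: measurableI.
    rewrite -[X in measurable X]setTI; apply: measurable_snd => //.
    exact: measurable_itv.
  apply: measurable_ler.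
    apply: measurable_funM => //; apply: (measurableT_comp mF).
    apply: measurable_fun_pair => //.
    by apply: measurableT_comp => //.
  apply: measurable_funM => //; exact: measurableT_comp.
have := measurable_fun_xsection mu mE.
congr measurable_fun; apply/funext => z /=; congr (mu _).
by apply/seteqP; split => t /=; rewrite /xsection/= inE.
Qed.

Let XF t s : I t -> K s -> X (F (t, s), s) = t.
Proof.
move=> It Ks; rewrite /X/= (_ : [set _ | _] = `]a, t]%classic).
  rewrite lebesgue_measure_itv/= lte_fin; move: (It) => /=.
  by rewrite /I/= in_itv/= => /andP[-> _] /=; rewrite addrCA subrr addr0.
apply/seteqP; split => t' /=.
  move=> [It' le]; rewrite in_itv/=; move: (It'); rewrite /I/= in_itv/= => /andP[-> _]/=.
  rewrite leNgt; apply/negP => tt'; have := monoF It' It Ks (ltW tt').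
  have : 0 < c * (t' - t) by rewrite mulr_gt0// subr_gt0.
  by rewrite mulrBr; lra.
rewrite in_itv/= => /andP[at' t't]; have It' : I t'.
  move: It; rewrite /I/= !in_itv/= at'/= => /andP[_]; exact: le_lt_trans.
split => //; have := monoF It It' Ks t't.
have : 0 <= c * (t - t') by rewrite mulr_ge0 ?subr_ge0// ltW.
by rewrite mulrBr; lra.
Qed.

(* For almost all u the section A_u is null; by expandG it pulls back to a null
   set of s on the level set F = u. By monoF, so does a null set of u to one of
   t, for each s. *)
Lemma local_null :
  (mu \x mu)%E [set z | [/\ I z.1, K z.2 & A (F z, G z)]] = 0%E.
Proof.
have mI1 : measurable [set z : R * R | I z.1].
  by rewrite -[X in measurable X]setTI; apply: measurable_fst => //; exact: measurable_itv.
have mK2 : measurable [set z : R * R | K z.2].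
  by rewrite -[X in measurable X]setTI; apply: measurable_snd => //; exact: measurable_itv.
have mS : measurable [set z | [/\ I z.1, K z.2 & A (F z, G z)]].
  rewrite (_ : [set _ | _] = [set z : R * R | I z.1] `&` [set z : R * R | K z.2]
      `&` (fun z => (F z, G z)) @^-1` A).
    apply: measurableI; first exact: measurableI.
    by rewrite -[X in measurable X]setTI; apply: measurable_fun_pair.
  by apply/seteqP; split => z /= => [[]|[[]]].
pose Y z : R * R := (X z, z.2).
have mY : measurable_fun setT Y by apply: measurable_fun_pair.
(* The image of the set in question under (t, s) -> (F (t, s), s), written through the inverse [X]
   so that it is visibly measurable. *)
pose M : set (R * R) := [set z | [/\ K z.2, I (X z), F (Y z) = z.1 & A (z.1, G (Y z))]].
have mM : measurable M.
  rewrite (_ : M = [set z : R * R | K z.2] `&` X @^-1` I `&`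
      [set z | F (Y z) = z.1] `&` (fun z => (z.1, G (Y z))) @^-1` A).
    apply: measurableI; last first.
      rewrite -[X in measurable X]setTI; apply: measurable_fun_pair => //.
      exact: measurableT_comp.
    apply: measurableI; last first.
      by apply: measurable_eqr => //; exact: measurableT_comp.
    apply: measurableI => //.
    by rewrite -[X in measurable X]setTI; apply: mX => //; exact: measurable_itv.
  by apply/seteqP; split => z /= => [[]|[[[]]]].
have M0 : (mu \x mu)%E M = 0%E.
  apply/(product_null_xsection mu mu mM).
  have /(product_null_xsection mu mu mA) := A0.
  apply: filterS => u Au0.
  apply/negligibleP; first exact: measurable_xsection.
  have nA : mu.-negligible (xsection A u).
    by apply/negligibleP => //; exact: measurable_xsection.
  have exG : forall s s', [set s | [/\ K s, I (X (u, s)) & F (Y (u, s)) = u]] s ->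
      [set s | [/\ K s, I (X (u, s)) & F (Y (u, s)) = u]] s' ->
      c * `|s - s'| <= `|G (Y (u, s)) - G (Y (u, s'))|.
    by move=> s s' /= [Ks Is Fs] [Ks' Is' Fs']; apply: expandG => //; exact: etrans Fs (esym Fs').
  apply: negligibleS (negligible_expanding c0 exG nA).
  by move=> s; rewrite /xsection/= !inE/= => -[/= ? ? ? ?].
apply/(product_null_ysection mu mu mS).
have /(product_null_ysection mu mu mM) := M0.
apply: filterS => s Ms0.
apply/negligibleP; first exact: measurable_ysection.
have nM : mu.-negligible (ysection M s).
  by apply/negligibleP => //; exact: measurable_ysection.
have [Ks|nKs] := pselect (K s); last first.
  by apply: (negligibleS _ (negligible_set0 _)) => t; rewrite /ysection/= inE/= => -[].
(* The [+ 1] keeps the denominator positive without information on [sg]. *)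
have exF : forall t t', I t -> I t' ->
    (c / (`|sg| + 1)) * `|t - t'| <= `|F (t, s) - F (t', s)|.
  suff H t t' : I t -> I t' -> t' <= t ->
      (c / (`|sg| + 1)) * `|t - t'| <= `|F (t, s) - F (t', s)|.
    move=> t t' It It'; case: (leP t' t) => [|/ltW] tt'; first exact: H.
    by rewrite distrC [leRHS]distrC; exact: H.
  move=> It It' tt'; rewrite mulrAC ler_pdivrMr ?ltr_wpDl//.
  rewrite ger0_norm ?subr_ge0//; apply: (le_trans (monoF It It' Ks tt')).
  rewrite (le_trans (ler_norm _))// normrM mulrC ler_wpM2l//.
  by rewrite lerDl.
have c1 : 0 < c / (`|sg| + 1) by rewrite divr_gt0// ltr_wpDl.
apply: negligibleS (negligible_expanding c1 exF nM).
move=> t; rewrite /ysection/= !inE/= => -[/= It _ At].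
by split => //; rewrite /M /Y/= XF//.
Qed.

End LocalNull.

(** * Polynomials in two variables and their Jacobian *)

Section PolyZeros.
Context {R : realType}.
Local Notation mu := (@lebesgue_measure R).

Lemma finite_roots (p : {poly R}) : p != 0 -> finite_set [set x | root p x].
Proof.
move: {2}(size p) (leqnn (size p)) => n.
elim: n p => [p|n IHn p sp p0]; first by rewrite leqn0 size_poly_eq0 => ->.
have [[x px]|nroot] := pselect (exists x, root p x); last first.
  by rewrite (_ : [set x | _] = set0)// -subset0 => x px; apply: nroot; exists x.
have [q pq] := factor_theorem p x px.
have q0 : q != 0 by apply: contraNneq p0 => q0; rewrite pq q0 mul0r.
apply: (@sub_finite_set _ _ ([set x] `|` [set y | root q y])).
  move=> y /=; rewrite pq rootM root_XsubC => /orP[->|/eqP->]; by [right|left].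
rewrite finite_setU; split; first exact: finite_set1.
apply: IHn => //; move: sp; rewrite pq size_mul ?polyXsubC_eq0// size_XsubC.
by rewrite addn2.
Qed.

Lemma ae_poly_neq0 (p : {poly R}) : p != 0 -> {ae mu, forall x, p.[x] != 0}.
Proof.
move=> p0; have fr := finite_roots p0; exists [set x | root p x]; split.
- by apply: countable_measurable => //; exact: finite_set_countable.
- by apply: countable_lebesgue_measure0; exact: finite_set_countable.
- by move=> x /= /negP; rewrite negbK.
Qed.

End PolyZeros.

Section Bivariate.
Context {R : realType}.
Implicit Types (P Q : {poly {poly R}}) (p : {poly R}).

(** The outer variable t is [z.1], and the coefficients are polynomials in s = [z.2]. Thus [deriv]
    is the partial derivative in t, [bideriv] the one in s, and the leading coefficient in t is a
    polynomial in s. *)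
Definition bieval P (z : R * R) : R := P.[z.1%:P].[z.2].
Definition bideriv P : {poly {poly R}} := map_poly (@deriv R) P.

Lemma bievalE P z : bieval P z = \sum_(i < size P) (P`_i).[z.2] * z.1 ^+ i.
Proof.
rewrite /bieval (horner_coef P) horner_sum; apply: eq_bigr => i _.
by rewrite hornerM -polyC_exp hornerC.
Qed.

Lemma bieval_map P z : bieval P z = (map_poly (horner_eval z.2) P).[z.1].
Proof.
rewrite bievalE (horner_coef_wide _ (size_poly _ _)).
by apply: eq_bigr => i _; rewrite coef_map.
Qed.

Lemma bievalB P Q z : bieval (P - Q) z = bieval P z - bieval Q z.
Proof. by rewrite /bieval !hornerE. Qed.

Lemma bievalM P Q z : bieval (P * Q) z = bieval P z * bieval Q z.
Proof. by rewrite /bieval !hornerE. Qed.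

Lemma measurable_bieval P : measurable_fun setT (bieval P).
Proof.
rewrite (_ : bieval P = fun z => \sum_(i < size P) (P`_i).[z.2] * z.1 ^+ i).
  apply: measurable_sum => i; apply: measurable_funM; last exact: measurable_funX.
  apply: (measurableT_comp _ measurable_snd).
  by apply: continuous_measurable_fun; exact: continuous_horner.
by apply/funext => z; rewrite bievalE.
Qed.

(** Some coefficient is a nonzero polynomial in s. Wherever it does not vanish, the section in t is
    the root set of a nonzero polynomial, hence finite. *)
Lemma bieval_null P : P != 0 ->
  (@lebesgue_measure R \x @lebesgue_measure R)%E [set z | bieval P z = 0] = 0%E.
Proof.
move=> P0; have mS : measurable [set z | bieval P z = 0].
  by apply: measurable_eqr => //; exact: measurable_bieval.
apply/(product_null_ysection (@lebesgue_measure R) (@lebesgue_measure R) mS).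
have [i Pi] : exists i, P`_i != 0.
  by exists (size P).-1; rewrite -lead_coefE lead_coef_eq0.
have := ae_poly_neq0 Pi; apply: (@filterS _ _ (ae_filter_ringOfSetsType _)) => s Ps.
have Ps0 : map_poly (horner_eval s) P != 0.
  by apply: contraNneq Ps => /polyP/(_ i)/eqP; rewrite coef_map coef0.
apply: countable_lebesgue_measure0; apply: finite_set_countable.
apply: sub_finite_set (finite_roots Ps0) => t; rewrite /ysection/= inE/= => Pt.
by apply/rootP; rewrite -[RHS]Pt bieval_map.
Qed.

(* The difference quotient of p, as a polynomial expression that is meaningful
   on the diagonal x = y. *)
Definition divdiff n p x y := \sum_(i < n) p`_i *
  \sum_(j < i) x ^+ (i.-1 - j) * y ^+ j.

Lemma divdiffE n p x y : (size p <= n)%N ->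
  p.[x] - p.[y] = divdiff n p x y * (x - y).
Proof.
move=> pn; rewrite !(horner_coef_wide _ pn) -sumrB /divdiff mulr_suml.
by apply: eq_bigr => i _; rewrite -mulrBr subrXX mulrAC mulrA.
Qed.

Lemma divdiff_diag n p x : (size p <= n)%N -> divdiff n p x x = (deriv p).[x].
Proof.
move=> pn; have -> : p = \poly_(i < n) p`_i.
  apply/polyP => i; rewrite coef_poly; case: ltnP => // ni.
  by rewrite nth_default// (leq_trans pn).
rewrite {2}poly_def (raddf_sum (@deriv R)) horner_sum.
apply: eq_bigr => i _; rewrite coef_poly ltn_ord.
rewrite /= derivZ hornerZ derivXn hornerMn hornerXn.
congr (_ * _); rewrite (eq_bigr (fun=> x ^+ i.-1)) => [|j _].
  by rewrite sumr_const card_ord.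
by rewrite -exprD subnK// -ltnS prednK// (leq_ltn_trans _ (ltn_ord j)).
Qed.

(** Partial difference quotients along the path from (t, s) through (t', s) to (t', s'): the first
    is taken at fixed s, the second is used at t'. *)
Definition divdiff1 P t t' s := divdiff (size P) (map_poly (horner_eval s) P) t t'.
Definition divdiff2 P t s s' :=
  \sum_(i < size P) divdiff (size P`_i) P`_i s s' * t ^+ i.

Lemma bieval_divdiff P t t' s s' : bieval P (t, s) - bieval P (t', s') =
  divdiff1 P t t' s * (t - t') + divdiff2 P t' s s' * (s - s').
Proof.
rewrite -(subrK (bieval P (t', s)) (bieval P (t, s))) -addrA; congr (_ + _).
  by rewrite !bieval_map/=; apply: divdiffE; exact: size_poly.
rewrite !bievalE/= -sumrB /divdiff2 mulr_suml; apply: eq_bigr => i _.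
by rewrite -mulrBl (divdiffE _ _ (leqnn _)) mulrAC.
Qed.

Lemma divdiff1_diag P t s : divdiff1 P t t s = bieval (deriv P) (t, s).
Proof.
rewrite /divdiff1 divdiff_diag ?size_poly// bieval_map/= deriv_map.
by [].
Qed.

Lemma divdiff2_diag P t s : divdiff2 P t s s = bieval (bideriv P) (t, s).
Proof.
rewrite /divdiff2 /bieval/= (horner_coef_wide _ (size_poly _ _)) horner_sum.
apply: eq_bigr => i _; rewrite divdiff_diag// hornerM -polyC_exp hornerC.
by rewrite coef_map.
Qed.

End Bivariate.

Section Continuity.
Context {R : realType} {T : topologicalType}.

Lemma continuous_expr (f : T -> R) n :
  continuous f -> continuous (fun x => f x ^+ n).
Proof.
move=> cf x; apply: (@continuous_comp _ _ _ f (fun y => y ^+ n)); first exact: cf.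
exact: exprn_continuous.
Qed.

Lemma continuousMr (f g : T -> R) :
  continuous f -> continuous g -> continuous (fun x => f x * g x).
Proof. by move=> cf cg x; apply: cvgM; [exact: cf|exact: cg]. Qed.

Lemma continuous_divdiff n (p : T -> {poly R}) (f g : T -> R) :
  (forall i, continuous (fun x => (p x)`_i)) -> continuous f -> continuous g ->
  continuous (fun x => divdiff n (p x) (f x) (g x)).
Proof.
move=> cp cf cg; apply: continuous_bigsum => i; apply: continuousMr => //.
by apply: continuous_bigsum => j; apply: continuousMr; exact: continuous_expr.
Qed.

Lemma continuous_divdiff1 (P : {poly {poly R}}) (f g h : T -> R) :
  continuous f -> continuous g -> continuous h ->
  continuous (fun x => divdiff1 P (f x) (g x) (h x)).
Proof.
move=> cf cg ch; apply: continuous_divdiff => // i.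
rewrite (_ : (fun x => _) = fun x => (P`_i).[h x]).
  move=> x; apply: (@continuous_comp _ _ _ h (fun y => (P`_i).[y])); first exact: ch.
  exact: continuous_horner.
by apply/funext => x; rewrite coef_map.
Qed.

Lemma continuous_divdiff2 (P : {poly {poly R}}) (f g h : T -> R) :
  continuous f -> continuous g -> continuous h ->
  continuous (fun x => divdiff2 P (f x) (g x) (h x)).
Proof.
move=> cf cg ch; apply: continuous_bigsum => i; apply: continuousMr.
  by apply: continuous_divdiff => // j x; exact: cvg_cst.
exact: continuous_expr.
Qed.

End Continuity.

Section PolynomialMaps.
Context {R : realType}.
Local Notation mu := (@lebesgue_measure R).
Variables (P Q : {poly {poly R}}).

Definition jacobian : {poly {poly R}} := deriv P * bideriv Q - deriv Q * bideriv P.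

(** A substitute for the inverse function theorem. The determinant [K] of the partial difference
    quotients is continuous and equals the Jacobian on the diagonal, so it stays away from 0 nearby.
    On a level set of [P], Cramer's rule turns this into expansion of [Q] in s. *)
Lemma local_expanding (t0 s0 : R) :
    bieval (deriv P) (t0, s0) != 0 -> bieval jacobian (t0, s0) != 0 ->
  exists e c sg : R, [/\ 0 < e, 0 < c,
    forall t t' s, ball t0 e t -> ball t0 e t' -> ball s0 e s -> t' <= t ->
      c * (t - t') <= sg * (bieval P (t, s) - bieval P (t', s)) &
    forall t t' s s', ball t0 e t -> ball t0 e t' -> ball s0 e s -> ball s0 e s' ->
      bieval P (t, s) = bieval P (t', s') ->
      c * `|s - s'| <= `|bieval Q (t, s) - bieval Q (t', s')|].
Proof.
set a0 := bieval _ _; set j0 := bieval _ _ => a00 j00.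
have na0 : 0 < `|a0| by rewrite normr_gt0.
have nj0 : 0 < `|j0| by rewrite normr_gt0.
pose w0 : (R * R) * (R * R) := ((t0, t0), (s0, s0)).
pose A1 (w : (R * R) * (R * R)) := divdiff1 P w.1.1 w.1.2 w.2.1.
pose A2 (w : (R * R) * (R * R)) := divdiff1 Q w.1.1 w.1.2 w.2.1.
pose B1 (w : (R * R) * (R * R)) := divdiff2 P w.1.2 w.2.1 w.2.2.
pose B2 (w : (R * R) * (R * R)) := divdiff2 Q w.1.2 w.2.1 w.2.2.
pose K w := A1 w * B2 w - A2 w * B1 w.
have c11 : continuous (fun w : (R * R) * (R * R) => w.1.1).
  by move=> w; apply: (@continuous_comp _ _ _ fst fst); exact: cvg_fst.
have c12 : continuous (fun w : (R * R) * (R * R) => w.1.2).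
  by move=> w; apply: (@continuous_comp _ _ _ fst snd); [exact: cvg_fst|exact: cvg_snd].
have c21 : continuous (fun w : (R * R) * (R * R) => w.2.1).
  by move=> w; apply: (@continuous_comp _ _ _ snd fst); [exact: cvg_snd|exact: cvg_fst].
have c22 : continuous (fun w : (R * R) * (R * R) => w.2.2).
  by move=> w; apply: (@continuous_comp _ _ _ snd snd); exact: cvg_snd.
have cA1 : continuous A1 by exact: continuous_divdiff1.
have cA2 : continuous A2 by exact: continuous_divdiff1.
have cB1 : continuous B1 by exact: continuous_divdiff2.
have cB2 : continuous B2 by exact: continuous_divdiff2.
have cK : continuous K.
  by move=> w; apply: cvgB; apply: cvgM; [exact: cA1|exact: cB2|exact: cA2|exact: cB1].
have A10 : A1 w0 = a0 by rewrite /A1 /= divdiff1_diag.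
have K0 : K w0 = j0.
  rewrite /K /A1 /A2 /B1 /B2 /= !divdiff1_diag !divdiff2_diag.
  by rewrite /j0 /jacobian bievalB !bievalM.
pose sg := Num.sg a0.
have n1 : \forall w \near w0, `|a0| / 2 < sg * A1 w.
  have cs : (fun w => sg * A1 w) @ w0 --> sg * a0.
    by rewrite -A10; apply: cvgM; [exact: cvg_cst|exact: cA1].
  apply: (cvgr_gt _ cs); rewrite /sg mulrC -normrEsg; lra.
have n2 : \forall w \near w0, `|A1 w| < 2 * `|a0|.
  by apply: (cvgr_norm_lt _ (cA1 w0)); rewrite A10; lra.
have n3 : \forall w \near w0, `|j0| / 2 < `|K w|.
  by apply: (cvgr_norm_gt _ (cK w0)); rewrite K0; lra.
have [e /= e0 He] := (nbhs_ballP _ _).1 (filterI n1 (filterI n2 n3)).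
have Hb t t' s s' : ball t0 e t -> ball t0 e t' -> ball s0 e s -> ball s0 e s' ->
   [/\ `|a0| / 2 < sg * A1 ((t, t'), (s, s')), `|A1 ((t, t'), (s, s'))| < 2 * `|a0| &
       `|j0| / 2 < `|K ((t, t'), (s, s'))|].
  by move=> bt bt' bs bs'; have [|? []] := He ((t, t'), (s, s')).
(* [sg] is the sign of the t-derivative of [P] at the centre. The second constant is the quotient of
   the bounds [|j0| / 2] on [|K|] from below and [2 * |a0|] on [|A1|] from above. *)
exists e, (Num.min (`|a0| / 2) (`|j0| / (4 * `|a0|))), sg; split => //.
- by rewrite lt_min !divr_gt0// mulr_gt0.
- move=> t t' s bt bt' bs tt'; rewrite bieval_divdiff subrr mulr0 addr0 mulrA.
  rewrite ler_wpM2r ?subr_ge0// ge_min; apply/orP; left.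
  by have [/ltW] := Hb _ _ _ _ bt bt' bs bs.
- move=> t t' s s' bt bt' bs bs' PP.
  have [_ H2 H3] := Hb _ _ _ _ bt bt' bs bs'.
  set w := ((t, t'), (s, s')) in H2 H3.
  have E : A1 w * (bieval Q (t, s) - bieval Q (t', s')) = K w * (s - s').
    have := bieval_divdiff P t t' s s'; rewrite PP subrr => /esym.
    rewrite bieval_divdiff /K /A1 /A2 /B1 /B2/=.
    set u := divdiff1 P _ _ _; set v := divdiff2 P _ _ _ => uv.
    have -> : u * (divdiff1 Q t t' s * (t - t') + divdiff2 Q t' s s' * (s - s')) =
      divdiff1 Q t t' s * (u * (t - t')) + u * divdiff2 Q t' s s' * (s - s') by ring.
    have -> : u * (t - t') = - (v * (s - s')) by apply/eqP; rewrite -addr_eq0 uv.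
    by ring.
  have nE : `|K w| * `|s - s'| <= 2 * `|a0| * `|bieval Q (t, s) - bieval Q (t', s')|.
    by rewrite -normrM -E normrM ler_wpM2r// ltW.
  apply: (@le_trans _ _ (`|j0| / (4 * `|a0|) * `|s - s'|)).
    by rewrite ler_wpM2r// ge_min lexx orbT.
  have hK : `|j0| / 2 * `|s - s'| <= 2 * `|a0| * `|bieval Q (t, s) - bieval Q (t', s')|.
    by apply: le_trans nE; rewrite ler_wpM2r// ltW.
  rewrite -(ler_pM2l (_ : 0 < 2 * `|a0|)) ?mulr_gt0//; apply: le_trans hK.
  by rewrite le_eqVlt; apply/orP; left; apply/eqP; field; rewrite gt_eqF.
Qed.

(** Off the zero sets of [deriv P] and of the Jacobian, which are null, [local_null] applies in a
    small box around each point. The boxes with rational centre and radius 1 / (n + 1) are countably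
    many, so those with null trace have a null union. *)
Theorem bieval_nonsingular (A : set (R * R)) :
    deriv P != 0 -> jacobian != 0 -> measurable A -> (mu \x mu)%E A = 0%E ->
  (mu \x mu)%E [set z | A (bieval P z, bieval Q z)] = 0%E.
Proof.
move=> P'0 J0 mA A0.
have mS : measurable [set z | A (bieval P z, bieval Q z)].
  by rewrite -[X in measurable X]setTI; apply: measurable_fun_pair => //; exact: measurable_bieval.
pose box (q : rat * rat * nat) := [set z : R * R |
  [/\ `](ratr q.1.1 - q.2.+1%:R^-1), (ratr q.1.1 + q.2.+1%:R^-1)[%classic z.1,
    `](ratr q.1.2 - q.2.+1%:R^-1), (ratr q.1.2 + q.2.+1%:R^-1)[%classic z.2 &
    A (bieval P z, bieval Q z)]].
pose good q := (mu \x mu)%E (box q) = 0%E.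
pose F n := if pickle_inv n is Some q then if `[< good q >] then box q else set0 else set0.
have mbox q : measurable (box q).
  rewrite (_ : box q = (`](ratr q.1.1 - q.2.+1%:R^-1), (ratr q.1.1 + q.2.+1%:R^-1)[%classic
     `*` `](ratr q.1.2 - q.2.+1%:R^-1), (ratr q.1.2 + q.2.+1%:R^-1)[%classic)
     `&` [set z | A (bieval P z, bieval Q z)]).
    by apply: measurableI => //; apply: measurableX; exact: measurable_itv.
  by apply/seteqP; split => z /= => [[]|[[]]].
have Z1 := bieval_null P'0; have Z2 := bieval_null J0.
have mZ (p : {poly {poly R}}) : measurable [set z | bieval p z = 0].
  by apply: measurable_eqr => //; exact: measurable_bieval.
have nF n : (mu \x mu)%E.-negligible (F n).
  rewrite /F; case: pickle_inv => [q|]; last exact: negligible_set0.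
  case: asboolP => [gq|_]; last exact: negligible_set0.
  by apply/(negligibleP (mu \x mu)%E (mbox q)).
apply/negligibleP => //.
have nZ B : measurable B -> (mu \x mu)%E B = 0%E -> (mu \x mu)%E.-negligible B.
  by exists B; split.
apply: negligibleS; last first.
  apply: negligibleU (negligible_bigcup nF).
  exact: negligibleU (nZ _ (mZ _) Z1) (nZ _ (mZ _) Z2).
move=> [t0 s0] /= Az.
have [?|/eqP a0] := pselect (bieval (deriv P) (t0, s0) = 0); first by left; left.
have [?|/eqP j0] := pselect (bieval jacobian (t0, s0) = 0); first by left; right.
right; have [e [c [sg [e0 c0 H1 H2]]]] := local_expanding a0 j0.
(* A box of radius [r] whose centre is within [r] of the point stays in the ball of radius [e],
   since 2 r < e. *)
have [n ne] : exists n, n.+1%:R^-1 < e / 2 :> R.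
  have e2 : 0 < e / 2 by rewrite divr_gt0.
  by have [n _ Hn] := near_infty_natSinv_lt (PosNum e2); exists n; exact: Hn n (leqnn _).
set r := n.+1%:R^-1 : R in ne.
have r0 : 0 < r by rewrite invr_gt0.
have rat_near (x : R) : exists q : rat, x - r < ratr q < x + r.
  have : x - r < x + r by lra.
  by move=> /rat_in_itvoo[q]; rewrite in_itv/=; exists q.
have [q1 /andP[q1a q1b]] := rat_near t0; have [q2 /andP[q2a q2b]] := rat_near s0.
have FE q : F (pickle q) = if `[< good q >] then box q else set0.
  by rewrite /F pickleK_inv.
exists (pickle (q1, q2, n)); first exact: Logic.I.
rewrite FE; clear FE.
have In (x y q : R) : x - r < q -> q < x + r -> `]q - r, q + r[%classic y -> ball x e y.
  move=> ? ?; rewrite /= in_itv/= => /andP[? ?].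
  by rewrite /ball/= ltr_norml; apply/andP; split; lra.
case: asboolP => [_|]; last first.
  case; apply: (@local_null R (bieval P) (bieval Q) _ _ _ _ sg c A) => //.
  - exact: measurable_bieval.
  - exact: measurable_bieval.
  - by move=> t t' s It It' Ks; apply: H1; [exact: In It|exact: In It'|exact: In Ks].
  - move=> t t' s s' It It' Ks Ks'; apply: H2;
      [exact: In It|exact: In It'|exact: In Ks|exact: In Ks'].
by split => //=; rewrite in_itv/= -/r; apply/andP; split; lra.
Qed.

End PolynomialMaps.

Lemma coefM_top (S : nzRingType) (A B : {poly S}) a b :
  (size A <= a.+1)%N -> (size B <= b.+1)%N -> (A * B)`_(a + b) = A`_a * B`_b.
Proof.
move=> sA sB; rewrite coefM.
have a1 : (a < (a + b).+1)%N by rewrite ltnS leq_addr.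
rewrite (bigD1 (Ordinal a1))//= addKn big1 ?addr0// => i.
rewrite -val_eqE/= => ia; case: (ltnP a i) => [ai|]; last first.
  rewrite leq_eqVlt (negbTE ia)/= => i_lt.
  by rewrite [B`_ _]nth_default ?mulr0// (leq_trans sB)// ltn_subRL ltn_add2r.
by rewrite nth_default ?mul0r// (leq_trans sA).
Qed.

(** The difference [r] of the two sides satisfies the same relation as [q] and vanishes at 0. If [r]
    is X^(e+1) s with s(0) nonzero, comparing lowest terms gives (e + 1) p(0) s(0) = 0, which is
    absurd. *)
Lemma proportional_of_wronskian (R : realType) (p q : {poly R}) : p.[0] != 0 ->
  p * deriv q = q * deriv p -> q = (q.[0] / p.[0]) *: p.
Proof.
move=> p0 pq; set c := _ / _; apply/eqP; rewrite -subr_eq0; apply/negPn/negP.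
set r := q - _ => r0.
have rr : p * deriv r = r * deriv p.
  rewrite /r derivB derivZ mulrBr mulrBl pq; congr (_ - _).
  by rewrite -scalerAr -scalerAl.
have root_r : root r 0.
  by apply/rootP; rewrite /r !hornerE /c divfK// subrr.
have [e [s /implyP/(_ r0) s0 rE]] := multiplicity_XsubC r 0.
rewrite subr0 in rE; case: e => [|e] in rE.
  by move: root_r; rewrite rE expr0 mulr1 (negbTE s0).
have : 'X^e * (p * (deriv s * 'X + s *+ e.+1)) = 'X^e * (s * 'X * deriv p).
  transitivity (p * deriv r).
    rewrite rE derivM derivXn/= exprS mulrDr; ring.
  by rewrite rr rE exprS; ring.
move=> /(mulfI (monic_neq0 (monicXn _ e)))/(congr1 (horner^~ 0)).
rewrite /= !hornerE hornerMn => /eqP.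
by rewrite mulf_eq0 (negbTE p0) mulrn_eq0/=; exact/negP.
Qed.

Section JacobianLeadingTerm.
Context {R : realType}.
Variables (P Q : {poly {poly R}}) (m : nat).
Hypotheses (sP : (size P <= m.+2)%N) (sQ : (size Q <= m.+2)%N).

Lemma jacobian_neq0 : P`_m.+1 * deriv Q`_m.+1 != Q`_m.+1 * deriv P`_m.+1 ->
  jacobian P Q != 0.
Proof.
have size_deriv (A : {poly {poly R}}) : (size A <= m.+2)%N -> (size (deriv A) <= m.+1)%N.
  by move=> sA; apply: leq_trans (size_poly _ _) _; case: (size A) sA.
have size_bideriv (A : {poly {poly R}}) : (size A <= m.+2)%N -> (size (bideriv A) <= m.+2)%N.
  by move=> sA; apply: leq_trans (size_poly _ _) sA.
apply: contraNneq => /polyP/(_ (m + m.+1)%N).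
rewrite coef0 coefB !coefM_top ?size_deriv ?size_bideriv//.
rewrite !coef_deriv !coef_map/= => /eqP; rewrite !mulrnAl -mulrnBl.
rewrite -mulr_natl mulf_eq0 => /orP[|]; last by rewrite subr_eq0.
by rewrite -polyC_natr polyC_eq0 pnatr_eq0.
Qed.

Lemma deriv_neq0 : P`_m.+1 != 0 -> deriv P != 0.
Proof.
apply: contraNneq => /polyP/(_ m); rewrite coef0 coef_deriv => /eqP.
by rewrite -mulr_natl mulf_eq0 -polyC_natr polyC_eq0 pnatr_eq0.
Qed.
End JacobianLeadingTerm.

(** * Gaussian laws and independence in isonormal processes *)

Section LebesgueInvariance.
Context {R : realType}.
Local Notation mu := (@lebesgue_measure R).
Local Open Scope ereal_scope.

Let lebesgue_measure_shift (a : R) (A : set R) : measurable A ->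
  pushforward mu (fun x : measurableTypeR R => (x + a)%R : measurableTypeR R) A = mu A.
Proof.
have mf : measurable_fun [set: measurableTypeR R]
    (fun x : measurableTypeR R => (x + a)%R : measurableTypeR R).
  have := @measurable_funD _ R R setT id (cst a); exact.
pose X : {mfun (measurableTypeR R) >-> (measurableTypeR R)} :=
  HB.pack (fun x : measurableTypeR R => (x + a)%R : measurableTypeR R)
   (isMeasurableFun.Build _ _ _ _ _ mf).
move=> mA; apply/esym.
apply: (@lebesgue_measure_unique R (pushforward mu X)) => //= _ [[b c]] _ <-.
rewrite /pushforward (_ : _ @^-1` _ = `](b - a)%R, (c - a)%R]%classic).
  rewrite !lebesgue_measure_itv/= !lte_fin ltrBDr subrK.
  by case: ltP => // _; rewrite -!EFinB; congr EFin; ring.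
by apply/seteqP; split => x /=; rewrite !in_itv/= ltrBlDr lerBrDr.
Qed.

Lemma ge0_integral_shift (f : R -> \bar R) (a : R) : measurable_fun setT f ->
  (forall x, 0 <= f x) -> \int[mu]_x f (x + a)%R = \int[mu]_x f x.
Proof.
move=> mf f0; have ms : measurable_fun setT (fun x : R => (x + a)%R).
  exact: measurable_funD.
have := @ge0_integral_pushforward _ _ (measurableTypeR R) (measurableTypeR R) R
  _ ms mu setT f measurableT mf (fun x _ => f0 x).
rewrite preimage_setT/= => <-.
by apply: eq_measure_integral => //= A mA _; exact: lebesgue_measure_shift.
Qed.

Lemma ge0_integral_oppr (f : R -> \bar R) : measurable_fun setT f ->
  (forall x, 0 <= f x) -> \int[mu]_x f (- x)%R = \int[mu]_x f x.
Proof.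
move=> mf f0; have ms : measurable_fun setT (-%R : R -> R) by exact: measurable_funN.
have := @ge0_integral_pushforward _ _ (measurableTypeR R) (measurableTypeR R) R
  _ ms mu setT f measurableT mf (fun x _ => f0 x).
rewrite preimage_setT/= => <-.
by apply: eq_measure_integral => //= A mA _; exact: lebesgue_measureN.
Qed.

End LebesgueInvariance.

Section NormalDensity.
Context {R : realType}.
Local Notation mu := (@lebesgue_measure R).
Implicit Types m s t u a x y : R.

Lemma normal_pdf_formula m s x : s != 0 -> normal_pdf m s x =
  (Num.sqrt (s ^+ 2 * pi *+ 2))^-1 * expR (- (x - m) ^+ 2 / (s ^+ 2 *+ 2)).
Proof. by move=> s0; rewrite normal_pdfE. Qed.

(** Completing the square in the exponent: this and the next two identities reduce Gaussian
    integrals to the total mass of a normal density. *)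
Lemma normal_pdf_exp m s a x : s != 0 ->
  expR (a * x) * normal_pdf m s x =
  expR (a * m + a ^+ 2 * s ^+ 2 / 2) * normal_pdf (m + s ^+ 2 * a) s x.
Proof.
move=> s0; rewrite !normal_pdf_formula// mulrCA -expRD mulrCA -expRD.
by congr (_ * expR _); field; rewrite s0.
Qed.

Lemma normal_pdf_sqr s u x : s != 0 -> 2 * u * s ^+ 2 < 1 ->
  let r := (Num.sqrt (1 - 2 * u * s ^+ 2))^-1 in
  expR (u * x ^+ 2) * normal_pdf 0 s x = r * normal_pdf 0 (s * r) x.
Proof.
move=> s0 us /=; set w := 1 - _; have w0 : 0 < w by rewrite subr_gt0.
have sw0 : Num.sqrt w != 0 by rewrite gt_eqF// sqrtr_gt0.
have sr0 : s * (Num.sqrt w)^-1 != 0 by rewrite mulf_neq0// invr_eq0.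
rewrite !normal_pdf_formula// mulrCA -expRD mulrA exprMn exprVn sqr_sqrtr ?ltW//.
congr (_ * expR _); last first.
  by rewrite /w; field; rewrite s0 /= gt_eqF.
rewrite (_ : s ^+ 2 * w^-1 * pi *+ 2 = w^-1 * (s ^+ 2 * pi *+ 2)); last by ring.
rewrite sqrtrM ?invr_ge0 ?ltW// sqrtrV ?ltW// invfM invrK mulrA mulVf// mul1r.
by [].
Qed.

Lemma normal_pdf_convolution s t x y : s != 0 -> t != 0 ->
  let r := Num.sqrt (s ^+ 2 + t ^+ 2) in
  normal_pdf y s x * normal_pdf 0 t y =
  normal_pdf 0 r x * normal_pdf (t ^+ 2 * x / r ^+ 2) (s * t / r) y.
Proof.
move=> s0 t0 /=; have r0 : 0 < s ^+ 2 + t ^+ 2.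
  by rewrite ltr_pwDl ?sqr_ge0// exprn_even_gt0.
have sr0 : Num.sqrt (s ^+ 2 + t ^+ 2) != 0 by rewrite gt_eqF// sqrtr_gt0.
rewrite !normal_pdf_formula// ?mulf_neq0 ?invr_eq0//.
rewrite !exprMn !exprVn sqr_sqrtr ?ltW//.
rewrite mulrACA -expRD [RHS]mulrACA -expRD; congr (_ * expR _); last first.
  by field; rewrite s0 t0 /= gt_eqF.
rewrite -!invfM -!sqrtrM; last 2 first.
- by rewrite pmulrn_lge0// mulr_ge0 ?sqr_ge0 ?pi_ge0// ltW.
- by rewrite pmulrn_lge0// mulr_ge0 ?sqr_ge0 ?pi_ge0.
by congr (Num.sqrt _)^-1; field; rewrite gt_eqF.
Qed.

End NormalDensity.

Lemma measurable_cosr (R : realType) : measurable_fun [set: R] (@cos R).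
Proof. by apply: continuous_measurable_fun; exact: continuous_cos. Qed.

Lemma measurable_sinr (R : realType) : measurable_fun [set: R] (@sin R).
Proof. by apply: continuous_measurable_fun; exact: continuous_sin. Qed.

Lemma cos_norm_le1 (R : realType) (x : R) : `|cos x| <= 1.
Proof. by rewrite ler_norml cos_geN1 cos_le1. Qed.

Lemma sin_norm_le1 (R : realType) (x : R) : `|sin x| <= 1.
Proof. by rewrite ler_norml sin_geN1 sin_le1. Qed.

Section NormalIntegrals.
Context {R : realType}.
Local Notation mu := (@lebesgue_measure R).

Lemma integrable_bounded_normal (f : R -> R) M m s : measurable_fun setT f ->
  (forall x, `|f x| <= M) ->
  mu.-integrable setT (fun x => (f x * normal_pdf m s x)%:E).
Proof.
move=> mf fM; have := integrable_normal_pdf m s.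
move=> /(integrableZl measurableT M); apply: le_integrable => //.
  apply/measurable_EFinP; apply: measurable_funM => //; exact: measurable_normal_pdf.
move=> x _; rewrite -EFinM/= lee_fin !normrM ler_wpM2r//.
by rewrite (le_trans (fM x))// ler_norm.
Qed.

Lemma integral_normal_pdfr m s : \int[mu]_x normal_pdf m s x = 1.
Proof. by rewrite /Rintegral integral_normal_pdf. Qed.

(** The characteristic function at 1 of a centered normal law. Its multiplicativity [normal_cosM]
    takes the place of a closed form. *)
Definition normal_cos (s : R) : R := \int[mu]_x (cos x * normal_pdf 0 s x).

(** Reflection of the line exchanges [1 + sin] and [1 - sin], which are nonnegative, as
    [ge0_integral_oppr] demands. *)
Lemma normal_sin (s : R) : s != 0 -> \int[mu]_x (sin x * normal_pdf 0 s x) = 0.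
Proof.
move=> s0; have mpdf := measurable_normal_pdf 0 s.
have i1 : mu.-integrable setT (fun x => (normal_pdf 0 s x)%:E) := integrable_normal_pdf 0 s.
have i2 : mu.-integrable setT (fun x => (sin x * normal_pdf 0 s x)%:E).
  by apply: (@integrable_bounded_normal _ 1); [exact: measurable_sinr|exact: sin_norm_le1].
have E : (\int[mu]_x (normal_pdf 0 s x + sin x * normal_pdf 0 s x)%:E =
          \int[mu]_x (normal_pdf 0 s x - sin x * normal_pdf 0 s x)%:E)%E.
  rewrite -[LHS]ge0_integral_oppr; last 2 first.
  - apply/measurable_EFinP; apply: measurable_funD => //.
    by apply: measurable_funM => //; exact: measurable_sinr.
  - move=> x; rewrite lee_fin -{1}[normal_pdf _ _ _]mul1r -mulrDl.
    by apply: mulr_ge0; [have := sin_geN1 x; lra|exact: normal_pdf_ge0].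
  apply: eq_integral => x _; congr EFin.
  have -> : normal_pdf 0 s (- x) = normal_pdf 0 s x.
    by rewrite !normal_pdf_formula// !subr0 sqrrN.
  by rewrite sinN mulNr.
have := congr1 fine E; rewrite -/(Rintegral mu setT _) -/(Rintegral mu setT _).
rewrite RintegralD// RintegralB// integral_normal_pdfr; lra.
Qed.

(** The integral of [1 + cos x] against [normal_pdf_convolution] is computed in both orders. Adding
    1 makes the integrand nonnegative for Tonelli; a shift centers the inner integral in x, and the
    sine terms vanish. *)
Lemma normal_cosM (s t : R) : s != 0 -> t != 0 ->
  normal_cos (Num.sqrt (s ^+ 2 + t ^+ 2)) = normal_cos s * normal_cos t.
Proof.
move=> s0 t0; set r := Num.sqrt _; have r20 : 0 < s ^+ 2 + t ^+ 2.
  by rewrite ltr_pwDl ?sqr_ge0// exprn_even_gt0.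
have r0 : r != 0 by rewrite gt_eqF// sqrtr_gt0.
have str0 : s * t / r != 0 by rewrite !mulf_neq0// invr_eq0.
have int1cos u a b : mu.-integrable setT (fun x => ((1 + a * cos x + b * sin x) * normal_pdf 0 u x)%:E).
  apply: (@integrable_bounded_normal _ (1 + `|a| + `|b|)).
    apply: measurable_funD; first apply: measurable_funD => //; apply: measurable_funM => //.
      exact: measurable_cosr.
    exact: measurable_sinr.
  move=> x; rewrite (le_trans (ler_normD _ _))// lerD//.
    rewrite (le_trans (ler_normD _ _))// normr1 lerD2l normrM -[leRHS]mulr1.
    by rewrite ler_wpM2l ?cos_norm_le1.
  by rewrite normrM -[leRHS]mulr1 ler_wpM2l ?sin_norm_le1.
have val u a b : u != 0 ->
    (\int[mu]_x ((1 + a * cos x + b * sin x) * normal_pdf 0 u x)%:E =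
     (1 + a * normal_cos u)%:E)%E.
  move=> u0; rewrite -[LHS]fineK; last exact: integrable_fin_num.
  congr EFin; rewrite -/(Rintegral mu setT _).
  have ic : mu.-integrable setT (fun x => (cos x * normal_pdf 0 u x)%:E).
    by apply: (@integrable_bounded_normal _ 1); [exact: measurable_cosr|exact: cos_norm_le1].
  have is_ : mu.-integrable setT (fun x => (sin x * normal_pdf 0 u x)%:E).
    by apply: (@integrable_bounded_normal _ 1); [exact: measurable_sinr|exact: sin_norm_le1].
  have iac : mu.-integrable setT (fun x => (a * (cos x * normal_pdf 0 u x))%:E).
    exact: (integrableZl measurableT a ic).
  have ibs : mu.-integrable setT (fun x => (b * (sin x * normal_pdf 0 u x))%:E).
    exact: (integrableZl measurableT b is_).
  have i1 : mu.-integrable setT (fun x => (normal_pdf 0 u x)%:E) := integrable_normal_pdf 0 u.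
  under eq_Rintegral do rewrite !mulrDl mul1r -!mulrA.
  rewrite RintegralD//; last exact: (integrableD measurableT i1 iac).
  rewrite RintegralD// integral_normal_pdfr !RintegralZl// normal_sin//.
  by rewrite mulr0 addr0.
pose h (z : R * R) := ((1 + cos z.1) * (normal_pdf z.2 s z.1 * normal_pdf 0 t z.2))%:E.
have mh : measurable_fun setT h.
  apply/measurable_EFinP; apply: measurable_funM.
    by apply: measurable_funD => //; apply: measurableT_comp => //; exact: measurable_cosr.
  apply: measurable_funM; last first.
    by apply: measurableT_comp => //; exact: measurable_normal_pdf.
  under eq_fun do rewrite normal_pdf_formula//.
  apply: measurable_funM => //; apply: measurableT_comp => //.
  apply: measurable_funM => //; apply: measurable_funN; apply: measurable_funX.
  exact: measurable_funB.
have h0 z : (0 <= h z)%E.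
  by rewrite lee_fin !mulr_ge0 ?normal_pdf_ge0//; have := cos_geN1 z.1; lra.
have := @fubini_tonelli _ _ _ _ R mu mu h mh h0; rewrite /h/=.
have -> : (\int[mu]_x \int[mu]_y ((1 + cos x) * (normal_pdf y s x * normal_pdf 0 t y))%:E =
    (1 + normal_cos r)%:E)%E.
  transitivity (\int[mu]_x ((1 + 1 * cos x + 0 * sin x) * normal_pdf 0 r x)%:E)%E; last first.
    by rewrite val// mul1r.
  apply: eq_integral => x _.
  transitivity (\int[mu]_y (((1 + cos x) * normal_pdf 0 r x)%:E *
    (normal_pdf (t ^+ 2 * x / r ^+ 2) (s * t / r) y)%:E))%E.
    by apply: eq_integral => y _; rewrite normal_pdf_convolution// -EFinM mulrA.
  rewrite integralZl//; last exact: integrable_normal_pdf.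
  by rewrite integral_normal_pdf mule1 mul1r mul0r addr0.
have -> : (\int[mu]_y \int[mu]_x ((1 + cos x) * (normal_pdf y s x * normal_pdf 0 t y))%:E =
    (1 + normal_cos s * normal_cos t)%:E)%E.
  transitivity (\int[mu]_y ((1 + normal_cos s * cos y + 0 * sin y) * normal_pdf 0 t y)%:E)%E; last first.
    by rewrite val.
  apply: eq_integral => y _.
  transitivity (\int[mu]_x ((normal_pdf 0 t y)%:E *
     ((1 + cos x) * normal_pdf y s x)%:E))%E.
    by apply: eq_integral => x _; rewrite -EFinM; congr EFin; ring.
  have mc : measurable_fun [set: R] (fun x => ((1 + cos x) * normal_pdf y s x)%:E).
    apply/measurable_EFinP; apply: measurable_funM; last exact: measurable_normal_pdf.
    by apply: measurable_funD => //; exact: measurable_cosr.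
  have c0 x : (0 <= ((1 + cos x) * normal_pdf y s x)%:E)%E.
    by rewrite lee_fin mulr_ge0 ?normal_pdf_ge0//; have := cos_geN1 x; lra.
  rewrite ge0_integralZl//; last by rewrite lee_fin normal_pdf_ge0.
  rewrite -(ge0_integral_shift y mc c0).
  transitivity ((normal_pdf 0 t y)%:E *
    \int[mu]_x ((1 + cos y * cos x + - sin y * sin x) * normal_pdf 0 s x)%:E)%E.
    congr (_ * _)%E; apply: eq_integral => x _; congr EFin.
    rewrite !normal_pdf_formula// addrK subr0 cosD; ring.
  by rewrite val// -EFinM; congr EFin; ring.
by case=> /addrI.
Qed.

End NormalIntegrals.

(* A centered normal X of variance S has E exp (u X^2) = (1 - 2 u S)^(-1/2),
   which is at least 1 + u E X^2: comparing slopes at u = 0 gives S = E X^2. *)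
Lemma tangent_slope_unique (R : realType) (v S : R) : 0 <= v -> 0 < S ->
  (forall u, 2 * u * S < 1 -> 0 <= 1 + u * v -> (1 + u * v) ^+ 2 * (1 - 2 * u * S) <= 1) ->
  S = v.
Proof.
move=> v0 S0 H; apply/eqP; rewrite eq_le.
apply/andP; split; rewrite leNgt; apply/negP => lt.
(* At [u = - e] the left side of the hypothesis is 1 + 2 e (S - v) up to terms of order e^2; this
   [e] is small enough for the linear term to push it above 1. The second case takes [u = e]. *)
- set e := (S - v) / (4 * S ^+ 2).
  have eE : e * (4 * S ^+ 2) = S - v by rewrite divfK// mulf_neq0 ?expf_neq0 ?gt_eqF.
  have e0 : 0 < e by rewrite divr_gt0 ?subr_gt0// mulr_gt0// exprn_gt0.
  have evE : e * v * (4 * S ^+ 2) = (S - v) * v by rewrite mulrAC eE.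
  have S2 : 0 < S ^+ 2 by rewrite exprn_gt0.
  have ev : e * v <= 1.
    rewrite -(ler_pM2r (_ : 0 < 4 * S ^+ 2)) ?evE; last by rewrite mulr_gt0.
    nra.
  have eS0 : 0 < e * S by rewrite mulr_gt0.
  have h1 : 2 * - e * S < 1 by lra.
  have h2 : 0 <= 1 + - e * v by lra.
  have h3 := H (- e) h1 h2.
  have h4 : (1 - 2 * e * v) * (1 + 2 * e * S) <= 1.
    have h5 : 0 <= (e * v) ^+ 2 * (1 + 2 * e * S) by rewrite mulr_ge0 ?sqr_ge0//; lra.
    apply: le_trans h3; rewrite -subr_ge0; apply: le_trans h5 _.
    by rewrite le_eqVlt; apply/orP; left; apply/eqP; ring.
  have h6 : e * (S - v) <= e * (2 * (e * v) * S).
    by rewrite -(ler_pM2l (_ : 0 < 2))//; lra.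
  rewrite ler_pM2l// in h6.
  have h7 : 2 * S * (S - v) <= (S - v) * v.
    rewrite -evE; apply: le_trans (_ : 2 * S * (2 * (e * v) * S) <= _).
      by rewrite ler_pM2l// mulr_gt0.
    by rewrite le_eqVlt; apply/orP; left; apply/eqP; ring.
  by move: h7; rewrite mulrC ler_pM2l ?subr_gt0//; lra.
- set e := (v - S) / (4 * v * S).
  have vp : 0 < v by exact: lt_trans lt.
  have eE : e * (4 * v * S) = v - S by rewrite divfK// !mulf_neq0 ?gt_eqF.
  have e0 : 0 < e by rewrite divr_gt0 ?subr_gt0// !mulr_gt0.
  have h1 : 2 * e * S < 1.
    rewrite -(ltr_pM2r (_ : 0 < 2 * v)) ?mulr_gt0//.
    have -> : 2 * e * S * (2 * v) = e * (4 * v * S) by ring.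
    by rewrite eE; lra.
  have h2 : 0 <= 1 + e * v by rewrite addr_ge0// mulr_ge0// ltW.
  have h3 := H e h1 h2.
  have h4 : (1 + 2 * e * v) * (1 - 2 * e * S) <= 1.
    have h5 : 0 <= (e * v) ^+ 2 * (1 - 2 * e * S) by rewrite mulr_ge0 ?sqr_ge0//; lra.
    apply: le_trans h3; rewrite -subr_ge0; apply: le_trans h5 _.
    by rewrite le_eqVlt; apply/orP; left; apply/eqP; ring.
  have h6 : e * (v - S) <= e * (2 * e * v * S).
    by rewrite -(ler_pM2l (_ : 0 < 2))//; lra.
  rewrite ler_pM2l// in h6.
  have : 2 * (v - S) <= v - S.
    rewrite -[leRHS]eE; apply: le_trans (_ : 2 * (2 * e * v * S) <= _).
      by rewrite ler_pM2l.
    by rewrite le_eqVlt; apply/orP; left; apply/eqP; ring.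
  by lra.
Qed.

Section GaussianLaw.
Context {d : measure_display} {Omega : measurableType d} {R : realType}.
Context (P : probability Omega R).
Local Notation mu := (@lebesgue_measure R).
Implicit Type X : {RV P >-> R}.

Lemma Rintegral_cst1 (a : R) : \int[P]_w a = a.
Proof.
rewrite Rintegral_cst// (_ : fine _ = 1) ?mulr1//.
exact: (congr1 fine (probability_setT P)).
Qed.

Lemma integrable_bounded (f : Omega -> R) M : measurable_fun setT f ->
  (forall w, `|f w| <= M) -> P.-integrable setT (EFin \o f).
Proof.
move=> mf fM; apply: measurable_bounded_integrable => //.
  by apply: (@le_lt_trans _ _ 1%E); [exact: probability_le1|exact: ltry].
by exists M; split; [exact: num_real|move=> x Mx w _; exact: le_trans (fM w) (ltW Mx)].
Qed.

Definition centered_law X (s : R) := forall A : set R, measurable A ->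
  pushforward P X A = if s == 0 then \d_(0 : R) A else normal_prob 0 s A.

Section NormalLaw.
Variables (X : {RV P >-> R}) (m s : R).
Hypothesis s0 : s != 0.
Hypothesis lawX : forall A : set R, measurable A -> pushforward P X A = normal_prob m s A.

Lemma ge0_integral_normal_law (f : R -> R) : measurable_fun setT f ->
  (forall x, 0 <= f x) ->
  (\int[P]_w (f (X w))%:E = \int[mu]_x (f x * normal_pdf m s x)%:E)%E.
Proof.
move=> mf f0; have mEf : measurable_fun setT (EFin \o f) by exact/measurable_EFinP.
have mX : measurable_fun setT (X : Omega -> measurableTypeR R) := measurable_funP X.
pose X' : {mfun Omega >-> measurableTypeR R} :=
  HB.pack (X : Omega -> measurableTypeR R) (isMeasurableFun.Build _ _ _ _ _ mX).
transitivity (\int[normal_prob m s]_x (f x)%:E)%E.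
  have f0' : {in [set: measurableTypeR R], forall x, (0 <= (EFin \o f) x)%E}.
    by move=> x _; rewrite /= lee_fin.
  have := @ge0_integral_pushforward _ _ Omega (measurableTypeR R) R _ mX P setT
    (EFin \o f) measurableT mEf f0'.
  rewrite preimage_setT => <-.
  rewrite (_ : pushforward P _ = pushforward P X')//.
  by apply: eq_measure_integral => A mA _; exact: lawX.
rewrite -(Radon_Nikodym_SigmaFinite.change_of_variables (normal_prob_dominates m s))//.
apply: ge0_ae_eq_integral => //.
- apply: emeasurable_funM => //.
  exact: measurable_int (Radon_Nikodym_SigmaFinite.f_integrable (normal_prob_dominates m s)).
- by apply/measurable_EFinP; apply: measurable_funM => //; exact: measurable_normal_pdf.
- move=> x _; rewrite mule_ge0 ?lee_fin//.
  exact: Radon_Nikodym_SigmaFinite.f_ge0 (normal_prob_dominates m s) x.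
- by move=> x _; rewrite lee_fin mulr_ge0 ?normal_pdf_ge0.
(* The change of variables produces the abstract Radon-Nikodym derivative. It agrees almost
   everywhere with the normal density, as both have the same integrals over measurable sets. *)
have : ae_eq mu setT (Radon_Nikodym_SigmaFinite.f (normal_prob m s) mu)
    (fun x => (normal_pdf m s x)%:E).
  apply: integral_ae_eq => //.
  - exact: Radon_Nikodym_SigmaFinite.f_integrable (normal_prob_dominates m s).
  - by apply/measurable_EFinP; exact: measurable_normal_pdf.
  - move=> A _ mA.
    by rewrite -(Radon_Nikodym_SigmaFinite.f_integral (normal_prob_dominates m s)).
by apply: filterS => x /= /(_ Logic.I) -> _; rewrite EFinM.
Qed.

Lemma Rintegral_normal_law (f : R -> R) : measurable_fun setT f ->
  (forall x, `|f x| <= 1) ->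
  \int[P]_w f (X w) = \int[mu]_x (f x * normal_pdf m s x).
Proof.
move=> mf f1.
have f0 x : 0 <= 1 + f x by have := f1 x; rewrite ler_norml => /andP[]; lra.
have mf1 : measurable_fun setT (fun x => 1 + f x) by exact: measurable_funD.
have := congr1 fine (ge0_integral_normal_law mf1 f0).
rewrite -/(Rintegral P setT _) -/(Rintegral mu setT _).
rewrite RintegralD//; last 2 first.
- exact: finite_measure_integrable_cst.
- by apply: (@integrable_bounded _ 1) => //; exact: measurableT_comp.
rewrite Rintegral_cst1.
have -> : \int[mu]_x ((1 + f x) * normal_pdf m s x) =
    1 + \int[mu]_x (f x * normal_pdf m s x).
  under eq_Rintegral do rewrite mulrDl mul1r.
  rewrite RintegralD//; last 2 first.
  - exact: integrable_normal_pdf.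
  - exact: (@integrable_bounded_normal _ _ 1).
  by rewrite integral_normal_pdfr.
exact: addrI.
Qed.

Lemma integral_expR_normal_law (a : R) :
  (\int[P]_w (expR (a * X w))%:E = (expR (a * m + a ^+ 2 * s ^+ 2 / 2))%:E)%E.
Proof.
rewrite (@ge0_integral_normal_law (fun x => expR (a * x))); last 2 first.
- by apply: measurableT_comp => //; exact: measurable_funM.
- by move=> x; exact: expR_ge0.
under eq_integral do rewrite normal_pdf_exp// EFinM.
by rewrite integralZl//= ?integral_normal_pdf ?mule1//; exact: integrable_normal_pdf.
Qed.

Lemma integral_expR_sqr_normal_law (u : R) : m = 0 -> 2 * u * s ^+ 2 < 1 ->
  (\int[P]_w (expR (u * X w ^+ 2))%:E = ((Num.sqrt (1 - 2 * u * s ^+ 2))^-1)%:E)%E.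
Proof.
move=> m0 us.
rewrite (@ge0_integral_normal_law (fun x => expR (u * x ^+ 2))); last 2 first.
- by apply: measurableT_comp => //; apply: measurable_funM => //; exact: measurable_funX.
- by move=> x; exact: expR_ge0.
rewrite m0; under eq_integral do rewrite normal_pdf_sqr// EFinM.
by rewrite integralZl//= ?integral_normal_pdf ?mule1//; exact: integrable_normal_pdf.
Qed.

End NormalLaw.

Section Moments.
Variables (X : {RV P >-> R}) (v : R).
Hypothesis EX : (\int[P]_w (X w)%:E = 0)%E.
Hypothesis EX2 : (\int[P]_w (X w * X w)%:E = v%:E)%E.

Let iX2 : P.-integrable setT (fun w => (X w * X w)%:E).
Proof.
apply/integrableP; split; first by apply/measurable_EFinP; exact: measurable_funM.
under eq_integral do rewrite gee0_abs ?lee_fin -?expr2 ?sqr_ge0//.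
by under eq_integral do rewrite expr2; rewrite EX2 ltry.
Qed.

Let iX : P.-integrable setT (fun w => (X w)%:E).
Proof.
have i1 : P.-integrable setT (fun w => (1 + X w * X w)%:E).
  exact: (integrableD measurableT (finite_measure_integrable_cst P 1 measurableT) iX2).
apply: le_integrable i1 => //; first exact/measurable_EFinP.
move=> w _ /=; rewrite lee_fin (ger0_norm (_ : 0 <= 1 + _)); last first.
  by rewrite addr_ge0// -expr2 sqr_ge0.
rewrite -expr2 ler_norml; apply/andP; split; nra.
Qed.

Let le_exp (Y : Omega -> R) (e y : R) : P.-integrable setT (fun w => (Y w)%:E) ->
  \int[P]_w Y w = y -> measurable_fun setT Y ->
  (\int[P]_w (expR (Y w))%:E = e%:E)%E -> 1 + y <= e.
Proof.
move=> iY Yy mY Ye; have i1 : P.-integrable setT (fun w => 1%:E) by exact: finite_measure_integrable_cst.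
have ie : P.-integrable setT (fun w => (expR (Y w))%:E).
  apply/integrableP; split; first by apply/measurable_EFinP; exact: measurableT_comp.
  by under eq_integral do rewrite gee0_abs ?lee_fin ?expR_ge0//; rewrite Ye ltry.
have <- : \int[P]_w expR (Y w) = e by rewrite /Rintegral Ye.
have <- : \int[P]_w (1 + Y w) = 1 + y by rewrite RintegralD// Rintegral_cst1 Yy.
apply: le_Rintegral => //; first exact: (integrableD measurableT i1 iY).
by move=> w _; exact: expR_ge1Dx.
Qed.

(** [gaussian] leaves the mean and the scale free. Integrating [1 + y <= expR y], with y a multiple
    of [X] or of its square, bounds exponential integrals of known value from below; this forces
    mean 0 and variance [v]. *)
Lemma gaussian_centered : gaussian P X -> exists2 s, s ^+ 2 = v & centered_law X s.
Proof.
have EXr : \int[P]_w X w = 0 by rewrite /Rintegral EX.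
have EX2r : \int[P]_w (X w * X w) = v by rewrite /Rintegral EX2.
have v0 : 0 <= v by rewrite -EX2r; apply: Rintegral_ge0 => w _; rewrite -expr2 sqr_ge0.
move=> [m [s]]; have [_|s0] := eqVneq s 0.
  move=> law; have Xm : {ae P, forall w, X w = m}.
    exists (X @^-1` (~` [set m])); split.
    - rewrite -[Y in measurable Y]setTI; apply: measurable_funP => //.
      by apply: measurableC.
    - have := law (~` [set m]) (measurableC (measurable_set1 m)).
      rewrite /pushforward => ->; rewrite diracE.
      by rewrite memNset//; apply.
    - by move=> w /=.
  have m0 : m = 0.
    rewrite -EXr -(Rintegral_cst1 m) /Rintegral; congr fine.
    apply: ae_eq_integral => //; first exact/measurable_EFinP.
    by apply: filterS Xm => w ->.
  exists 0; last by move=> A mA; rewrite law// m0 eqxx.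
  rewrite -EX2r; transitivity (\int[P]_w (0 : R)).
    by rewrite Rintegral_cst1 expr0n.
  rewrite /Rintegral; congr fine.
  apply: ae_eq_integral => //; first by apply/measurable_EFinP; exact: measurable_funM.
  by apply: filterS Xm => w ->; rewrite m0 mulr0.
move=> law.
have s20 : 0 < s ^+ 2 by rewrite exprn_even_gt0.
have m0 : m = 0.
  have H a : 0 <= a * m + a ^+ 2 * s ^+ 2 / 2.
    rewrite -ler_expR expR0 -[leLHS]addr0.
    apply: (le_exp (Y := fun w => a * X w)).
    - exact: (integrableZl measurableT a iX).
    - by rewrite RintegralZl// EXr mulr0.
    - exact: measurable_funM.
    - exact: integral_expR_normal_law.
  (* The minimizer of the quadratic in [H]. *)
  have := H (- m / s ^+ 2).
  rewrite (_ : _ + _ = - (m ^+ 2 / (2 * s ^+ 2))); last by field.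
  have s22 : 0 < (2 * s ^+ 2)^-1 by rewrite invr_gt0 (mulr_gt0 _ s20).
  rewrite oppr_ge0 pmulr_lle0// => m2.
  by apply/eqP; rewrite -sqrf_eq0 eq_le m2 sqr_ge0.
have H u : 2 * u * s ^+ 2 < 1 -> 1 + u * v <= (Num.sqrt (1 - 2 * u * s ^+ 2))^-1.
  move=> us; apply: (le_exp (Y := fun w => u * X w ^+ 2)).
  - have := integrableZl measurableT u iX2.
    by apply: eq_integrable => // w _; rewrite /= expr2.
  - under eq_Rintegral do rewrite expr2.
    by rewrite RintegralZl// EX2r.
  - by apply: measurable_funM => //; exact: measurable_funX.
  - exact: (integral_expR_sqr_normal_law s0 law m0 us).
have H2 u : 2 * u * s ^+ 2 < 1 -> 0 <= 1 + u * v ->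
    (1 + u * v) ^+ 2 * (1 - 2 * u * s ^+ 2) <= 1.
  move=> us uv; have w0 : 0 < 1 - 2 * u * s ^+ 2 by rewrite subr_gt0.
  rewrite -(sqr_sqrtr (ltW w0)) -exprMn expr_le1//; last first.
    by rewrite mulr_ge0// sqrtr_ge0.
  by rewrite -ler_pdivlMr ?sqrtr_gt0// mul1r H.
exists s; last by move=> A mA; rewrite law// m0 (negbTE s0).
exact: tangent_slope_unique.
Qed.

End Moments.
End GaussianLaw.

(** * Indicators as bounded limits of trigonometric functions *)

Section StepPolynomials.
Context {R : realType}.
Implicit Types (u r x y : R) (n k : nat).

Lemma bernoulli_ineq y k : -1 <= y -> 1 + k%:R * y <= (1 + y) ^+ k.
Proof.
move=> y1; elim: k => [|k IHk]; first by rewrite mul0r addr0 expr0.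
rewrite exprS; apply: (@le_trans _ _ ((1 + y) * (1 + k%:R * y))).
  rewrite -natr1 -subr_ge0 (_ : _ - _ = k%:R * y ^+ 2); last by ring.
  by rewrite mulr_ge0 ?sqr_ge0.
by rewrite ler_wpM2l//; lra.
Qed.

(** Write r = s^2. Bernoulli's inequality for 1 / s bounds n s^n, and the other factor s^n tends to
    0. *)
Lemma cvg_natr_expr r : 0 <= r -> r < 1 -> (fun n => n%:R * r ^+ n) @ \oo --> (0 : R).
Proof.
rewrite le_eqVlt => /predU1P[<- _|r0 r1].
  apply: cvg_near_cst; near=> n; rewrite expr0n.
  by rewrite (_ : n == 0%N = false) ?mulr0//; apply/negbTE; rewrite -lt0n; near: n; exact: nbhs_infty_gt.
pose s := Num.sqrt r; have s0 : 0 < s by rewrite sqrtr_gt0.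
have s1 : s < 1 by rewrite -sqrtr1 ltr_sqrt.
have rE : r = s * s by rewrite -expr2 sqr_sqrtr// ltW.
apply: (@squeeze_cvgr _ _ _ _ (fun=> 0) (fun n => s / (1 - s) * s ^+ n)).
- near=> n; rewrite mulr_ge0//=; last by rewrite exprn_ge0// ltW.
  rewrite rE exprMn mulrA ler_wpM2r ?exprn_ge0 ?(ltW s0)//.
  have b : 1 + n%:R * (s^-1 - 1) <= (s^-1) ^+ n.
    have si0 : 0 < s^-1 by rewrite invr_gt0.
    have := @bernoulli_ineq (s^-1 - 1) n.
    by rewrite (_ : 1 + (s^-1 - 1) = s^-1); [apply; lra|ring].
  have sn0 : 0 < s ^+ n by rewrite exprn_gt0.
  have c : n%:R * (s^-1 - 1) * s ^+ n <= 1.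
    rewrite -ler_pdivlMr// div1r -exprVn; apply: le_trans b.
    by rewrite lerDr.
  rewrite ler_pdivlMr ?subr_gt0//.
  rewrite (_ : _ * (1 - s) = s * (n%:R * (s^-1 - 1) * s ^+ n)); last first.
    by field; rewrite gt_eqF.
  by rewrite -[leRHS]mulr1 ler_wpM2l// ltW.
- exact: cvg_cst.
- rewrite -[X in _ --> X](mulr0 (s / (1 - s))); apply: cvgM; first exact: cvg_cst.
  by apply: cvg_expr; rewrite ger0_norm// ltW.
Unshelve. all: by end_near. Qed.

(* Polynomials in u that approach the indicator of u < 1/2; the factor n in the
   exponent makes the limit 0 also at u = 1/2. *)
Definition step_poly n u : R := (1 - u ^+ n) ^+ (n * 2 ^ n).

Lemma step_poly_itv n u : 0 <= u <= 1 -> 0 <= step_poly n u <= 1.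
Proof.
move=> /andP[u0 u1]; have un : 0 <= u ^+ n <= 1 by rewrite exprn_ge0//= exprn_ile1.
move/andP: un => [un0 un1].
by rewrite exprn_ge0 ?subr_ge0//= exprn_ile1 ?subr_ge0// gerBl.
Qed.

(** Below 1/2, Bernoulli's inequality gives the lower bound 1 - n (2u)^n. From 1/2 on, the product
    with (1 + u^n)^(n 2^n) is at most 1, while that factor is at least n + 1. *)
Lemma cvg_step_poly u : 0 <= u <= 1 ->
  step_poly n u @[n --> \oo] --> ((u < 2^-1)%R%:R : R).
Proof.
move=> u01; move/andP: (u01) => [u0 u1]; case: ltP => u2.
- apply: (@squeeze_cvgr _ _ _ _ (fun n => 1 - n%:R * (2 * u) ^+ n) (fun=> 1)).
  + near=> n; have /andP[_ ->] := step_poly_itv n u01; rewrite andbT.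
    have := @bernoulli_ineq (- u ^+ n) (n * 2 ^ n); rewrite lerN2 exprn_ile1// => /(_ isT).
    by rewrite mulrN natrM natrX exprMn mulrA.
  + rewrite -[X in _ --> X]subr0; apply: cvgB; first exact: cvg_cst.
    by apply: cvg_natr_expr; lra.
  + exact: cvg_cst.
- apply: (@squeeze_cvgr _ _ _ _ (fun=> 0) (fun n => (n.+1%:R)^-1)).
  + near=> n; have /andP[-> _]/= := step_poly_itv n u01.
    have un0 : 0 <= u ^+ n by rewrite exprn_ge0.
    have un1 : u ^+ n <= 1 by rewrite exprn_ile1.
    have b : 1 + n%:R * (2 * u) ^+ n <= (1 + u ^+ n) ^+ (n * 2 ^ n).
      rewrite exprMn mulrA -natrX -natrM; apply: bernoulli_ineq.
      by rewrite (le_trans _ un0)// lerN10.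
    rewrite -[_^-1]mul1r ler_pdivlMr//.
    apply: (@le_trans _ _ (step_poly n u * (1 + u ^+ n) ^+ (n * 2 ^ n))).
      rewrite ler_wpM2l//; first by have /andP[] := step_poly_itv n u01.
      apply: le_trans b; rewrite -natr1 addrC lerD2l -[leLHS]mulr1 ler_wpM2l// exprn_ege1//.
      by lra.
    rewrite /step_poly -exprMn exprn_ile1//.
      by rewrite mulr_ge0 ?subr_ge0// addr_ge0.
    by rewrite -subr_sqr expr1n gerBl sqr_ge0.
  + exact: cvg_cst.
  + exact: cvg_harmonic.
Unshelve. all: by end_near. Qed.

End StepPolynomials.

Section Multipliers.
Context {d : measure_display} {Omega : measurableType d} {R : realType}.
Implicit Types (f g Z : Omega -> R) (B : set Omega).

Definition bounded_rv f := measurable_fun setT f /\ exists M, forall w, `|f w| <= M.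

Lemma bounded_rv_cst a : bounded_rv (fun=> a).
Proof. by split; [exact: measurable_cst|exists `|a|]. Qed.

Lemma bounded_rvD f g : bounded_rv f -> bounded_rv g -> bounded_rv (fun w => f w + g w).
Proof.
move=> [mf [M fM]] [mg [N gN]]; split; first exact: measurable_funD.
by exists (M + N) => w; rewrite (le_trans (ler_normD _ _))// lerD.
Qed.

Lemma bounded_rvM f g : bounded_rv f -> bounded_rv g -> bounded_rv (fun w => f w * g w).
Proof.
move=> [mf [M fM]] [mg [N gN]]; split; first exact: measurable_funM.
by exists (M * N) => w; rewrite normrM ler_pM.
Qed.

Lemma bounded_rv_indic B : measurable B -> bounded_rv (\1_B).
Proof.
move=> mB; split; first exact: measurable_indic.
by exists 1 => w; rewrite indicE; case: (_ \in _); rewrite ?normr1 ?normr0.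
Qed.

Lemma bounded_rv_lim (f_ : nat -> Omega -> R) f M : (forall n, bounded_rv (f_ n)) ->
  (forall n w, `|f_ n w| <= M) -> (forall w, f_ n w @[n --> \oo] --> f w) ->
  bounded_rv f.
Proof.
move=> bf fM ff; split.
  apply/measurable_EFinP; apply: (emeasurable_fun_cvg (fun n w => (f_ n w)%:E)).
    by move=> n; apply/measurable_EFinP; have [] := bf n.
  by move=> w _; apply: cvg_EFin; [exact: nearW|exact: ff].
exists M => w; have cn : `|f_ n w| @[n --> \oo] --> `|f w| by exact: cvg_norm.
rewrite -(cvg_lim _ cn)//; apply: limr_le; first by apply/cvg_ex; exists `|f w|.
exact: nearW.
Qed.

(* The multipliers of such a class form an algebra closed under bounded limits:
   if they contain cos (t X) and sin (t X), they contain the indicators of the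
   events generated by X. This takes the place of Fourier uniqueness. *)
Record null_class (N : set (Omega -> R)) : Prop := NullClass {
  null_class_bounded : forall Z, N Z -> bounded_rv Z;
  null_class_linear : forall a Z Z', N Z -> N Z' -> N (fun w => a * Z w + Z' w);
  null_class_lim : forall (Z_ : nat -> Omega -> R) Z M, (forall n, N (Z_ n)) ->
    (forall n w, `|Z_ n w| <= M) -> (forall w, Z_ n w @[n --> \oo] --> Z w) -> N Z }.

Definition multiplier (N : set (Omega -> R)) f :=
  bounded_rv f /\ forall Z, N Z -> N (fun w => Z w * f w).

Variables (N : set (Omega -> R)) (nullN : null_class N).

Lemma multiplier_cst a : multiplier N (fun=> a).
Proof.
split; first exact: bounded_rv_cst.
move=> Z NZ; have N0 := null_class_linear nullN (-1) NZ NZ.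
have := null_class_linear nullN a NZ N0; congr (N _); apply/funext => w; ring.
Qed.

Lemma multiplierM f g : multiplier N f -> multiplier N g ->
  multiplier N (fun w => f w * g w).
Proof.
move=> [bf Nf] [bg Ng]; split; first exact: bounded_rvM.
move=> Z NZ; have := Ng _ (Nf _ NZ); congr (N _); apply/funext => w; ring.
Qed.

Lemma multiplierD f g : multiplier N f -> multiplier N g ->
  multiplier N (fun w => f w + g w).
Proof.
move=> [bf Nf] [bg Ng]; split; first exact: bounded_rvD.
move=> Z NZ; have := null_class_linear nullN 1 (Nf _ NZ) (Ng _ NZ).
by congr (N _); apply/funext => w; ring.
Qed.

Lemma multiplierZ a f : multiplier N f -> multiplier N (fun w => a * f w).
Proof. by move=> mf; exact: multiplierM (multiplier_cst a) mf. Qed.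

Lemma multiplierX f n : multiplier N f -> multiplier N (fun w => f w ^+ n).
Proof.
move=> mf; elim: n => [|n IHn]; first exact: multiplier_cst.
have := multiplierM mf IHn; congr (multiplier N _); apply/funext => w.
by rewrite exprS.
Qed.

Lemma multiplier_lim (f_ : nat -> Omega -> R) f M : (forall n, multiplier N (f_ n)) ->
  (forall n w, `|f_ n w| <= M) -> (forall w, f_ n w @[n --> \oo] --> f w) ->
  multiplier N f.
Proof.
move=> mf fM ff; split.
  by apply: (@bounded_rv_lim f_ f M) => // n; have [] := mf n.
move=> Z NZ; have [_ [K ZK]] := null_class_bounded nullN NZ.
apply: (@null_class_lim _ nullN (fun n w => Z w * f_ n w) _ (K * M)).
- by move=> n; have [_] := mf n; exact.
- by move=> n w; rewrite normrM ler_pM.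
- by move=> w; apply: cvgM; [exact: cvg_cst|exact: ff].
Qed.

Definition multiplier_set B := measurable B /\ multiplier N \1_B.

Lemma multiplier_setC B : multiplier_set B -> multiplier_set (~` B).
Proof.
move=> [mB B1]; split; first exact: measurableC.
have := multiplierD (multiplier_cst 1) (multiplierZ (-1) B1).
congr (multiplier N _); apply/funext => w; rewrite !indicE in_setC.
by case: (w \in B) => /=; rewrite ?mulr1 ?mulr0 ?subrr ?addr0.
Qed.

Lemma multiplier_setI A B : multiplier_set A -> multiplier_set B ->
  multiplier_set (A `&` B).
Proof.
move=> [mA A1] [mB B1]; split; first exact: measurableI.
have := multiplierM A1 B1; congr (multiplier N _); apply/funext => w.
by rewrite !indicE in_setI; case: (w \in A); case: (w \in B); rewrite /= ?mulr1 ?mulr0.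
Qed.

Lemma multiplier_bigcap (B_ : nat -> set Omega) : (forall n, multiplier_set (B_ n)) ->
  multiplier_set (\bigcap_n B_ n).
Proof.
move=> mB; split; first by apply: bigcapT_measurable => n; have [] := mB n.
pose A_ n := \big[setI/setT]_(i < n) B_ i.
have mA n : multiplier_set (A_ n).
  apply: big_ind => //.
  - split => //; have := multiplier_cst 1; congr (multiplier N _).
    by apply/funext => w; rewrite indicE in_setT.
  - exact: multiplier_setI.
apply: (@multiplier_lim (fun n => \1_(A_ n)) _ 1).
- by move=> n; have [] := mA n.
- by move=> n w; rewrite indicE; case: (_ \in _); rewrite ?normr1 ?normr0.
- move=> w; have [Bw|] := pselect ((\bigcap_n B_ n) w).
    apply: cvg_near_cst; apply: nearW => n; rewrite !indicE !mem_set//.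
    by rewrite /A_ -bigcap_mkord => i _; exact: Bw.
  move=> /existsNP[k /not_implyP[_ Bk]].
  apply: cvg_near_cst; near=> n; rewrite !indicE !memNset//.
    by move=> Bw; apply: Bk; exact: Bw.
  rewrite /A_ -bigcap_mkord => Aw; apply: Bk; apply: Aw => /=.
  by near: n; exact: nbhs_infty_gt.
Unshelve. all: by end_near. Qed.

Lemma sigma_algebra_multiplier : sigma_algebra setT multiplier_set.
Proof.
split.
- rewrite -setCT; apply: multiplier_setC; split => //.
  have := multiplier_cst 1; congr (multiplier N _).
  by apply/funext => w; rewrite indicE in_setT.
- by move=> A mA; rewrite setTD; exact: multiplier_setC.
- move=> A mA; rewrite -[\bigcup_k _]setCK setC_bigcup; apply: multiplier_setC.
  by apply: multiplier_bigcap => n; exact: multiplier_setC.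
Qed.

Section TrigonometricMultipliers.
Variable X : Omega -> R.
Hypothesis mX : measurable_fun setT X.
Hypothesis cosX : forall t, multiplier N (fun w => cos (t * X w)).
Hypothesis sinX : forall t, multiplier N (fun w => sin (t * X w)).

(** [u] is a multiplier with values in [0, 1] by the subtraction formula, it is below 1/2 exactly
    where the sine is negative, and [step_poly n u] is a polynomial in [u]. *)
Lemma multiplier_preimage_sin_lt0 t b :
  multiplier N (fun w => ((sin (t * (X w - b)) < 0)%R%:R : R)).
Proof.
pose u w := 2^-1 * (1 + sin (t * (X w - b))).
have mu : multiplier N u.
  apply: multiplierZ; apply: multiplierD; first exact: multiplier_cst.
  have := multiplierD (multiplierZ (cos (t * b)) (sinX t))
    (multiplierZ (- sin (t * b)) (cosX t)).
  congr (multiplier N _); apply/funext => w; rewrite mulrBr sinB; ring.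
have u01 w : 0 <= u w <= 1.
  have := sin_geN1 (t * (X w - b)); have := sin_le1 (t * (X w - b)).
  by rewrite /u => ? ?; apply/andP; split; lra.
apply: (@multiplier_lim (fun n w => step_poly n (u w)) _ 1).
- move=> n; apply: multiplierX; apply: multiplierD; first exact: multiplier_cst.
  have := multiplierZ (-1) (multiplierX n mu); congr (multiplier N _).
  by apply/funext => w; ring.
- by move=> n w; have /andP[? ?] := step_poly_itv n (u01 w); rewrite ger0_norm.
- move=> w; have := cvg_step_poly (u01 w); rewrite (_ : (u w < _) = (sin (t * (X w - b)) < 0))//.
  by rewrite /u; apply/idP/idP; lra.
Qed.

(** For large [n] the argument (X - b) / (n + 1) lies between - pi and pi, where the sine has the
    sign of its argument. *)
Lemma multiplier_ray b : multiplier_set (X @^-1` `]-oo, b[).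
Proof.
split; first by rewrite -[Y in measurable Y]setTI; exact: mX.
apply: (@multiplier_lim
  (fun n w => ((sin (n.+1%:R^-1 * (X w - b)) < 0)%R%:R : R)) _ 1).
- by move=> n; exact: multiplier_preimage_sin_lt0.
- by move=> n w; case: (_ < _); rewrite ?normr1 ?normr0.
- move=> w; rewrite indicE; apply: cvg_near_cst.
  have [k hk] : exists k : nat, `|X w - b| < k%:R * pi.
    exists (Num.trunc (`|X w - b| / pi)).+1.
    by rewrite -ltr_pdivrMr ?pi_gt0//; apply: truncnS_gt.
  near=> n; have n0 : 0 < n.+1%:R :> R by [].
  have small : `|n.+1%:R^-1 * (X w - b)| < pi.
    rewrite normrM gtr0_norm ?invr_gt0// mulrC ltr_pdivrMr// mulrC.
    apply: (lt_le_trans hk); rewrite ler_pM2r ?pi_gt0// ler_nat.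
    by apply: leqW; near: n; exact: nbhs_infty_ge.
  congr ((nat_of_bool _)%:R); case: (ltrgtP (X w) b) => Xb.
  - rewrite mem_set/= ?in_itv//; apply/esym.
    have neg : 0 < - (n.+1%:R^-1 * (X w - b)).
      by rewrite -mulrN opprB mulr_gt0 ?invr_gt0 ?subr_gt0.
    rewrite -[X in sin X]opprK sinN oppr_lt0 sin_gt0_pi// neg/=.
    by rewrite ltrNl; move: small; rewrite ltr_norml => /andP[].
  - rewrite memNset/= ?in_itv/= ?(lt_gtF Xb)//; apply/negbTE; rewrite -leNgt ltW// sin_gt0_pi//.
    rewrite mulr_gt0 ?invr_gt0 ?subr_gt0//=.
    by move: small; rewrite ltr_norml => /andP[].
  - rewrite Xb subrr mulr0 sin0 ltxx memNset//= in_itv/= Xb ltxx//.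
Unshelve. all: by end_near. Qed.

Lemma multiplier_preimage (A : set R) : measurable A -> multiplier_set (X @^-1` A).
Proof.
suff : @measurable _ (measurableTypeR R) `<=` [set A : set R | multiplier_set (X @^-1` A)].
  exact.
rewrite RGenInftyO.measurableE; apply: smallest_sub.
  have [s0 sC sU] := sigma_algebra_multiplier; split => /=.
  - by rewrite preimage_set0.
  - by move=> B /sC; rewrite !setTD preimage_setC.
  - by move=> B_ mB; rewrite preimage_bigcup; exact: sU.
by move=> _ [x ->]; exact: multiplier_ray.
Qed.

End TrigonometricMultipliers.

Lemma multiplier_generated (I : Type) (X : I -> Omega -> R) (D : set I) :
  (forall i, D i -> measurable_fun setT (X i)) ->
  (forall i t, D i -> multiplier N (fun w => cos (t * X i w))) ->
  (forall i t, D i -> multiplier N (fun w => sin (t * X i w))) ->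
  <<s \bigcup_(i in D) preimage_set_system setT (X i) measurable >> `<=` multiplier_set.
Proof.
move=> mX cosX sinX; apply: smallest_sub; first exact: sigma_algebra_multiplier.
move=> _ [i Di [A mA <-]]; rewrite setTI; apply: multiplier_preimage => //.
- exact: mX.
- by move=> t; exact: cosX.
- by move=> t; exact: sinX.
Qed.

End Multipliers.

(** * Almost sure linearity and independence in isonormal processes *)

Section Isonormal.
Context {R : realType} {d : measure_display} {Omega : measurableType d}.
Context (P : probability Omega R) {H : hilbertType R}.
Variable W : H -> {RV P >-> R}.
Hypothesis isoW : isonormal W.

Lemma isonormal_integral0 h : (\int[P]_w (W h w)%:E = 0)%E.
Proof. by case: isoW => _ E0 _; have := E0 h; rewrite unlock. Qed.

Lemma isonormal_integralM h g : (\int[P]_w (W h w * W g w)%:E = (inner h g)%:E)%E.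
Proof. by case: isoW => _ _ E2; have := E2 h g; rewrite unlock. Qed.

Lemma isonormal_law h : exists2 s, s ^+ 2 = inner h h & centered_law (W h) s.
Proof.
apply: gaussian_centered.
- exact: isonormal_integral0.
- exact: isonormal_integralM.
- case: isoW => /(_ 1%N (fun=> h) (fun=> 1)) + _ _; congr (gaussian _ _).
  by apply/funext => w; rewrite big_ord1 mul1r.
Qed.

Lemma integrable_isonormal_sqr h : P.-integrable setT (fun w => (W h w * W h w)%:E).
Proof.
apply/integrableP; split; first by apply/measurable_EFinP; exact: measurable_funM.
under eq_integral do rewrite gee0_abs ?lee_fin -?expr2 ?sqr_ge0//.
by under eq_integral do rewrite expr2; rewrite isonormal_integralM ltry.
Qed.

Lemma integrable_isonormalM h g : P.-integrable setT (fun w => (W h w * W g w)%:E).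
Proof.
have := integrableD measurableT (integrable_isonormal_sqr h) (integrable_isonormal_sqr g).
apply: le_integrable => //; first by apply/measurable_EFinP; exact: measurable_funM.
move=> w _ /=; rewrite lee_fin [leRHS]ger0_norm; last first.
  by rewrite addr_ge0// -expr2 sqr_ge0.
set x := W h w; set y := W g w; rewrite ler_norml; apply/andP; split.
- have := sqr_ge0 (x + y); nra.
- have := sqr_ge0 (x - y); nra.
Qed.

(** [isonormal] does not state linearity of [W]. It holds almost surely, because the covariances
    make the second moment of the sum equal to the squared norm of the same combination of the
    [h i]. *)
Lemma isonormal_lincomb0 n (c : 'I_n -> R) (h : 'I_n -> H) :
  \sum_(i < n) c i *: h i = 0 -> {ae P, forall w, \sum_(i < n) c i * W (h i) w = 0}.
Proof.
move=> ch0; pose Y w := \sum_(i < n) c i * W (h i) w.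
have mY : measurable_fun setT Y.
  by apply: measurable_sum => i; exact: measurable_funM.
have YE w : Y w * Y w = \sum_(p : 'I_n * 'I_n) c p.1 * c p.2 * (W (h p.1) w * W (h p.2) w).
  rewrite /Y big_distrlr/= pair_bigA/=.
  by apply: eq_bigr => p _; ring.
have Y0 : (\int[P]_w (Y w * Y w)%:E = 0)%E.
  under eq_integral do rewrite YE -sumEFin.
  rewrite integral_sum//; last first.
    move=> p; under eq_fun do rewrite EFinM.
    exact: (integrableZl measurableT _ (integrable_isonormalM _ _)).
  transitivity (\sum_(p : 'I_n * 'I_n) (c p.1 * c p.2 * inner (h p.1) (h p.2))%:E)%E.
    apply: eq_bigr => p _; under eq_integral do rewrite EFinM.
    rewrite (integralZl measurableT (integrable_isonormalM _ _)).
    by rewrite isonormal_integralM -EFinM.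
  rewrite sumEFin; congr EFin.
  transitivity (inner (\sum_(i < n) c i *: h i) (\sum_(i < n) c i *: h i)); last first.
    by rewrite ch0 inner0l.
  rewrite inner_suml -(pair_bigA _ (fun i j => c i * c j * inner (h i) (h j)))/=.
  apply: eq_bigr => i _; rewrite innerZl inner_sumr mulr_sumr.
  by apply: eq_bigr => j _; rewrite innerZr mulrA.
have mYY : measurable_fun setT (fun w => (Y w * Y w)%:E).
  by apply/measurable_EFinP; exact: measurable_funM.
have := ae_eq_integral_abs P measurableT mYY.
under eq_integral do rewrite gee0_abs ?lee_fin -?expr2 ?sqr_ge0//.
under eq_integral do rewrite expr2.
move=> [/(_ Y0) + _]; apply: filterS => w /= /(_ Logic.I) /(congr1 fine) /=.
by move=> /eqP; rewrite mulf_eq0 orbb => /eqP.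
Qed.

Lemma isonormal_linear a b h k :
  {ae P, forall w, W (a *: h + b *: k) w = a * W h w + b * W k w}.
Proof.
have := @isonormal_lincomb0 3 (fun i => nth 0 [:: 1; - a; - b] i)
  (fun i => nth 0 [:: a *: h + b *: k; h; k] i).
rewrite !big_ord_recl !big_ord0/= !scaleNr scale1r !addr0 -opprD subrr => /(_ erefl).
by apply: filterS => w; rewrite !big_ord_recl !big_ord0/= => ?; lra.
Qed.

End Isonormal.

Section BoundedExpectation.
Context {R : realType} {d : measure_display} {Omega : measurableType d}.
Context (P : probability Omega R).
Implicit Types f g : Omega -> R.

Lemma bounded_rv_integrable f : bounded_rv f -> P.-integrable setT (EFin \o f).
Proof. by move=> [mf [M fM]]; exact: (integrable_bounded P mf fM). Qed.

Lemma Rintegral_lim (f_ : nat -> Omega -> R) f M : (forall n, bounded_rv (f_ n)) ->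
  (forall n w, `|f_ n w| <= M) -> (forall w, f_ n w @[n --> \oo] --> f w) ->
  \int[P]_w f_ n w @[n --> \oo] --> \int[P]_w f w.
Proof.
move=> bf fM ff; have bl := bounded_rv_lim bf fM ff.
have [] := @dominated_convergence _ _ _ P setT measurableT
  (fun n w => (f_ n w)%:E) (fun w => (f w)%:E) (fun=> M%:E).
- by move=> n; apply/measurable_EFinP; have [] := bf n.
- by apply/measurable_EFinP; have [] := bl.
- by apply: aeW => w _; apply: cvg_EFin; [exact: nearW|exact: ff].
- exact: finite_measure_integrable_cst.
- by apply: aeW => w n _ /=; rewrite lee_fin.
move=> i1 _ c; apply: fine_cvg; rewrite fineK//; exact: integrable_fin_num i1.
Qed.

Lemma eq_ae_Rintegral f g : measurable_fun setT f -> measurable_fun setT g ->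
  {ae P, forall w, f w = g w} -> \int[P]_w f w = \int[P]_w g w.
Proof.
move=> mf mg fg; rewrite /Rintegral; congr fine; apply: ae_eq_integral => //.
- exact/measurable_EFinP.
- exact/measurable_EFinP.
- by apply: filterS fg => w ->.
Qed.

Lemma Rintegral_indic (B : set Omega) : measurable B -> \int[P]_w \1_B w = fine (P B).
Proof. by move=> mB; rewrite /Rintegral integral_indic// setIT. Qed.

End BoundedExpectation.

Section Independence.
Context {R : realType} {d : measure_display} {Omega : measurableType d}.
Context (P : probability Omega R) {H : hilbertType R}.
Variable W : H -> {RV P >-> R}.
Hypothesis isoW : isonormal W.

(** The characteristic function at 1 in terms of the variance; at variance 0 the law is a point
    mass, which has no density. *)
Definition gaussian_cos (v : R) : R := if v == 0 then 1 else normal_cos (Num.sqrt v).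

Lemma gaussian_cosD v w : 0 <= v -> 0 <= w ->
  gaussian_cos (v + w) = gaussian_cos v * gaussian_cos w.
Proof.
move=> v0 w0; rewrite /gaussian_cos paddr_eq0//.
have [->|vn0] := eqVneq v 0; first by rewrite /= add0r mul1r.
have [->|wn0] /= := eqVneq w 0; first by rewrite addr0 mulr1.
have vp : 0 < v by rewrite lt_def vn0.
have wp : 0 < w by rewrite lt_def wn0.
rewrite -normal_cosM; last 2 first.
- by rewrite gt_eqF// sqrtr_gt0.
- by rewrite gt_eqF// sqrtr_gt0.
by rewrite !sqr_sqrtr.
Qed.

Lemma isonormal0 h : inner h h = 0 -> {ae P, forall w, W h w = 0}.
Proof.
move=> /eqP; rewrite inner_eq0 => /eqP ->.
have := @isonormal_lincomb0 _ _ _ _ _ _ isoW 1 (fun=> 1) (fun=> 0).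
rewrite big_ord1 scaler0 => /(_ erefl).
by apply: filterS => w; rewrite big_ord1 mul1r.
Qed.

Lemma measurable_cosW h : measurable_fun setT (fun w => cos (W h w)).
Proof. by apply: measurableT_comp => //; exact: measurable_cosr. Qed.

Lemma measurable_sinW h : measurable_fun setT (fun w => sin (W h w)).
Proof. by apply: measurableT_comp => //; exact: measurable_sinr. Qed.

Lemma isonormal_cos h : \int[P]_w cos (W h w) = gaussian_cos (inner h h).
Proof.
have [s sv law] := isonormal_law isoW h; rewrite -sv /gaussian_cos sqrf_eq0.
have [s0|s0] := eqVneq s 0.
  rewrite -(Rintegral_cst1 P 1); apply: eq_ae_Rintegral => //.
    exact: measurable_cosW.
  have := @isonormal0 h; rewrite -sv s0 expr0n => /(_ erefl).
  by apply: filterS => w ->; rewrite cos0.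
have law' A : measurable A -> pushforward P (W h) A = normal_prob 0 s A.
  by move=> mA; rewrite law// (negbTE s0).
apply: etrans (Rintegral_normal_law law' (@measurable_cosr R) (@cos_norm_le1 R)) _.
apply: eq_Rintegral => x _; congr (_ * _).
rewrite !normal_pdf_formula// ?sqr_sqrtr ?sqr_ge0//.
by rewrite sqrtr_eq0 -ltNge exprn_even_gt0.
Qed.

Lemma isonormal_sin h : \int[P]_w sin (W h w) = 0.
Proof.
have [s sv law] := isonormal_law isoW h.
have [s0|s0] := eqVneq s 0.
  rewrite -(Rintegral_cst1 P 0); apply: eq_ae_Rintegral => //.
    exact: measurable_sinW.
  have := @isonormal0 h; rewrite -sv s0 expr0n => /(_ erefl).
  by apply: filterS => w ->; rewrite sin0.
have law' A : measurable A -> pushforward P (W h) A = normal_prob 0 s A.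
  by move=> mA; rewrite law// (negbTE s0).
apply: etrans (Rintegral_normal_law law' (@measurable_sinr R) (@sin_norm_le1 R)) _.
exact: normal_sin.
Qed.

(* For V a subspace, addition formulas make cos (t W h) and sin (t W h), h in V,
   multipliers of this class. *)
Definition trig_null (V : set H) (Z : Omega -> R) := bounded_rv Z /\
  forall k, V k -> \int[P]_w (Z w * cos (W k w)) = 0 /\ \int[P]_w (Z w * sin (W k w)) = 0.

Lemma bounded_cosW h : bounded_rv (fun w => cos (W h w)).
Proof. by split; [exact: measurable_cosW|exists 1 => w; exact: cos_norm_le1]. Qed.

Lemma bounded_sinW h : bounded_rv (fun w => sin (W h w)).
Proof. by split; [exact: measurable_sinW|exists 1 => w; exact: sin_norm_le1]. Qed.

Lemma null_class_trig V : null_class (trig_null V).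
Proof.
split=> [Z []//|a Z Z' [bZ Z0] [bZ' Z0']|Z_ Z M Zn ZM ZZ].
- split; first by apply: bounded_rvD => //; exact: bounded_rvM (bounded_rv_cst a) bZ.
  have Hf f : bounded_rv f -> \int[P]_w ((a * Z w + Z' w) * f w) =
      a * \int[P]_w (Z w * f w) + \int[P]_w (Z' w * f w).
    move=> bf; under eq_Rintegral do rewrite mulrDl -mulrA.
    have bZf := bounded_rvM bZ bf.
    rewrite RintegralD//; last 2 first.
    - exact: bounded_rv_integrable (bounded_rvM (bounded_rv_cst a) bZf).
    - exact: bounded_rv_integrable (bounded_rvM bZ' bf).
    by rewrite RintegralZl//; exact: bounded_rv_integrable bZf.
  move=> k Vk; have [zc zs] := Z0 _ Vk; have [zc' zs'] := Z0' _ Vk.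
  rewrite Hf; last exact: bounded_cosW.
  rewrite Hf; last exact: bounded_sinW.
  by rewrite zc zs zc' zs' !mulr0 !addr0.
- split; first by apply: (bounded_rv_lim (f_ := Z_)) ZM ZZ => n; have [] := Zn n.
  have Hf f : bounded_rv f -> (forall w, `|f w| <= 1) ->
     (forall n, \int[P]_w (Z_ n w * f w) = 0) -> \int[P]_w (Z w * f w) = 0.
    move=> bf f1 Zf.
    have : \int[P]_w (Z_ n w * f w) @[n --> \oo] --> \int[P]_w (Z w * f w).
      apply: (@Rintegral_lim _ _ _ P (fun n w => Z_ n w * f w) _ (M * 1)).
      - by move=> n; apply: bounded_rvM => //; have [] := Zn n.
      - by move=> n w; rewrite normrM ler_pM.
      - by move=> w; apply: cvgM; [exact: ZZ|exact: cvg_cst].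
    under eq_fun do rewrite Zf.
    by move=> c; rewrite -(cvg_lim _ c)//; apply: lim_cst.
  move=> k Vk; split; apply: Hf.
  - exact: bounded_cosW.
  - by move=> w; exact: cos_norm_le1.
  - by move=> n; have [_ /(_ _ Vk)[]] := Zn n.
  - exact: bounded_sinW.
  - by move=> w; exact: sin_norm_le1.
  - by move=> n; have [_ /(_ _ Vk)[]] := Zn n.
Qed.

(** The product-to-sum formulas. [W p] and [W q] agree with the combinations of values only almost
    surely, so the formulas are stated under the integral. *)
Lemma trig_product_sum Z h k t : bounded_rv Z ->
  let p := t *: h + 1 *: k in let q := t *: h + (-1) *: k in
  [/\ \int[P]_w (Z w * cos (t * W h w) * cos (W k w)) =
      2^-1 * \int[P]_w (Z w * cos (W p w)) + 2^-1 * \int[P]_w (Z w * cos (W q w)),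
      \int[P]_w (Z w * cos (t * W h w) * sin (W k w)) =
      2^-1 * \int[P]_w (Z w * sin (W p w)) + - 2^-1 * \int[P]_w (Z w * sin (W q w)),
      \int[P]_w (Z w * sin (t * W h w) * cos (W k w)) =
      2^-1 * \int[P]_w (Z w * sin (W p w)) + 2^-1 * \int[P]_w (Z w * sin (W q w)) &
      \int[P]_w (Z w * sin (t * W h w) * sin (W k w)) =
      - 2^-1 * \int[P]_w (Z w * cos (W p w)) + 2^-1 * \int[P]_w (Z w * cos (W q w))].
Proof.
move=> bZ p q.
have lp := isonormal_linear isoW t 1 h k; have lq := isonormal_linear isoW t (-1) h k.
have mZ : measurable_fun setT Z by have [] := bZ.
have mth : measurable_fun setT (fun w => t * W h w) by exact: measurable_funM.
have mct : measurable_fun setT (fun w => cos (t * W h w)).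
  by apply: measurableT_comp => //; exact: measurable_cosr.
have mst : measurable_fun setT (fun w => sin (t * W h w)).
  by apply: measurableT_comp => //; exact: measurable_sinr.
have key (f1 f2 : R -> R) (g : Omega -> R) a b : measurable_fun setT g ->
    bounded_rv (fun w => Z w * f1 (W p w)) -> bounded_rv (fun w => Z w * f2 (W q w)) ->
    (forall x y w, x = t * W h w + 1 * W k w -> y = t * W h w + -1 * W k w ->
      g w = a * (Z w * f1 x) + b * (Z w * f2 y)) ->
    \int[P]_w g w = a * \int[P]_w (Z w * f1 (W p w)) + b * \int[P]_w (Z w * f2 (W q w)).
  move=> mg b1 b2 gE.
  have b1' := bounded_rvM (bounded_rv_cst a) b1.
  have b2' := bounded_rvM (bounded_rv_cst b) b2.
  transitivity (\int[P]_w (a * (Z w * f1 (W p w)) + b * (Z w * f2 (W q w)))).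
    apply: eq_ae_Rintegral => //.
      by apply: measurable_funD; [have [] := b1'|have [] := b2'].
    by apply: filterS2 lp lq => w; exact: gE.
  rewrite RintegralD//; [|exact: bounded_rv_integrable b1'|exact: bounded_rv_integrable b2'].
  by rewrite !RintegralZl//; [exact: bounded_rv_integrable b2|exact: bounded_rv_integrable b1].
have bc r := bounded_rvM bZ (bounded_cosW r); have bs r := bounded_rvM bZ (bounded_sinW r).
have mck := measurable_cosW k; have msk := measurable_sinW k.
split.
- apply: (key cos cos) => //.
    by apply: measurable_funM => //; exact: measurable_funM.
  by move=> x y w -> ->; rewrite mul1r mulN1r cosD cosB; field.
- apply: (key sin sin) => //.
    by apply: measurable_funM => //; exact: measurable_funM.
  by move=> x y w -> ->; rewrite mul1r mulN1r sinD sinB; field.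
- apply: (key sin sin) => //.
    by apply: measurable_funM => //; exact: measurable_funM.
  by move=> x y w -> ->; rewrite mul1r mulN1r sinD sinB; field.
- apply: (key cos cos) => //.
    by apply: measurable_funM => //; exact: measurable_funM.
  by move=> x y w -> ->; rewrite mul1r mulN1r cosD cosB; field.
Qed.

Section Subspace.
Variable V : set H.
Hypothesis V_lin : forall a b h k, V h -> V k -> V (a *: h + b *: k).

Let trig_product Z h k t : trig_null V Z -> V h -> V k ->
  [/\ \int[P]_w (Z w * cos (t * W h w) * cos (W k w)) = 0,
      \int[P]_w (Z w * cos (t * W h w) * sin (W k w)) = 0,
      \int[P]_w (Z w * sin (t * W h w) * cos (W k w)) = 0 &
      \int[P]_w (Z w * sin (t * W h w) * sin (W k w)) = 0].
Proof.
move=> [bZ Z0] Vh Vk; have [E1 E2 E3 E4] := trig_product_sum h k t bZ.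
have [pc ps] := Z0 _ (V_lin t 1 Vh Vk); have [qc qs] := Z0 _ (V_lin t (-1) Vh Vk).
by rewrite E1 E2 E3 E4 pc ps qc qs !mulr0 !addr0.
Qed.

Lemma multiplier_cosW h t : V h -> multiplier (trig_null V) (fun w => cos (t * W h w)).
Proof.
move=> Vh; have bc : bounded_rv (fun w => cos (t * W h w)).
  split; last by exists 1 => w; exact: cos_norm_le1.
  by apply: measurableT_comp; [exact: measurable_cosr|exact: measurable_funM].
split => // Z NZ; split; first by apply: bounded_rvM => //; have [] := NZ.
by move=> k Vk; have [] := trig_product t NZ Vh Vk.
Qed.

Lemma multiplier_sinW h t : V h -> multiplier (trig_null V) (fun w => sin (t * W h w)).
Proof.
move=> Vh; have bc : bounded_rv (fun w => sin (t * W h w)).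
  split; last by exists 1 => w; exact: sin_norm_le1.
  by apply: measurableT_comp; [exact: measurable_sinr|exact: measurable_funM].
split => // Z NZ; split; first by apply: bounded_rvM => //; have [] := NZ.
by move=> k Vk; have [] := trig_product t NZ Vh Vk.
Qed.

(** The indicator of [B] is a multiplier, so its product with [Z] is still orthogonal to cos (W 0),
    which is 1 almost surely. *)
Lemma trig_null_generated Z B : V 0 -> trig_null V Z ->
  (<<s \bigcup_(h in V) preimage_set_system setT (W h) measurable >>) B ->
  \int[P]_w (Z w * \1_B w) = 0.
Proof.
move=> V0 NZ sB.
have [|h t Vh|h t Vh|mB [bB /(_ _ NZ)[bZB /(_ _ V0)[+ _]]]] :=
    multiplier_generated (null_class_trig V) (X := fun h => W h) _ _ _ sB.
- by move=> h _; exact: measurable_funP.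
- exact: multiplier_cosW.
- exact: multiplier_sinW.
move=> <-; apply: eq_ae_Rintegral.
- by have [] := bZB.
- by have [] := bounded_rvM bZB (bounded_cosW 0).
by have := isonormal0 (inner0l 0); apply: filterS => w ->; rewrite cos0 mulr1.
Qed.

End Subspace.

Definition orthogonal_to (e : H) : set H := [set h | inner h e = 0].

(** For trigonometric functions independence is [gaussian_cosD]. It is extended to indicators one
    side at a time, first on the line through [e] and then on its orthogonal complement, each time
    by [trig_null_generated]. *)
Lemma isonormal_independent (e : H) (B : set Omega) (C : set R) :
  (<<s \bigcup_(h in orthogonal_to e) preimage_set_system setT (W h) measurable >>) B ->
  measurable C -> P (B `&` W e @^-1` C) = (P B * P (W e @^-1` C))%E.
Proof.
move=> sB mC; pose V1 : set H := [set h | exists t, h = t *: e].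
have V1_lin a b h k : V1 h -> V1 k -> V1 (a *: h + b *: k).
  by move=> [x ->] [y ->]; exists (a * x + b * y); rewrite !scalerA -scalerDl.
have V1_0 : V1 0 by exists 0; rewrite scale0r.
pose V2 := orthogonal_to e.
have V2_lin a b h k : V2 h -> V2 k -> V2 (a *: h + b *: k).
  by rewrite /V2 /orthogonal_to/= => hV kV; rewrite innerDl !innerZl hV kV !mulr0 addr0.
have V2_0 : V2 0 by rewrite /V2 /orthogonal_to/= inner0l.
have mWC : measurable (W e @^-1` C) by rewrite -[X in measurable X]setTI; exact: measurable_funP.
have sC : (<<s \bigcup_(h in V1) preimage_set_system setT (W h) measurable >>) (W e @^-1` C).
  apply: sub_gen_smallest; exists e; first by exists 1; rewrite scale1r.
  by exists C => //; rewrite setTI.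
have trigM k l : V2 k -> V1 l ->
   [/\ \int[P]_w (cos (W l w) * cos (W k w)) = gaussian_cos (inner l l) * gaussian_cos (inner k k),
       \int[P]_w (cos (W l w) * sin (W k w)) = 0,
       \int[P]_w (sin (W l w) * cos (W k w)) = 0 &
       \int[P]_w (sin (W l w) * sin (W k w)) = 0].
  move=> Vk [t lE]; have lk : inner l k = 0.
    by rewrite lE innerZl innerC Vk mulr0.
  have pq (a : R) : a ^+ 2 = 1 ->
      inner (1 *: l + a *: k) (1 *: l + a *: k) = inner l l + inner k k.
    move=> a1; rewrite innerDl !innerDr !innerZl !innerZr lk (innerC k) lk.
    by rewrite !mul1r !mulr0 addr0 add0r mulrA -expr2 a1 mul1r.
  have pq1 : inner (1 *: l + 1 *: k) (1 *: l + 1 *: k) = inner l l + inner k k.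
    by rewrite pq// expr1n.
  have pq2 : inner (1 *: l + -1 *: k) (1 *: l + -1 *: k) = inner l l + inner k k.
    by rewrite pq// sqrrN expr1n.
  have [E1 E2 E3 E4] := trig_product_sum l k 1 (bounded_rv_cst 1).
  have c1 (f : Omega -> R) : \int[P]_w (1 * f w) = \int[P]_w f w.
    by apply: eq_Rintegral => w _; rewrite mul1r.
  have c2 (f g : R -> R) : \int[P]_w (f (W l w) * g (W k w)) =
      \int[P]_w (1 * f (1 * W l w) * g (W k w)).
    by apply: eq_Rintegral => w _; rewrite !mul1r.
  rewrite (c2 cos cos) (c2 cos sin) (c2 sin cos) (c2 sin sin) E1 E2 E3 E4.
  rewrite !c1 !isonormal_cos !isonormal_sin pq1 pq2 gaussian_cosD ?inner_ge0//.
  move: (_ * gaussian_cos _) => x; rewrite !mulr0 !addr0 mulNr addNr -mulrDl.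
  by rewrite (_ : 2^-1 + 2^-1 = 1) ?mul1r//; field.
have bI : bounded_rv (\1_(W e @^-1` C) : Omega -> R) := bounded_rv_indic mWC.
pose C1 := fine (P (W e @^-1` C)).
(* The centered trigonometric functions of [W k] are orthogonal to those of the line, hence to the
   indicator of the event that [W e] lies in [C]. *)
have NZ1 k : V2 k -> trig_null V1 (fun w => cos (W k w) - gaussian_cos (inner k k)) /\
    trig_null V1 (fun w => sin (W k w)).
  move=> Vk; have bc := bounded_cosW k; have bs := bounded_sinW k.
  have Zf g f : bounded_rv f -> \int[P]_w ((cos (W k w) - g) * f w) =
      \int[P]_w (f w * cos (W k w)) - g * \int[P]_w f w.
    move=> bf; rewrite -RintegralZl//; last exact: bounded_rv_integrable.
    rewrite -RintegralB//; last 2 first.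
    - exact: bounded_rv_integrable (bounded_rvM bf bc).
    - exact: bounded_rv_integrable (bounded_rvM (bounded_rv_cst g) bf).
    by apply: eq_Rintegral => w _; ring.
  split.
    split; first exact: bounded_rvD bc (bounded_rv_cst _).
    move=> l V1l; have [E1 E2 E3 E4] := trigM _ _ Vk V1l.
    rewrite (Zf _ _ (bounded_cosW l)) (Zf _ _ (bounded_sinW l)) E1 E3.
    rewrite isonormal_cos isonormal_sin; split; last by rewrite mulr0 subrr.
    by rewrite [X in X - _]mulrC subrr.
  split => // l V1l; have [E1 E2 E3 E4] := trigM _ _ Vk V1l.
  by rewrite -[in X in X /\ _]E2 -[in X in _ /\ X]E4; split; apply: eq_Rintegral => w _; rewrite mulrC.
(* Read from the other side: the centered indicator is orthogonal to all trigonometric functions of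
   the complement, and can be paired with [B]. *)
have NZ2 : trig_null V2 (fun w => \1_(W e @^-1` C) w - C1).
  have bZ := bounded_rvD bI (bounded_rv_cst (- C1)); split => // k Vk.
  have [N1 N2] := NZ1 k Vk.
  have bc := bounded_cosW k; have bs := bounded_sinW k.
  have E1 := trig_null_generated V1_lin V1_0 N1 sC.
  have E2 := trig_null_generated V1_lin V1_0 N2 sC.
  have EC f : bounded_rv f -> \int[P]_w ((\1_(W e @^-1` C) w - C1) * f w) =
      \int[P]_w (f w * \1_(W e @^-1` C) w) - C1 * \int[P]_w f w.
    move=> bf; rewrite -RintegralZl//; last exact: bounded_rv_integrable.
    rewrite -RintegralB//; last 2 first.
    - exact: bounded_rv_integrable (bounded_rvM bf bI).
    - exact: bounded_rv_integrable (bounded_rvM (bounded_rv_cst C1) bf).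
    by apply: eq_Rintegral => w _; ring.
  rewrite !EC// isonormal_cos isonormal_sin E2 mulr0 subrr; split => //.
  apply: etrans E1; rewrite [C1 * _]mulrC /C1 -(Rintegral_indic _ mWC).
  rewrite -RintegralZl//; last exact: bounded_rv_integrable.
  rewrite -RintegralB//; last 2 first.
  - exact: bounded_rv_integrable (bounded_rvM bc bI).
  - exact: bounded_rv_integrable (bounded_rvM (bounded_rv_cst _) bI).
  by apply: eq_Rintegral => w _; ring.
have mB : measurable B.
  suff : <<s \bigcup_(h in V2) preimage_set_system setT (W h) measurable >> `<=`
      @measurable _ Omega by exact.
  apply: smallest_sub; first exact: sigma_algebra_measurable.
  by move=> _ [h _ [A mA <-]]; exact: measurable_funP.
have bB : bounded_rv (\1_B : Omega -> R) := bounded_rv_indic mB.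
have := trig_null_generated V2_lin V2_0 NZ2 sB.
have -> : \int[P]_w ((\1_(W e @^-1` C) w - C1) * \1_B w) =
    fine (P (B `&` W e @^-1` C)) - C1 * fine (P B).
  rewrite -!Rintegral_indic//; last exact: measurableI.
  rewrite -RintegralZl//; last exact: bounded_rv_integrable.
  rewrite -RintegralB//; last 2 first.
  - exact: bounded_rv_integrable (bounded_rv_indic (measurableI _ _ mB mWC)).
  - exact: bounded_rv_integrable (bounded_rvM (bounded_rv_cst _) bB).
  apply: eq_Rintegral => w _; rewrite mulrBl; congr (_ - _).
  by rewrite !indicE in_setI; case: (w \in B); case: (w \in _ @^-1` _); rewrite /= ?mulr1 ?mulr0.
move=> /eqP; rewrite subr_eq0 => /eqP E.
rewrite -[LHS]fineK ?fin_num_measure//; last exact: measurableI.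
by rewrite E EFinM muleC !fineK ?fin_num_measure.
Qed.

End Independence.

(** * Hermite expansions and their limits *)

Section Interpolation.
Context {R : realType}.

(** The weights are the coefficients of the Lagrange basis. They depend on the nodes only, so
    convergence of values at the nodes becomes convergence of coefficients. *)
Lemma interpolation_weights (x : seq R) : uniq x -> exists w : nat -> R -> R,
  forall p : {poly R}, (size p <= size x)%N ->
  forall j, p`_j = \sum_(a <- x) w j a * p.[a].
Proof.
move=> ux; pose L (a : R) : {poly R} := \prod_(b <- rem a x) ((a - b)^-1 *: ('X - b%:P)).
have La a : a \in x -> (L a).[a] = 1.
  move=> ax; rewrite horner_prod big_seq big1// => b.
  rewrite mem_rem_uniq// !inE => /andP[ba _].
  by rewrite !hornerE mulVf// subr_eq0 eq_sym.
have Lb a b : a \in x -> b \in x -> b != a -> (L a).[b] = 0.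
  move=> ax bx ba; rewrite horner_prod (big_rem b)/=; last by rewrite mem_rem_uniq// !inE ba.
  by rewrite !hornerE subrr mulr0 mul0r.
have sL a : a \in x -> (size (L a) <= size x)%N.
  move=> ax; rewrite /L; have -> : size x = (size (rem a x)).+1.
    by rewrite size_rem// prednK//; case: (x) ax.
  elim: (rem a x) => [|b r IHr]; first by rewrite big_nil size_poly1.
  rewrite big_cons; apply: leq_trans (size_polyMleq _ _) _.
  have : (size ((a - b)^-1 *: ('X - b%:P)) <= 2)%N.
    by apply: leq_trans (size_scale_leq _ _) _; rewrite size_XsubC.
  move=> s2; apply: (@leq_trans (2 + (size r).+1).-1) => //.
  by rewrite -!subn1 leq_sub2r// leq_add.
exists (fun j a => (L a)`_j) => p sp j.
suff {1}-> : p = \sum_(a <- x) p.[a] *: L a.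
  by rewrite coef_sum; apply: eq_bigr => a _; rewrite coefZ mulrC.
apply/eqP; rewrite -subr_eq0; apply/eqP.
apply: (@roots_geq_poly_eq0 _ _ x) => //.
  apply/allP => b bx; apply/rootP; rewrite !hornerE horner_sum.
  rewrite (big_rem b)//= hornerZ La// mulr1 big_seq big1 ?addr0 ?subrr// => a.
  rewrite mem_rem_uniq// !inE => /andP[ab ax].
  by rewrite hornerZ Lb ?mulr0// eq_sym.
apply: leq_trans (size_polyD _ _) _; rewrite geq_max sp size_polyN.
apply: leq_trans (size_sum _ _ _) _; rewrite big_seq.
elim/big_ind: _ => //; first by move=> m n mx nx; rewrite geq_max mx.
by move=> a ax; apply: leq_trans (size_scale_leq _ _) _; exact: sL.
Qed.

Definition bisize (n : nat) (P : {poly {poly R}}) :=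
  (size P <= n)%N /\ forall i, (size (P`_i)%R <= n)%N.

Lemma bisize_lin n (c : R) P Q : bisize n P -> bisize n Q -> bisize n (c%:P%:P * P + Q).
Proof.
move=> [sP cP] [sQ cQ]; split.
  apply: leq_trans (size_polyD _ _) _; rewrite geq_max sQ andbT mul_polyC.
  by apply: leq_trans (size_scale_leq _ _) _.
move=> i; rewrite coefD coefCM; apply: leq_trans (size_polyD _ _) _.
rewrite geq_max cQ andbT mul_polyC.
exact: leq_trans (size_scale_leq _ _) _.
Qed.

Lemma bieval_bisize n P t s : bisize n P ->
  bieval P (t, s) = \sum_(i < n) \sum_(j < n) P`_i`_j * s ^+ j * t ^+ i.
Proof.
move=> [sP cP]; rewrite /bieval/= (horner_coef_wide _ sP) horner_sum.
apply: eq_bigr => i _; rewrite hornerM -polyC_exp hornerC.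
by rewrite (horner_coef_wide _ (cP _)) mulr_suml.
Qed.

Lemma bieval_limit n (P_ : nat -> {poly {poly R}}) (ts ss : seq R) :
    uniq ts -> size ts = n -> uniq ss -> size ss = n ->
    (forall k, bisize n (P_ k)) ->
    (forall t s, t \in ts -> s \in ss -> cvgn (fun k => bieval (P_ k) (t, s))) ->
  exists P, [/\ bisize n P,
    forall i j, (P_ k)`_i`_j @[k --> \oo] --> P`_i`_j &
    forall t s, bieval (P_ k) (t, s) @[k --> \oo] --> bieval P (t, s)].
Proof.
move=> uts tn uss sn bP cP.
have [wt wtE] := interpolation_weights uts.
have [ws wsE] := interpolation_weights uss.
have cE k i j : (P_ k)`_i`_j =
    \sum_(s <- ss) \sum_(t <- ts) ws j s * (wt i t * bieval (P_ k) (t, s)).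
  have [sP cPk] := bP k; rewrite (wsE (P_ k)`_i) ?sn//.
  apply: eq_bigr => s _; rewrite -mulr_sumr; congr (_ * _).
  have sz : (size (map_poly (horner_eval s) (P_ k)) <= size ts)%N.
    by rewrite tn; apply: leq_trans (size_poly _ _) sP.
  have := wtE _ sz i; rewrite coef_map/= /horner_eval => ->.
  by apply: eq_bigr => t _; rewrite bieval_map.
have cc i j : cvgn (fun k => (P_ k)`_i`_j).
  under eq_fun do rewrite cE.
  apply/cvg_ex; exists (\sum_(s <- ss) \sum_(t <- ts)
    ws j s * (wt i t * limn (fun k => bieval (P_ k) (t, s)))).
  apply: cvg_bigsum => s sss; apply: cvg_bigsum => t tts.
  by do 2 (apply: cvgM; first exact: cvg_cst); exact: cP.
pose P : {poly {poly R}} := \poly_(i < n) \poly_(j < n) limn (fun k => (P_ k)`_i`_j).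
have sizeP : bisize n P.
  split; first exact: size_poly.
  by move=> i; rewrite coef_poly; case: ifP => _; rewrite ?size_poly ?size_poly0.
have PE i j : (P_ k)`_i`_j @[k --> \oo] --> P`_i`_j.
  rewrite coef_poly; case: (ltnP i n) => ni; last first.
    rewrite coef0; apply: cvg_near_cst; apply: nearW => k.
    have [sP _] := bP k.
    by rewrite [(P_ k)`_i]nth_default ?coef0//; exact: leq_trans sP ni.
  rewrite coef_poly; case: (ltnP j n) => nj; first exact: cc.
  apply: cvg_near_cst; apply: nearW => k; have [_ cPk] := bP k.
  by rewrite nth_default//; exact: leq_trans (cPk i) nj.
exists P; split => // t s; rewrite (bieval_bisize _ _ sizeP).
under eq_fun do rewrite (bieval_bisize _ _ (bP _)).
apply: cvg_bigsum => i _; apply: cvg_bigsum => j _.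
by do 2 (apply: cvgM; last exact: cvg_cst); exact: PE.
Qed.

End Interpolation.

Lemma hermite_monic (R : realType) n : size (hermite R n) = n.+1 /\ hermite R n \is monic.
Proof.
elim: n => [|n [sn mn]] /=; first by rewrite size_poly1 monic1.
set q : {poly R} := 'X * _; set r : {poly R} := - _.
have sq : size q = n.+2 by rewrite /q mulrC size_mulX ?sn// monic_neq0.
have sr : (size r < size q)%N.
  by rewrite size_polyN sq ltnS; apply: leq_trans (size_poly _ _) _; rewrite sn.
split; first by rewrite size_polyDl.
by rewrite monicE lead_coefDl// lead_coefM lead_coefX mul1r -monicE.
Qed.

Section AffineComposition.
Context {R : realType}.
Variables (m : nat) (p A : {poly R}) (c : R).
Hypotheses (sp : (size p <= m.+1)%N) (sA : (size A <= 2)%N).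

(** The polynomial p(A(s) t + c), expanded by the binomial theorem so that its coefficient of degree
    [m] in t can be read off: there [c] disappears. For j < i the binomial coefficient cancels the
    truncated [j - i]. *)
Definition affine_comp : {poly {poly R}} :=
  \poly_(i < m.+1) \sum_(j < m.+1) p`_j *: (A ^+ i * (c ^+ (j - i))%:P *+ 'C(j, i)).

Lemma size_expr_le (B : {poly R}) i : (size B <= 2)%N -> (size (B ^+ i) <= i.+1)%N.
Proof.
move=> sB; apply: leq_trans (size_poly_exp_leq _ _) _; rewrite ltnS.
by rewrite -[leqRHS]mul1n leq_mul2r; case: (size B) sB => [|[|[|]]]//=; rewrite orbT.
Qed.

Lemma bisize_affine_comp : bisize m.+1 affine_comp.
Proof.
split; first exact: size_poly.
move=> i; rewrite coef_poly; case: ifP => im; last by rewrite size_poly0.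
apply: leq_trans (size_sum _ _ _) _; apply/bigmax_leqP => j _.
apply: leq_trans (size_scale_leq _ _) _; rewrite -mulr_natr -mulrA.
rewrite -polyC_natr -polyCM mulrC mul_polyC; apply: leq_trans (size_scale_leq _ _) _.
exact: leq_trans (size_expr_le _ sA) im.
Qed.

Lemma affine_comp_top : affine_comp`_m = p`_m *: A ^+ m.
Proof.
rewrite coef_poly leqnn big_ord_recr/= subnn expr0 binn mulr1n mulr1 big1 ?add0r//.
by move=> j _; rewrite bin_small// mulr0n scaler0.
Qed.

Lemma bieval_affine_comp t s : bieval affine_comp (t, s) = p.[A.[s] * t + c].
Proof.
rewrite (bieval_bisize _ _ bisize_affine_comp) (horner_coef_wide _ sp).
transitivity (\sum_(i < m.+1) (affine_comp`_i).[s] * t ^+ i).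
  apply: eq_bigr => i _; have [_ ca] := bisize_affine_comp.
  by rewrite (horner_coef_wide _ (ca i)) mulr_suml.
transitivity (\sum_(i < m.+1) \sum_(j < m.+1)
    p`_j * (A.[s] ^+ i * c ^+ (j - i) *+ 'C(j, i)) * t ^+ i).
  apply: eq_bigr => i _; rewrite coef_poly ltn_ord horner_sum mulr_suml.
  by apply: eq_bigr => j _; rewrite hornerZ hornerMn hornerM hornerC horner_exp.
rewrite exchange_big/=; apply: eq_bigr => j _.
have -> : (A.[s] * t + c) ^+ j =
    \sum_(i < m.+1) A.[s] ^+ i * t ^+ i * c ^+ (j - i) *+ 'C(j, i).
  rewrite addrC exprDn.
  rewrite (big_ord_widen _ (fun i => c ^+ (j - i) * (A.[s] * t) ^+ i *+ 'C(j, i)) (ltn_ord j)).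
  rewrite big_mkcond; apply: eq_bigr => i _; case: ltnP => ij; first by rewrite mulrC exprMn.
  by rewrite bin_small.
rewrite mulr_sumr; apply: eq_bigr => i _.
by rewrite -!mulrA -!mulrnAl -!mulrA; congr (_ * _); rewrite !mulrnAl [t ^+ i * _]mulrC.
Qed.

End AffineComposition.

(** * Conditioning as a product law *)

Section AlmostEverywhereProduct.
Context d1 d2 (T1 : measurableType d1) (T2 : measurableType d2) (R : realType).
Variable m1 : {sigma_finite_measure set T1 -> \bar R}.
Variable m2 : {sigma_finite_measure set T2 -> \bar R}.
Local Open Scope ereal_scope.

Lemma product_null_ae (S : set (T1 * T2)) : measurable S ->
  (m1 \x m2) S = 0 <-> {ae m1, forall x, {ae m2, forall y, ~ S (x, y)}}.
Proof.
move=> mS; rewrite (product_null_xsection m1 m2 mS).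
have E x : m2 (xsection S x) = 0 <-> {ae m2, forall y, ~ S (x, y)}.
  rewrite -negligibleP; last exact: measurable_xsection.
  split; apply: negligibleS => y /=.
    by move=> /contrapT Sxy; rewrite /xsection/= inE.
  by rewrite /xsection/= inE => Sxy; apply.
by split; apply: filterS => x; rewrite E.
Qed.

End AlmostEverywhereProduct.

Section JointLaw.
Context {R : realType} {d : measure_display} {Omega : measurableType d}.
Context (P : probability Omega R) {H : hilbertType R}.
Variable W : H -> {RV P >-> R}.
Hypothesis isoW : isonormal W.
Variables e1 e2 : H.
Hypotheses (e12 : inner e1 e2 = 0).

Definition generators (V : set H) : set (set Omega) :=
  \bigcup_(h in V) preimage_set_system setT (W h) measurable.

Definition orthogonal_to2 : set H := orthogonal_to e1 `&` orthogonal_to e2.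

(** [Omega] with the sigma-algebra of the [W h] for [h] orthogonal to [e1] and [e2]. The identity
    map into it stands for this whole family, without a choice of coordinates. *)
Local Notation OG := (g_sigma_algebraType (generators orthogonal_to2)).

Lemma sub_generators (V V' : set H) : V `<=` V' ->
  <<s generators V >> `<=` <<s generators V' >>.
Proof.
move=> VV'; apply: sub_smallest2r; first exact: smallest_sigma_algebra.
by move=> A [h Vh Ah]; exists h => //; exact: VV'.
Qed.

Lemma generators_measurable V : <<s generators V >> `<=` @measurable _ Omega.
Proof.
apply: smallest_sub; first exact: sigma_algebra_measurable.
by move=> _ [h _ [A mA <-]]; exact: measurable_funP.
Qed.

Let measurable_idG : measurable_fun setT (fun w : Omega => w : OG).
Proof.
by move=> _ A mA; rewrite setTI; apply: (@generators_measurable orthogonal_to2).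
Qed.

Let idG : {mfun Omega >-> OG} := HB.pack (fun w : Omega => w : OG)
  (isMeasurableFun.Build _ _ Omega OG (fun w : Omega => w : OG) measurable_idG).

Let measurable_joint1 : measurable_fun setT (fun w : Omega => (w : OG, W e1 w)).
Proof. exact: measurable_fun_pair. Qed.

Let joint1 : {mfun Omega >-> (OG * R)%type} :=
  HB.pack (fun w : Omega => (w : OG, W e1 w))
  (isMeasurableFun.Build _ _ Omega (OG * R)%type _ measurable_joint1).

Lemma measurable_joint2 : measurable_fun setT (fun w : Omega => ((w : OG, W e1 w), W e2 w)).
Proof. exact: measurable_fun_pair. Qed.

Let joint2 : {mfun Omega >-> ((OG * R) * R)%type} :=
  HB.pack (fun w : Omega => ((w : OG, W e1 w), W e2 w))
  (isMeasurableFun.Build _ _ Omega ((OG * R) * R)%type _ measurable_joint2).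

Lemma joint_law1 (S : set (OG * R)) : measurable S ->
  (distribution P idG \x distribution P (W e1))%E S = distribution P joint1 S.
Proof.
apply: product_measure_unique => A B mA mB.
rewrite /distribution/= /pushforward/=.
apply: (isonormal_independent isoW) => //.
by apply: sub_generators mA => h [].
Qed.

(** As [e1] is orthogonal to [e2], the map [joint1] is measurable for the sigma-algebra of the
    complement of [e2], and [isonormal_independent] applies again. *)
Lemma joint_law2 (S : set ((OG * R) * R)) : measurable S ->
  (distribution P joint1 \x distribution P (W e2))%E S = distribution P joint2 S.
Proof.
apply: product_measure_unique => D B mD mB.
rewrite /distribution/= /pushforward/=.
apply: (isonormal_independent isoW) => //.
pose G2 := generators (orthogonal_to e2).
have mid : measurable_fun setT (fun w : g_sigma_algebraType G2 => w : OG).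
  by move=> _ A mA; rewrite setTI; apply: sub_generators mA => h [].
have me1 : measurable_fun setT (fun w : g_sigma_algebraType G2 => W e1 w).
  move=> _ A mA; apply: sub_gen_smallest; exists e1; first exact: e12.
  by exists A.
have m1 : measurable_fun setT (fun w : g_sigma_algebraType G2 => (w : OG, W e1 w)).
  exact: measurable_fun_pair.
by have := m1 measurableT D mD; rewrite setTI.
Qed.

Lemma joint_null (S : set ((OG * R) * R)) : measurable S ->
  P [set w | S ((w : OG, W e1 w), W e2 w)] = 0%E <->
  {ae distribution P idG, forall w, {ae distribution P (W e1), forall x,
    {ae distribution P (W e2), forall y, ~ S ((w, x), y)}}}.
Proof.
move=> mS; rewrite -[P _]/(distribution P joint2 S) -joint_law2// product_null_ae//.
set m2 := distribution P (W e2).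
(* The pairs with a nonnull section: this turns the innermost almost everywhere statement into a
   measurable set, to which [joint_law1] applies. *)
pose T := [set z : OG * R | m2 (xsection S z) != 0%E].
have mT : measurable T.
  have mf : measurable_fun setT (m2 \o xsection S) by exact: measurable_fun_xsection.
  by have := measurable_neqe measurableT mf (measurable_cst 0%E); rewrite setTI.
have ST z : ~ T z <-> {ae m2, forall y, ~ S (z, y)}.
  have -> : ~ T z <-> m2 (xsection S z) = 0%E.
    by rewrite /T/=; split => [/negP/negPn/eqP|->]//; rewrite eqxx.
  rewrite -negligibleP; last exact: measurable_xsection.
  split; apply: negligibleS => y /=.
    by move=> /contrapT Sxy; rewrite /xsection/= inE.
  by rewrite /xsection/= inE => Sxy; apply.
have -> : {ae distribution P joint1, forall x, {ae m2, forall y, ~ S (x, y)}} <->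
    distribution P joint1 T = 0%E.
  rewrite -(negligibleP _ mT); split; apply: negligibleS => z /=.
    by move=> Tz; rewrite -ST; apply.
  by rewrite -ST => /contrapT.
rewrite -joint_law1// product_null_ae//.
by split; apply: filterS => w; apply: filterS => x; rewrite ST.
Qed.

(** The normal density is positive everywhere, so both measures have the same null sets. *)
Lemma unit_law_equiv (e : H) (Q : R -> Prop) : inner e e = 1 ->
  {ae distribution P (W e), forall x, Q x} <-> {ae @lebesgue_measure R, forall x, Q x}.
Proof.
move=> e1_; have [s s1 law] := isonormal_law isoW e.
have s0 : s != 0 by rewrite -sqrf_eq0 s1 e1_ oner_eq0.
have lawE (A : set R) : measurable A -> distribution P (W e) A = normal_prob 0 s A.
  by move=> mA; rewrite [LHS]law// (negbTE s0).
suff E (A : set R) : measurable A ->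
    distribution P (W e) A = 0%E <-> @lebesgue_measure R A = 0%E.
  by split=> -[N [mN N0 QN]]; exists N; split => //; apply/E.
move=> mA; rewrite lawE//; split => A0; last first.
  have /null_content_dominatesP := @normal_prob_dominates R 0 s; exact.
have mpdf : measurable_fun A (fun x => (normal_pdf 0 s x)%:E).
  by apply/measurable_EFinP; apply: measurable_funTS; exact: measurable_normal_pdf.
have := ae_eq_integral_abs (@lebesgue_measure R) mA mpdf.
under eq_integral do rewrite gee0_abs ?lee_fin ?normal_pdf_ge0//.
move=> [/(_ A0) [N [mN N0 AN]] _].
apply/eqP; rewrite eq_le measure_ge0 andbT -N0 le_measure ?inE// => x Ax.
apply: AN => /= /(_ Ax) /eqP; apply/negP.
rewrite eqe gt_eqF// normal_pdf_formula// mulr_gt0 ?expR_gt0// invr_gt0 sqrtr_gt0.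
by rewrite pmulrn_lgt0// mulr_gt0 ?pi_gt0// exprn_even_gt0.
Qed.

Lemma isonormal_disintegration : inner e1 e1 = 1 -> inner e2 e2 = 1 ->
  exists law : {measure set OG -> \bar R}, forall S : set ((OG * R) * R), measurable S ->
  P [set w | S ((w : OG, W e1 w), W e2 w)] = 0%E <->
  {ae law, forall w, {ae @lebesgue_measure R, forall x,
    {ae @lebesgue_measure R, forall y, ~ S ((w, x), y)}}}.
Proof.
move=> u1 u2; exists (distribution P idG) => S mS; rewrite joint_null//.
have E w : {ae distribution P (W e1), forall x, {ae distribution P (W e2), forall y, ~ S (w, x, y)}} <->
    {ae @lebesgue_measure R, forall x, {ae @lebesgue_measure R, forall y, ~ S (w, x, y)}}.
  rewrite -(unit_law_equiv _ u1).
  by split; apply: filterS => x; rewrite (unit_law_equiv _ u2).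
by split; apply: filterS => w /E.
Qed.

End JointLaw.

(** * Almost sure approximation of multiple integrals by Hermite sums *)

Section WienerIntegrals.
Context {R : realType} {d : measure_display} {Omega : measurableType d}.
Context (P : probability Omega R) {H T : hilbertType R} {m : nat}.
Variables (W : H -> {RV P >-> R}) (tens : ('I_m -> H) -> T) (I : T -> {RV P >-> R}).
Hypotheses (tensT : tensor_power tens) (intI : multiple_integral W tens I).
Hypothesis m_gt0 : (0 < m)%N.

Definition power_sum (s : seq (R * H)) : T := \sum_(p <- s) p.1 *: tpow tens p.2.

Definition hermite_sum (s : seq (R * H)) (w : Omega) : R :=
  \sum_(p <- s) p.1 * (hermite R m).[W p.2 w].

Definition unit_seq (s : seq (R * H)) := forall p, p \in s -> `|p.2| = 1.

Lemma integral_linear a f g : symmetric_tensor tens f -> symmetric_tensor tens g ->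
  {ae P, forall w, I (a *: f + g) w = a * I f w + I g w}.
Proof. by case: intI => + _ _; exact. Qed.

Lemma multiple_integral0 f : symmetric_tensor tens f -> {ae P, forall w, I 0 w = 0}.
Proof.
move=> symf; have sym0 : symmetric_tensor tens (0 : T).
  by have := symmetric_power_span symf 0 (power_span0 tens); rewrite scale0r addr0.
have := integral_linear 1 sym0 sym0; rewrite scale1r addr0.
by apply: filterS => w; rewrite mul1r => E; lra.
Qed.

Lemma integral_isometry f : symmetric_tensor tens f ->
  (\int[P]_w (I f w ^+ 2)%:E = (m`!%:R * `|f| ^+ 2)%:E)%E.
Proof.
by move=> symf; case: intI => _ _ /(_ f symf); rewrite unlock.
Qed.

Section Symmetric.
Variable f : T.
Hypothesis symf : symmetric_tensor tens f.

Lemma symmetric_power_sum s : unit_seq s -> symmetric_tensor tens (power_sum s).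
Proof.
move=> s1; have xs : power_span tens (power_sum s) by exists s.
by have := symmetric_power_span symf 0 xs; rewrite scale0r add0r.
Qed.

Lemma integral_power_sum s : unit_seq s ->
  {ae P, forall w, I (power_sum s) w = hermite_sum s w}.
Proof.
elim: s => [_|p s IHs s1].
  rewrite /power_sum big_nil; have := multiple_integral0 symf; apply: filterS => w ->.
  by rewrite /hermite_sum big_nil.
have s1' : unit_seq s by move=> q qs; apply: s1; rewrite inE qs orbT.
have p1 : `|p.2| = 1 by apply: s1; rewrite mem_head.
have symp : symmetric_tensor tens (tpow tens p.2).
  by have := symmetric_power_span symf 0 (power_span_tpow tensT m_gt0 p.2); rewrite scale0r add0r.
have Ip : {ae P, forall w, I (tpow tens p.2) w = (hermite R m).[W p.2 w]}.
  by case: intI => _ + _; exact.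
have := integral_linear p.1 symp (symmetric_power_sum s1').
rewrite /power_sum big_cons; apply: filterS3 (IHs s1') Ip => w E1 E2 E3.
by rewrite E3 E2 E1 /hermite_sum big_cons.
Qed.

(** The approximation is so fast that the second moments of the errors are summable. The sum of the
    squared errors is then integrable, hence finite almost surely, and the errors tend to 0 along
    the whole sequence. *)
Lemma integral_approx : exists s_ : nat -> seq (R * H), [/\ forall k, unit_seq (s_ k),
  power_sum (s_ k) @[k --> \oo] --> f &
  {ae P, forall w, hermite_sum (s_ k) w @[k --> \oo] --> I f w}].
Proof.
have mf0 : 0 < (m`!%:R : R) by rewrite ltr0n fact_gt0.
pose e k : R := 1 / (2 ^ k.+1)%:R.
have e0 k : 0 < e k by rewrite divr_gt0// ltr0n expn_gt0.
have e_le k : e k <= k.+1%:R^-1.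
  rewrite /e mul1r lef_pV2 ?posrE// ?ltr0n ?expn_gt0// ler_nat.
  exact: ltnW (ltn_expl k.+1 (isT : (1 < 2)%N)).
(* The division by the factorial serves the isometry: the distance is at most 1, so its square times
   the factorial stays below [e k]. *)
have /choice[s_ Hs] : forall k, exists s, unit_seq s /\ `|f - power_sum s| < e k / m`!%:R.
  move=> k; have [_ [s s1 ->] fs] := symmetric_approx tensT m_gt0 symf (divr_gt0 (e0 k) mf0).
  by exists s.
exists s_; have s1 k : unit_seq (s_ k) by have [] := Hs k.
have m1 : 1 <= (m`!%:R : R) by rewrite ler1n fact_gt0.
have fe k : `|f - power_sum (s_ k)| < e k / m`!%:R by have [] := Hs k.
have fe1 k : `|f - power_sum (s_ k)| < e k.
  by apply: lt_le_trans (fe k) _; rewrite ler_pdivrMr// ler_peMr// ltW.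
split => //.
  apply/cvgrPdist_lt => r r0; near=> k.
  apply: lt_trans (fe1 k) _; apply: le_lt_trans (e_le k) _.
  by near: k; exact: (near_infty_natSinv_lt (PosNum r0)).
have symD k : symmetric_tensor tens (1 *: f + (-1) *: power_sum (s_ k)).
  by apply: symmetric_power_span => //; apply: power_spanZ; exists (s_ k) => //; exact: s1.
pose D k := I (1 *: f + (-1) *: power_sum (s_ k)).
have DE : {ae P, forall w, forall k, D k w = I f w - hermite_sum (s_ k) w}.
  apply: ae_foralln => k.
  have xs : symmetric_tensor tens (power_sum (s_ k)) := symmetric_power_sum (s1 k).
  have sym0 : symmetric_tensor tens (0 : T).
    by have := symmetric_power_span symf 0 (power_span0 tens); rewrite scale0r addr0.
  have symN : symmetric_tensor tens ((-1) *: power_sum (s_ k)).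
    have xk : power_span tens ((-1) *: power_sum (s_ k)).
      by apply: power_spanZ; exists (s_ k) => //; exact: s1.
    by have := symmetric_power_span symf 0 xk; rewrite scale0r add0r.
  have L1 := integral_linear 1 symf symN.
  have L2 := integral_linear (-1) xs sym0; rewrite addr0 in L2.
  apply: filterS3 (filterI (integral_power_sum (s1 k)) (multiple_integral0 symf)) L1 L2 => w [E1 E2] E3 E4.
  by rewrite /D E3 E4 E1 E2 addr0 mul1r mulN1r.
have intD k : (\int[P]_w (D k w ^+ 2)%:E <= (e k)%:E)%E.
  rewrite integral_isometry// lee_fin scale1r scaleN1r expr2.
  rewrite -ler_pdivlMl//; apply: le_trans (_ : _ <= `|f - power_sum (s_ k)| * 1) _.
    rewrite ler_wpM2l// (le_trans (ltW (fe1 k)))// (le_trans (e_le k))//.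
    by rewrite invf_le1// ler1n.
  by rewrite mulr1 mulrC ltW.
have mD k : measurable_fun setT (fun w => (D k w ^+ 2)%:E).
  by apply/measurable_EFinP; exact: measurable_funX.
pose S w := (\sum_(k <oo) (D k w ^+ 2)%:E)%E.
have S0 w : (0 <= S w)%E by apply: nneseries_ge0 => k _ _; rewrite lee_fin sqr_ge0.
have mS : measurable_fun setT S.
  by apply: ge0_emeasurable_sum => // k w _ _; rewrite lee_fin sqr_ge0.
have iS : P.-integrable setT S.
  apply/integrableP; split => //.
  under eq_integral do rewrite gee0_abs//.
  rewrite /S integral_nneseries//; last by move=> k w _; rewrite lee_fin sqr_ge0.
  apply: (@le_lt_trans _ _ (\sum_(k <oo) (e k)%:E)%E).
    apply: lee_nneseries => k *; last exact: intD.
    by apply: integral_ge0 => w _; rewrite lee_fin sqr_ge0.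
  apply: le_lt_trans (epsilon_trick0 xpredT ler01) _.
  exact: ltry.
apply: filterS2 DE (integrable_ae measurableT iS) => w Dw /(_ Logic.I) Sw.
have cD : (D k w ^+ 2) @[k --> \oo] --> (0 : R).
  apply: cvg_series_cvg_0; apply: nondecreasing_is_cvgn.
    apply/nondecreasing_seqP => n; rewrite /series/= big_nat_recr//=.
    by rewrite lerDl sqr_ge0.
  exists (fine (S w)) => _ [n _ <-].
  rewrite -lee_fin fineK// /series/= -sumEFin.
  by apply: nneseries_lim_ge => k _ _; rewrite lee_fin sqr_ge0.
apply/cvgrPdist_lt => r r0.
have r2 : (0 : R) < r ^+ 2 by rewrite exprn_gt0.
have n2 : \forall k \near \oo, D k w ^+ 2 < r ^+ 2 by apply: (cvgr_lt _ cD).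
near=> k; have : D k w ^+ 2 < r ^+ 2 by near: k.
by rewrite Dw -[X in X < _]ger0_norm ?sqr_ge0// normrX ltr_pXn2r// nnegrE ltW.
Unshelve. all: by end_near. Qed.

End Symmetric.
End WienerIntegrals.

(** * Limits of polynomials under almost everywhere convergence *)

Section LebesgueAlmostEverywhere.
Context {R : realType}.
Local Notation mu := (@lebesgue_measure R).
Implicit Type Q : R -> Prop.

(** Multiplication by [a] expands distances by [|a|], so it pulls null sets back to null sets. *)
Lemma ae_scale Q (a : R) : a != 0 -> {ae mu, forall y, Q y} -> {ae mu, forall s, Q (a * s)}.
Proof.
move=> a0 aQ; have na : 0 < `|a| by rewrite normr_gt0.
have := @negligible_expanding R ( *%R a) `|a| setT (~` [set y | Q y]) na _ aQ.
rewrite setTI; apply => x y _ _.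
by rewrite -mulrBr normrM.
Qed.

Lemma ae_neq0 : {ae mu, forall x, x != 0}.
Proof.
exists [set 0]; split; [exact: measurable_set1|exact: lebesgue_measure_set1|].
by move=> x /= /negP; rewrite negbK => /eqP.
Qed.

(** A null set together with finitely many points does not cover [0, 1]. *)
Lemma ae_points Q n : {ae mu, forall x, Q x} ->
  exists s : seq R, [/\ uniq s, size s = n & forall x, x \in s -> Q x].
Proof.
move=> [N [mN N0 QN]]; elim: n => [|n [s [us sn Qs]]]; first by exists [::].
have [x [xs Qx]] : exists x, x \notin s /\ Q x.
  apply: contrapT => /forallNP nx.
  have sN : [set: R] `<=` N `|` [set` s].
    move=> x _; have [xs|xs] := boolP (x \in s); first by right.
    by left; apply: QN => /= Qx; apply: (nx x).
  have ms : mu [set` s] = 0%E.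
    by apply: countable_lebesgue_measure0; apply: finite_set_countable; exact: finite_seq.
  have mseq : measurable [set` s].
    by apply: countable_measurable => //; apply: finite_set_countable; exact: finite_seq.
  have : (mu `[0%R, 1%R]%classic <= mu N + mu [set` s])%E.
    apply: le_trans (measureU2 _ mN mseq); apply: le_measure; rewrite ?inE//.
      exact: measurableU.
    by move=> x _; exact: sN.
  by rewrite N0 ms adde0 lebesgue_measure_itv/= lte01 oppr0 adde0 lee_fin ler10.
exists (x :: s); split => /=; [by rewrite xs us|by rewrite sn|].
by move=> y; rewrite inE => /predU1P[->//|/Qs].
Qed.

Lemma ae_seq (I : eqType) (r : seq I) (Q : I -> R -> Prop) :
  (forall i, i \in r -> {ae mu, forall x, Q i x}) ->
  {ae mu, forall x, forall i, i \in r -> Q i x}.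
Proof.
elim: r => [|i r IHr] aQ; first by apply: aeW.
have a1 := aQ _ (mem_head i r).
have a2 : {ae mu, forall x, forall j, j \in r -> Q j x}.
  by apply: IHr => j jr; apply: aQ; rewrite inE jr orbT.
apply: (@filterS2 _ _ (ae_filter_ringOfSetsType _) _ _ _ _ a1 a2) => x Qi Qr j.
by rewrite inE => /predU1P[->|/Qr].
Qed.

End LebesgueAlmostEverywhere.

Section LimitingPolynomials.
Context {R : realType}.
Local Notation mu := (@lebesgue_measure R).

(* Almost everywhere convergence yields an n * n grid of points of convergence,
   and bivariate polynomials of degree less than n in each variable are linear
   combinations of their values on it. *)
Lemma limiting_polynomial n (f_ : nat -> R -> R -> R) (P_ : nat -> {poly {poly R}}) :
    (forall k, bisize n (P_ k)) ->
    (forall k t s, f_ k t (t * s) = bieval (P_ k) (t, s)) ->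
    {ae mu, forall x, {ae mu, forall y, cvgn (fun k => f_ k x y)}} ->
  exists P, [/\ bisize n P, forall i j, (P_ k)`_i`_j @[k --> \oo] --> P`_i`_j &
    forall t s, f_ k t (t * s) @[k --> \oo] --> bieval P (t, s)].
Proof.
move=> bP fP cf; have X0 := @ae_neq0 R.
have cf0 : {ae mu, forall x, x != 0 /\ {ae mu, forall y, cvgn (fun k => f_ k x y)}}.
  by apply: (@filterS2 _ _ (ae_filter_ringOfSetsType _) _ _ _ _ X0 cf) => x.
have [ts [uts tn tsP]] := ae_points n cf0.
have cs : {ae mu, forall s, forall t, t \in ts -> cvgn (fun k => f_ k t (t * s))}.
  by apply: ae_seq => t /tsP[t0 ct]; exact: ae_scale ct.
have [ss [uss sn ssP]] := ae_points n cs.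
have [P [sP cP eP]] : exists P, [/\ bisize n P,
    forall i j, (P_ k)`_i`_j @[k --> \oo] --> P`_i`_j &
    forall t s, bieval (P_ k) (t, s) @[k --> \oo] --> bieval P (t, s)].
  apply: (bieval_limit uts tn uss sn bP) => t s tts sss.
  by have := ssP _ sss _ tts; under eq_fun do rewrite fP.
by exists P; split => // t s; under eq_fun do rewrite fP; exact: eP.
Qed.

(** The polynomials live in the coordinates (x, s) with y = x s. Their coefficients of top degree in
    x converge to [p] and [q], so the limits have these as top coefficients and [bieval_nonsingular]
    applies to them. *)
Lemma limit_pair_null m (f_ g_ : nat -> R -> R -> R) (P_ Q_ : nat -> {poly {poly R}})
    (p q : R -> R) (A : set (R * R)) :
    (forall k, bisize m.+2 (P_ k)) -> (forall k, bisize m.+2 (Q_ k)) ->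
    (forall k t s, f_ k t (t * s) = bieval (P_ k) (t, s)) ->
    (forall k t s, g_ k t (t * s) = bieval (Q_ k) (t, s)) ->
    {ae mu, forall x, {ae mu, forall y, cvgn (fun k => f_ k x y)}} ->
    {ae mu, forall x, {ae mu, forall y, cvgn (fun k => g_ k x y)}} ->
    (forall s, ((P_ k)`_m.+1).[s] @[k --> \oo] --> p s) ->
    (forall s, ((Q_ k)`_m.+1).[s] @[k --> \oo] --> q s) ->
    p 0 != 0 -> (exists s, q s != q 0 / p 0 * p s) ->
    measurable A -> (mu \x mu)%E A = 0%E ->
  {ae mu, forall x, {ae mu, forall y,
    ~ A (limn (fun k => f_ k x y), limn (fun k => g_ k x y))}}.
Proof.
move=> bP bQ fP gQ cf cg Pp Qq p0 [s0 qs] mA A0.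
have [P [sP cP eP]] := limiting_polynomial bP fP cf.
have [Q [sQ cQ eQ]] := limiting_polynomial bQ gQ cg.
have top (B_ : nat -> {poly {poly R}}) B b : (forall k, bisize m.+2 (B_ k)) -> bisize m.+2 B ->
    (forall i j, (B_ k)`_i`_j @[k --> \oo] --> B`_i`_j) ->
    (forall s, ((B_ k)`_m.+1).[s] @[k --> \oo] --> b s) ->
    forall s, (B`_m.+1).[s] = b s.
  move=> sB_ [_ sB] cB Bb s.
  have c1 : ((B_ k)`_m.+1).[s] @[k --> \oo] --> (B`_m.+1).[s].
    rewrite (horner_coef_wide _ (sB _)).
    under eq_fun do rewrite (horner_coef_wide _ ((sB_ _).2 _)).
    by apply: cvg_bigsum => j _; apply: cvgM; [exact: cB|exact: cvg_cst].
  by rewrite -(cvg_lim _ c1)// (cvg_lim _ (Bb s)).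
have Pm := top _ _ _ bP sP cP Pp; have Qm := top _ _ _ bQ sQ cQ Qq.
(* Otherwise [q] would be the multiple of [p] fixed by the values at 0, against [qs]. *)
have J0 : jacobian P Q != 0.
  apply: jacobian_neq0; [exact: sP.1|exact: sQ.1|].
  apply: contra_neqN qs => /eqP /proportional_of_wronskian; rewrite !Pm => /(_ p0).
  by move=> /(congr1 (fun r => r.[s0])); rewrite hornerZ Pm !Qm => ->.
have P'0 : deriv P != 0.
  apply: (@deriv_neq0 _ _ m); apply: contraNneq p0 => Pm0.
  by rewrite -Pm Pm0 horner0.
have := bieval_nonsingular P'0 J0 mA A0.
have mS : measurable [set z | A (bieval P z, bieval Q z)].
  by rewrite -[X in measurable X]setTI; apply: measurable_fun_pair => //; exact: measurable_bieval.
move=> /(product_null_xsection mu mu mS) aeS.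
have X0 := @ae_neq0 R.
apply: (@filterS2 _ _ (ae_filter_ringOfSetsType _) _ _ _ _ X0 aeS) => x x0 Sx0.
(* For fixed nonzero x, the scaling s = y / x brings the exceptional null set back to y. *)
have aes : {ae mu, forall s, ~ A (bieval P (x, s), bieval Q (x, s))}.
  exists (xsection [set z | A (bieval P z, bieval Q z)] x); split => //.
    exact: measurable_xsection.
  by move=> s /= /contrapT As; rewrite /xsection/= inE.
have x'0 : x^-1 != 0 by rewrite invr_eq0.
have := ae_scale x'0 aes.
apply: (@filterS _ _ (ae_filter_ringOfSetsType _)) => y nA.
have := eP x (x^-1 * y); have := eQ x (x^-1 * y); rewrite mulVKf//.
by move=> /(cvg_lim (@Rhausdorff R)) -> /(cvg_lim (@Rhausdorff R)) ->.
Qed.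

End LimitingPolynomials.

Section LimitMeasurability.
Context {d} {Z : measurableType d} {R : realType}.
Variable h : nat -> Z -> R.
Hypothesis mh : forall k, measurable_fun setT (h k).

(** The Cauchy criterion with tolerances 1 / (n + 1) needs only countable unions and
    intersections. *)
Lemma measurable_cvg_set : measurable [set z | cvgn (fun k => h k z)].
Proof.
rewrite (_ : [set _ | _] = \bigcap_n \bigcup_N \bigcap_i
    [set z | `|h N z - h (N + i)%N z| <= n.+1%:R^-1]).
  apply: bigcapT_measurable => n; apply: bigcupT_measurable => N.
  apply: bigcapT_measurable => i; apply: measurable_ler => //.
  by apply: measurableT_comp => //; exact: measurable_funB.
apply/seteqP; split => z /=.
  move=> /cvg_cauchy/cauchyP cz n _.
  have n0 : (0 : R) < n.+1%:R^-1 / 2 by rewrite divr_gt0// invr_gt0.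
  have [x [N _ HN]] := cz _ n0; exists N => // i _ /=.
  have b1 : `|x - h N z| < n.+1%:R^-1 / 2 by exact: (HN N (leqnn _)).
  have b2 : `|x - h (N + i)%N z| < n.+1%:R^-1 / 2 by exact: (HN (N + i)%N (leq_addr _ _)).
  rewrite (_ : h N z - _ = (x - h (N + i)%N z) - (x - h N z)); last by ring.
  apply: (le_trans (ler_normB _ _)).
  by rewrite [leRHS]splitr lerD// ltW.
move=> Hz; apply/cauchy_cvgP/cauchyP => e e0.
have [n _ ne] := near_infty_natSinv_lt (PosNum e0).
have [N _ HN] := Hz n Logic.I; exists (h N z); exists N => // k /= Nk.
rewrite /ball/=; apply: le_lt_trans (ne n (leqnn _)).
by have := HN (k - N)%N Logic.I; rewrite subnKC.
Qed.

(* The limit superior is measurable without a convergence hypothesis. *)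
Definition seq_limit (z : Z) : R := fine (limn_esup (fun k => (h k z)%:E)).

Lemma measurable_seq_limit : measurable_fun setT seq_limit.
Proof.
apply: measurableT_comp => //; apply: measurable_fun_limn_esup => k.
exact/measurable_EFinP.
Qed.

Lemma seq_limitE z l : h k z @[k --> \oo] --> l -> seq_limit z = l.
Proof.
move=> hl; have c : (h k z)%:E @[k --> \oo] --> l%:E by apply: cvg_EFin => //; exact: nearW.
rewrite /seq_limit is_cvg_limn_esupE; last by apply/cvg_ex; exists l%:E.
by rewrite (cvg_lim _ c).
Qed.

End LimitMeasurability.

(** * The law of a pair of multiple integrals *)

Section WienerChaosPair.
Context {R : realType} {d : measure_display} {Omega : measurableType d}.
Context (P : probability Omega R) {H T : hilbertType R} {m : nat}.
Variables (W : H -> {RV P >-> R}) (tens : ('I_m.+1 -> H) -> T) (I : T -> {RV P >-> R}).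
Hypotheses (isoW : isonormal W) (tensT : tensor_power tens).
Hypothesis intI : multiple_integral W tens I.
Local Notation mu := (@lebesgue_measure R).

Section Directions.
Variables e1 e2 : H.
Hypotheses (u1 : inner e1 e1 = 1) (u2 : inner e2 e2 = 1) (u12 : inner e1 e2 = 0).
Local Notation OG := (g_sigma_algebraType (generators W (orthogonal_to2 e1 e2))).

Definition rest (u : H) : H := u - (inner u e1 *: e1 + inner u e2 *: e2).

Lemma rest_orthogonal u : orthogonal_to2 e1 e2 (rest u).
Proof.
split; rewrite /orthogonal_to/= /rest innerBl innerDl !innerZl ?(innerC e2 e1) u12.
  by rewrite u1 mulr1 mulr0 addr0 subrr.
by rewrite u2 mulr1 mulr0 add0r subrr.
Qed.

(** [W u] on the product space, with free coordinates in place of [W e1] and [W e2]. The agreement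
    with [W u] is almost sure, by [affine_valueE]. *)
Definition affine_value (u : H) (z : (OG * R) * R) : R :=
  inner u e1 * z.1.2 + inner u e2 * z.2 + W (rest u) z.1.1.

Definition product_sum (s : seq (R * H)) (z : (OG * R) * R) : R :=
  \sum_(p <- s) p.1 * (hermite R m.+1).[affine_value p.2 z].

Lemma measurable_product_sum s : measurable_fun setT (product_sum s).
Proof.
apply: measurable_sum => p; apply: measurable_funM => //.
apply: measurableT_comp; first by apply: continuous_measurable_fun; exact: continuous_horner.
apply: measurable_funD; first apply: measurable_funD.
- by apply: measurable_funM => //; exact: measurableT_comp.
- by apply: measurable_funM.
- have mr : measurable_fun setT (fun w : OG => W (rest p.2) w).
    move=> _ A mA; apply: sub_gen_smallest; exists (rest p.2); first exact: rest_orthogonal.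
    by exists A.
  by apply: (measurableT_comp mr); exact: measurableT_comp.
Qed.

Lemma affine_valueE u :
  {ae P, forall w, W u w = affine_value u ((w : OG, W e1 w), W e2 w)}.
Proof.
have := @isonormal_lincomb0 _ _ _ _ _ _ isoW 4
  (fun i => nth 0 [:: 1; - inner u e1; - inner u e2; - 1] i)
  (fun i => nth 0 [:: u; e1; e2; rest u] i).
rewrite !big_ord_recl !big_ord0/= !scaleNr !scale1r addr0.
have -> : u + (- (inner u e1 *: e1) + (- (inner u e2 *: e2) - rest u)) = 0.
  by rewrite addrA addrA -[u - _ - _]addrA -opprD subrr.
move=> /(_ erefl); apply: filterS => w.
by rewrite !big_ord_recl !big_ord0/= /affine_value/= => ?; lra.
Qed.

Lemma hermite_sumE s : {ae P, forall w,
  hermite_sum W (m := m.+1) s w = product_sum s ((w : OG, W e1 w), W e2 w)}.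
Proof.
elim: s => [|p s IHs].
  by apply: aeW => w; rewrite /hermite_sum /product_sum !big_nil.
apply: filterS2 IHs (affine_valueE p.2) => w E1 E2.
by rewrite /hermite_sum /product_sum !big_cons -/(hermite_sum _ _ _) E1 E2.
Qed.

(* At W e1 = t and W e2 = t * x, W u is (slope u).[x] * t + W (rest u). *)
Definition slope (u : H) : {poly R} := (inner u e1)%:P + inner u e2 *: 'X.

Definition section_poly (s : seq (R * H)) (w : Omega) : {poly {poly R}} :=
  \sum_(p <- s) p.1%:P%:P * affine_comp m.+1 (hermite R m.+1) (slope p.2) (W (rest p.2) w).

Lemma size_slope u : (size (slope u) <= 2)%N.
Proof.
apply: leq_trans (size_polyD _ _) _; rewrite geq_max.
rewrite (leq_trans (size_polyC_leq1 _))//.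
by apply: leq_trans (size_scale_leq _ _) _; rewrite size_polyX.
Qed.

Lemma bisize_section_poly s w : bisize m.+2 (section_poly s w).
Proof.
elim: s => [|p s IHs].
  rewrite /section_poly big_nil; split; first by rewrite size_poly0.
  by move=> i; rewrite coef0 size_poly0.
rewrite /section_poly big_cons; apply: bisize_lin => //.
by apply: bisize_affine_comp; rewrite ?size_slope// (hermite_monic R m.+1).1.
Qed.

Lemma bieval_section_poly s w t x : product_sum s ((w, t), t * x) =
  bieval (section_poly s w) (t, x).
Proof.
rewrite /bieval /section_poly !horner_sum; apply: eq_bigr => p _.
rewrite !hornerM !hornerC; congr (_ * _).
rewrite -/(bieval _ (t, x)) bieval_affine_comp ?size_slope//; last first.
  by rewrite (hermite_monic R m.+1).1.
by congr (_.[_]); rewrite /affine_value/= /slope hornerD hornerC hornerZ hornerX; ring.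
Qed.

(** Hermite polynomials are monic and [W (rest u)] does not enter the top coefficient, so powers of
    [slope] remain, and these are inner products of tensor powers. The result is independent of [w]
    and continuous in the tensor. *)
Lemma section_poly_top s w x : ((section_poly s w)`_m.+1).[x] =
  inner (power_sum tens s) (tpow tens (e1 + x *: e2)).
Proof.
rewrite /section_poly /power_sum coef_sum horner_sum inner_suml; apply: eq_bigr => p _.
rewrite coefCM hornerM hornerC innerZl; congr (_ * _).
rewrite affine_comp_top (inner_tpow tensT) hornerZ horner_exp.
have [sh /monicP] := hermite_monic R m.+1; rewrite lead_coefE sh/= => ->.
by rewrite mul1r /slope !hornerE innerDr innerZr mulrC.
Qed.

End Directions.

Variables f g : T.
Hypotheses (symf : symmetric_tensor tens f) (symg : symmetric_tensor tens g).
Hypothesis indep : forall a b : R, a *: f + b *: g = 0 -> a = 0 /\ b = 0.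

Lemma pair_null (A : set (R * R)) : measurable A -> (mu \x mu)%E A = 0%E ->
  P [set w | A (I f w, I g w)] = 0%E.
Proof.
move=> mA A0.
have af := symmetric_approx tensT (ltn0Sn m) symf.
have ag := symmetric_approx tensT (ltn0Sn m) symg.
have [e1 [e2 [u1 u2 u12 fe1 [s0 gs]]]] :=
  independent_directions tensT (ltn0Sn m) af ag indep.
have [sf [sf1 sfc sfI]] := integral_approx tensT intI (ltn0Sn m) symf.
have [sg [sg1 sgc sgI]] := integral_approx tensT intI (ltn0Sn m) symg.
have [law Hlaw] := isonormal_disintegration isoW u12 u1 u2.
pose OG := g_sigma_algebraType (generators W (orthogonal_to2 e1 e2)).
pose Ff k : (OG * R) * R -> R := product_sum (e1 := e1) (e2 := e2) (sf k).
pose Fg k : (OG * R) * R -> R := product_sum (e1 := e1) (e2 := e2) (sg k).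
have mFf k : measurable_fun setT (Ff k) by exact: measurable_product_sum.
have mFg k : measurable_fun setT (Fg k) by exact: measurable_product_sum.
pose phi (w : Omega) : (OG * R) * R := ((w : OG, W e1 w), W e2 w).
have cF : {ae P, forall w, Ff k (phi w) @[k --> \oo] --> I f w}.
  have E : {ae P, forall w, forall k, hermite_sum W (m := m.+1) (sf k) w = Ff k (phi w)}.
    by apply: ae_foralln => k; exact: hermite_sumE.
  by apply: filterS2 E sfI => w E c; under eq_fun do rewrite -E.
have cG : {ae P, forall w, Fg k (phi w) @[k --> \oo] --> I g w}.
  have E : {ae P, forall w, forall k, hermite_sum W (m := m.+1) (sg k) w = Fg k (phi w)}.
    by apply: ae_foralln => k; exact: hermite_sumE.
  by apply: filterS2 E sgI => w E c; under eq_fun do rewrite -E.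
(* The points of the product space where both Hermite sums converge. Convergence is almost sure, and
   [Hlaw] passes it on to almost every section. *)
pose S0 : set ((OG * R) * R) := [set z | cvgn (fun k => Ff k z)] `&` [set z | cvgn (fun k => Fg k z)].
have mS0 : measurable S0 by apply: measurableI; exact: measurable_cvg_set.
(* The intersection with [S0] ensures that [seq_limit] is the true limit, which equals the integrals
   almost surely. *)
pose SA := S0 `&` [set z | A (seq_limit Ff z, seq_limit Fg z)].
have mSA : measurable SA.
  apply: measurableI => //; rewrite -[X in measurable X]setTI.
  by apply: measurable_fun_pair => //; exact: measurable_seq_limit.
have mphi (S : set ((OG * R) * R)) : measurable S -> measurable [set w : Omega | S (phi w)].
  by move=> mS; have := measurable_joint2 (P := P) (W := W) (e1 := e1) (e2 := e2) measurableT mS; rewrite setTI.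
have S0ae : P [set w : Omega | (~` S0) (phi w)] = 0%E.
  apply/negligibleP; first by apply: (mphi (~` S0)); exact: measurableC.
  have : {ae P, forall w, S0 (phi w)}.
    by apply: filterS2 cF cG => w c1 c2; split; apply/cvg_ex; [exists (I f w)|exists (I g w)].
  exact.
have {}S0ae := (Hlaw _ (measurableC mS0)).1 S0ae.
have SA0 : P [set w : Omega | SA (phi w)] = 0%E.
  apply/(Hlaw _ mSA); apply: filterS S0ae => w S0w.
  have cvS : {ae mu, forall x, {ae mu, forall y, S0 ((w, x), y)}}.
    apply: (@filterS _ _ (ae_filter_ringOfSetsType _)) S0w => x.
    by apply: (@filterS _ _ (ae_filter_ringOfSetsType _)) => y /contrapT.
  have cvf : {ae mu, forall x, {ae mu, forall y, cvgn (fun k => Ff k ((w, x), y))}}.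
    apply: (@filterS _ _ (ae_filter_ringOfSetsType _)) cvS => x.
    by apply: (@filterS _ _ (ae_filter_ringOfSetsType _)) => y [].
  have cvg_ : {ae mu, forall x, {ae mu, forall y, cvgn (fun k => Fg k ((w, x), y))}}.
    apply: (@filterS _ _ (ae_filter_ringOfSetsType _)) cvS => x.
    by apply: (@filterS _ _ (ae_filter_ringOfSetsType _)) => y [].
  have cinner (s_ : nat -> seq (R * H)) (h : T) v : power_sum tens (s_ k) @[k --> \oo] --> h ->
      inner (power_sum tens (s_ k)) v @[k --> \oo] --> inner h v.
    move=> sh; apply/cvgrPdist_lt => r r0; have v0 : 0 < `|v| + 1 by rewrite ltr_wpDl.
    have rv : 0 < r / (`|v| + 1) by rewrite divr_gt0.
    move/cvgrPdist_lt: sh => /(_ _ rv); apply: filterS => k hk.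
    rewrite -innerBl; apply: le_lt_trans (Cauchy_Schwarz _ _) _.
    apply: (@le_lt_trans _ _ (`|h - power_sum tens (s_ k)| * (`|v| + 1))).
      by rewrite ler_wpM2l// lerDl.
    by rewrite -ltr_pdivlMr.
  have := @limit_pair_null R m (fun k x y => Ff k ((w, x), y)) (fun k x y => Fg k ((w, x), y))
    (fun k => section_poly e1 e2 (sf k) w) (fun k => section_poly e1 e2 (sg k) w)
    (fun s => inner f (tpow tens (e1 + s *: e2))) (fun s => inner g (tpow tens (e1 + s *: e2))) A.
  rewrite !scale0r !addr0 => /(_ (fun k => bisize_section_poly _ _ _ _)
    (fun k => bisize_section_poly _ _ _ _)
    (fun k t s => bieval_section_poly _ _ _ _) (fun k t s => bieval_section_poly _ _ _ _)
    cvf cvg_) H1.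
  have {}H1 := fun c1 c2 => H1 c1 c2 fe1 (ex_intro _ s0 gs) mA A0.
  have aeA : {ae mu, forall x, {ae mu, forall y, ~ A (limn (fun k => Ff k ((w, x), y)), limn (fun k => Fg k ((w, x), y)))}}.
    apply: H1 => s.
      by under eq_fun do rewrite section_poly_top; exact: cinner.
    by under eq_fun do rewrite section_poly_top; exact: cinner.
  apply: (@filterS _ _ (ae_filter_ringOfSetsType _)) aeA => x.
  apply: (@filterS _ _ (ae_filter_ringOfSetsType _)) => y nA [[cf cg]] /=.
  by rewrite (seq_limitE cf) (seq_limitE cg).
have mFG : measurable [set w | A (I f w, I g w)].
  by rewrite -[X in measurable X]setTI; apply: measurable_fun_pair.
apply/negligibleP => //.
have nSA : P.-negligible [set w : Omega | SA (phi w)] by apply/negligibleP => //; exact: mphi.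
have nC : P.-negligible (~` [set w | (Ff k (phi w) @[k --> \oo] --> I f w) /\
    (Fg k (phi w) @[k --> \oo] --> I g w)]).
  by have : {ae P, forall w, (Ff k (phi w) @[k --> \oo] --> I f w) /\
    (Fg k (phi w) @[k --> \oo] --> I g w)} by apply: filterS2 cF cG => w.
apply: negligibleS (negligibleU nSA nC) => w Aw.
have [[c1 c2]|nc] := pselect ((Ff k (phi w) @[k --> \oo] --> I f w) /\
    (Fg k (phi w) @[k --> \oo] --> I g w)); last by right.
left; split; first by split; apply/cvg_ex; [exists (I f w)|exists (I g w)].
by rewrite /= (seq_limitE c1) (seq_limitE c2).
Qed.

End WienerChaosPair.

(** * Covariance matrices and the equivalences *)

(** For x > 0, x times the form is (a x + b c)^2 + b^2 (x y - c^2). Its value at (c, - x) shows that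
    the determinant is nonnegative, and is a zero of the form when the determinant vanishes;
    conversely a zero kills both summands. *)
Lemma nonneg_form_det (R : realFieldType) (x y c : R) :
    (forall a b : R, 0 <= a ^+ 2 * x + b ^+ 2 * y + 2 * (a * b * c)) ->
  x * y - c * c = 0 <-> exists a b : R,
    (a, b) != (0, 0) /\ a ^+ 2 * x + b ^+ 2 * y + 2 * (a * b * c) = 0.
Proof.
move=> Q0; have [x0|x0] := eqVneq x 0.
  have c0 : c = 0.
    have y0 : 0 <= y by have := Q0 0 1; lra.
    (* At this point the form is - (y + 2) c^2, which forces [c = 0]. *)
    have := Q0 (- (y + 1)) c; rewrite x0 => Q1.
    have yc : 0 <= y * c ^+ 2 by rewrite mulr_ge0// sqr_ge0.
    by apply/eqP; rewrite -sqrf_eq0 eq_le sqr_ge0 andbT; lra.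
  rewrite x0 c0 !mul0r subr0; split=> [_|//].
  exists 1, 0; split; last by ring.
  by rewrite xpair_eqE oner_eq0.
have x_gt0 : 0 < x by rewrite lt_def x0; have := Q0 1 0; rewrite expr1n expr0n/=; lra.
have det0 : 0 <= x * y - c * c.
  by rewrite -(pmulr_rge0 _ x_gt0); have := Q0 c (- x); lra.
split=> [D0|[a [b [ab Qab]]]].
  exists c, (- x); split; first by rewrite xpair_eqE oppr_eq0 (negbTE x0) andbF.
  by rewrite -[RHS](mulr0 x) -D0; ring.
have xQ : (a * x + b * c) ^+ 2 + b ^+ 2 * (x * y - c * c) = 0.
  by rewrite -[RHS](mulr0 x) -Qab; ring.
have /andP[/eqP s0 /eqP bD] : ((a * x + b * c) ^+ 2 == 0) && (b ^+ 2 * (x * y - c * c) == 0).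
  by rewrite -paddr_eq0 ?sqr_ge0 ?(mulr_ge0 (sqr_ge0 b) det0)//; apply/eqP.
move/eqP: bD; rewrite mulf_eq0 sqrf_eq0 => /orP[/eqP b0|/eqP//].
move/eqP: s0; rewrite b0 mul0r addr0 sqrf_eq0 mulf_eq0 (negbTE x0) orbF => a0.
by rewrite (eqP a0) b0 eqxx in ab.
Qed.

Lemma determinant2 (R : comNzRingType) (A : 'M[R]_2) :
  \det A = A 0 0 * A 1 1 - A 0 1 * A 1 0.
Proof.
rewrite (expand_det_row _ 0) !big_ord_recl big_ord0 addr0 /cofactor !det_mx11 !mxE /=.
rewrite expr0 expr1 mul1r mulN1r mulrN.
congr (_ * A _ _ - A _ _ * A _ _); exact: val_inj.
Qed.

Section Degeneracy.
Context {R : realType} {d : measure_display} {Omega : measurableType d}.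
Variable P : probability Omega R.

Lemma Lfun2_of_square (X : {RV P >-> R}) :
  (\int[P]_w (X w ^+ 2)%:E < +oo)%E -> (X : Omega -> R) \in Lfun P 2%:E.
Proof.
move=> X2; rewrite inE; apply/andP; split; rewrite inE/=; first exact: measurable_funP.
rewrite /finite_norm unlock; apply: poweR_lty.
rewrite (eq_integral (fun w => (X w ^+ 2)%:E))// => w _.
by rewrite /= powR_mulrn// real_normK// num_real.
Qed.

Lemma variance0P (X : {RV P >-> R}) :
  'V_P[X]%E = 0%E <-> {ae P, forall w, X w = fine 'E_P[X]}.
Proof.
have mD : measurable_fun setT (fun w => ((X w - fine 'E_P[X]) * (X w - fine 'E_P[X]))%:E).
  by apply/measurable_EFinP; apply: measurable_funM; exact: measurable_funB.
have := ae_eq_integral_abs P measurableT mD.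
under eq_integral do rewrite gee0_abs ?lee_fin -?expr2 ?sqr_ge0//.
have -> : 'V_P[X]%E = (\int[P]_w ((X w - fine 'E_P[X]) ^+ 2)%:E)%E.
  by rewrite /variance !unlock.
move=> [H1 H2]; split=> [V0|X0].
  have := H1 V0; apply: filterS => w /(_ Logic.I)/= [/eqP].
  by rewrite -expr2 sqrf_eq0 subr_eq0 => /eqP.
by apply: H2; apply: filterS X0 => w -> _ /=; rewrite subrr mulr0.
Qed.

Variables X Y : {RV P >-> R}.
Hypotheses (X2 : (X : Omega -> R) \in Lfun P 2%:E) (Y2 : (Y : Omega -> R) \in Lfun P 2%:E).

Definition combination (a b : R) : {RV P >-> R} :=
  HB.pack (fun w => a * X w + b * Y w) (isMeasurableFun.Build _ _ _ _ (fun w => a * X w + b * Y w)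
    (measurable_funD (measurable_funM (measurable_cst a) (measurable_funP X))
                     (measurable_funM (measurable_cst b) (measurable_funP Y)))).

Lemma variance_combination a b : ('V_P[combination a b] =
  (a ^+ 2 * fine (covariance P X X) + b ^+ 2 * fine (covariance P Y Y) +
   2 * (a * b * fine (covariance P X Y)))%:E)%E.
Proof.
have Pfin : P setT \is a fin_num by exact: fin_num_measure.
have L1 := @Lfun_subset12 _ _ _ P Pfin.
have fc (U V : Omega -> R) : U \in Lfun P 2%:E -> V \in Lfun P 2%:E ->
    covariance P U V = (fine (covariance P U V))%:E.
  move=> U2 V2; rewrite fineK//.
  exact: covariance_fin_num (L1 _ U2) (L1 _ V2) (Lfun2_mul_Lfun1 U2 V2).
have -> : (combination a b : Omega -> R) = (a \o* X) \+ (b \o* Y).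
  by apply/funext => w /=; rewrite ![_ * a]mulrC ![_ * b]mulrC.
have aX2 : a \o* X \in Lfun P 2%:E by rewrite Lfun_scale// ler1n.
have bY2 : b \o* Y \in Lfun P 2%:E by rewrite Lfun_scale// ler1n.
rewrite varianceD// !varianceZ//.
rewrite (covarianceZl _ (L1 _ X2) (L1 _ bY2) (Lfun2_mul_Lfun1 X2 bY2)).
rewrite (covarianceZr _ (L1 _ X2) (L1 _ Y2) (Lfun2_mul_Lfun1 X2 Y2)).
rewrite /variance (fc X X)// (fc Y Y)// (fc X Y)//=.
by rewrite -!EFinM -!EFinD !mulrA.
Qed.

Lemma det_covariance_eq0P : \det (covariance_matrix [tuple X; Y]) = 0 <->
  exists a b, (a, b) != (0, 0) /\ 'V_P[combination a b]%E = 0%E.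
Proof.
rewrite determinant2 !mxE /= !(tnth_nth X)/= (covarianceC P Y X).
rewrite nonneg_form_det => [|a b]; last first.
  by rewrite -lee_fin -variance_combination variance_ge0.
split=> -[a [b [ab V0]]]; exists a, b; split=> //; first by rewrite variance_combination V0.
by move: V0; rewrite variance_combination => -[].
Qed.

Lemma proportional_det : proportional X Y -> \det (covariance_matrix [tuple X; Y]) = 0.
Proof.
move=> [a [b [ab XY0]]]; apply/det_covariance_eq0P; exists a, b; split => //.
apply/variance0P; suff -> : 'E_P[combination a b]%E = 0%E by [].
rewrite unlock (ae_eq_integral (cst 0%E)) ?integral0//.
  by apply/measurable_EFinP; exact: measurable_funP.
by apply: filterS XY0 => w /= -> _.
Qed.

Lemma line_null (a b c : R) : (a, b) != (0, 0) ->
  (@lebesgue_measure R \x @lebesgue_measure R)%E [set z | a * z.1 + b * z.2 = c] = 0%E.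
Proof.
set S := [set _ | _] => ab.
have mS : measurable (S : set (R * R)).
  apply: measurable_eqr => //.
  by apply: measurable_funD; apply: measurable_funM.
have [b0|b0] := eqVneq b 0.
  have a0 : a != 0 by move: ab; rewrite b0 xpair_eqE eqxx andbT.
  apply/(product_null_ysection (@lebesgue_measure R) (@lebesgue_measure R) mS); apply: aeW => y.
  rewrite (_ : ysection S y = [set c / a]); first exact: lebesgue_measure_set1.
  apply/seteqP; split => x; rewrite /ysection/= inE /S/= b0 mul0r addr0.
    by move=> <-; rewrite mulrC mulKf.
  by move=> ->; rewrite mulrC divfK.
apply/(product_null_xsection (@lebesgue_measure R) (@lebesgue_measure R) mS); apply: aeW => x.
rewrite (_ : xsection S x = [set (c - a * x) / b]); first exact: lebesgue_measure_set1.
apply/seteqP; split => y; rewrite /xsection/= inE /S/=.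
  by move=> <-; rewrite addrAC subrr add0r mulrC mulKf.
by move=> ->; rewrite [b * _]mulrC divfK// subrKC.
Qed.

(** A combination of variance 0 is almost surely equal to its mean, so the law lives on an affine
    line, whatever the means are. *)
Lemma degenerate_no_density : \det (covariance_matrix [tuple X; Y]) = 0 ->
  ~ has_joint_density X Y.
Proof.
move=> /det_covariance_eq0P[a [b [ab /variance0P V0]]].
set c := fine _ in V0.
pose S : set (R * R) := [set z | a * z.1 + b * z.2 = c].
have mS : measurable S.
  apply: measurable_eqr => //.
  by apply: measurable_funD; apply: measurable_funM.
move=> /null_content_dominatesP /(_ S mS (line_null c ab)).
rewrite /pushforward => PS; suff : P setT = 0%E.
  by rewrite probability_setT => /eqP; rewrite eqe oner_eq0.
have mXY : measurable [set w | S (X w, Y w)].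
  by rewrite -[A in measurable A]setTI; apply: measurable_fun_pair.
apply/negligibleP => //.
have n1 : P.-negligible [set w | S (X w, Y w)] by apply/negligibleP.
apply: negligibleS (negligibleU n1 V0) => w _.
by have [h|h] := pselect (S (X w, Y w)); [left|right].
Qed.

End Degeneracy.

Section Dichotomy.
Context {R : realType} {d : measure_display} {Omega : measurableType d}.
Context (P : probability Omega R) {H T : hilbertType R} {m : nat}.
Variables (W : H -> {RV P >-> R}) (tens : ('I_m.+1 -> H) -> T) (I : T -> {RV P >-> R}).
Hypotheses (isoW : isonormal W) (tensT : tensor_power tens).
Hypothesis intI : multiple_integral W tens I.
Variables f g : T.
Hypotheses (symf : symmetric_tensor tens f) (symg : symmetric_tensor tens g).

(** For linearly independent [f] and [g], [pair_null] would give a density. A linear relation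
    between them passes to the integrals. *)
Lemma no_density_proportional : ~ has_joint_density (I f) (I g) -> proportional (I f) (I g).
Proof.
move=> nd; have [a [b [ab fg0]]] : exists a b : R, (a, b) != (0, 0) /\ a *: f + b *: g = 0.
  apply: contrapT => nfg; apply: nd; apply/null_content_dominatesP => A mA A0.
  apply: (pair_null isoW tensT intI symf symg _ mA A0) => a b ab0.
  have [/eqP[-> ->]//|ab] := boolP ((a, b) == (0, 0)).
  by exfalso; apply: nfg; exists a, b.
exists a, b; split => //.
have [b0|b0] := eqVneq b 0.
  have a0 : a != 0 by move: ab; rewrite b0 xpair_eqE eqxx andbT.
  move: fg0; rewrite b0 scale0r addr0 => /eqP; rewrite scaler_eq0 (negbTE a0)/= => /eqP ->.
  have := multiple_integral0 intI symf.
  by apply: filterS => w ->; rewrite mulr0 mul0r addr0.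
(* [integral_linear] leaves its second summand unscaled, whence the division by [b]. *)
have := integral_linear intI (a / b) symf symg.
have -> : (a / b) *: f + g = 0.
  by apply: (scalerI b0); rewrite scaler0 scalerDr scalerA mulrC divfK.
apply: filterS2 (multiple_integral0 intI symf) => w -> E0.
by rewrite -(mulr0 b) E0 mulrDr mulrA [b * (_ / _)]mulrC divfK.
Qed.

Lemma Lfun2_integral h : symmetric_tensor tens h -> (I h : Omega -> R) \in Lfun P 2%:E.
Proof. by move=> symh; apply: Lfun2_of_square; rewrite (integral_isometry intI)// ltry. Qed.

End Dichotomy.

Theorem theorem3 (R : realType) (d : measure_display)
    (Omega : measurableType d) (P : probability Omega R)
    (H : hilbertType R) (sepH : separable_space H)
    (W : H -> {RV P >-> R}) (isoW : isonormal W) (genW : generated_by W)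
    (m : nat) (m_ge1 : (1 <= m)%N) (m_le4 : (m <= 4)%N)
    (T : hilbertType R) (tens : ('I_m -> H) -> T) (tensT : tensor_power tens)
    (I : T -> {RV P >-> R}) (intI : multiple_integral W tens I)
    (f g : T) (symf : symmetric_tensor tens f) (symg : symmetric_tensor tens g) :
  let F := I f in
  let G := I g in
  let C := covariance_matrix [tuple F; G] in
  (~ has_joint_density F G <-> \det C = 0) /\
  (~ has_joint_density F G <-> proportional F G).
Proof.
case: m m_ge1 {m_le4} tens tensT intI symf symg => // m _ tens tensT intI symf symg F G C.
have F2 := Lfun2_integral intI symf; have G2 := Lfun2_integral intI symg.
have pd := proportional_det F2 G2; have dd := degenerate_no_density F2 G2.
have np := no_density_proportional isoW tensT intI symf symg.
(* The implications form a cycle: proportional, singular covariance, no density, proportional. *)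
by split; split => [/np|]; [exact: pd|exact: dd|by []|move=> /pd/dd].
Qed.
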